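(* Let $\pi(\theta)=\mathcal{N}(\theta;\mu,Q^{-1})$ be Gaussian on $\mathbb{R}^p$ with positive definite $Q$, $\theta=(\theta_0,\dots,\theta_K)$ divided into $K+1$ blocks, $(\mathcal{C},\mathcal{U})$ a partition of $\{0,\dots,K\}$ with $\mathcal{U}\ne\emptyset$, and let $\mathcal{Q}$, $V(q\Vert\pi)$ and $q^*=\arg\max_{q\in\mathcal{Q}}V(q\Vert\pi)$ be as defined in the context. Consider the random-scan partially factorized coordinate ascent algorithm: starting from densities $q_0(\theta_k)$, $k\in\mathcal{U}$, at each update an index $k$ is drawn uniformly at random from $\mathcal{U}$, independently of the past, and the factor $q(\theta_k)$ is replaced by $q^{\mathrm{new}}(\theta_k)\propto\exp\{\mathbb{E}_{q(\theta_{\mathcal{U}\setminus k})}[\log\pi(\theta_{\mathcal{U}})]\}$ (where $\pi(\theta_{\mathcal{U}})$ is the marginal of $\pi$ and $q(\theta_{\mathcal{U}\setminus k})=\prod_{m\in\mathcal{U},m\ne k}q(\theta_m)$ are the current factors), all other factors being unchanged. After $s$ updates, set $q_s(\theta)=\pi(\theta_{\mathcal{C}}\mid\theta_{\mathcal{U}})\prod_{k\in\mathcal{U}}q_s(\theta_k)$. Write $u=|\mathcal{U}|$. Then for every starting point with $V(q_0\Vert\pi)>-\infty$ and every integer $s\ge0$, $$\mathbb{E}\big[V(q^*\Vert\pi)-V(q_s\Vert\pi)\big]\le\Big(1-\frac{UQF(q^*\Vert\pi)}{u}\Big)^{s}\big(V(q^*\Vert\pi)-V(q_0\Vert\pi)\big).$$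 Moreover, there exists a starting point $q_0^\dagger$ such that for every integer $s\ge0$, $$\mathbb{E}\big[V(q^*\Vert\pi)-V(q_s\Vert\pi)\big]\ge\Big(1-\frac{UQF(q^*\Vert\pi)}{u}\Big)^{2s}\big(V(q^*\Vert\pi)-V(q^\dagger_0\Vert\pi)\big).$$ Expectations are with respect to the random choice of coordinates. (In particular, after $t$ full ''iterations'' consisting of $s=ut$ updates, the rate is $(1-UQF(q^*\Vert\pi)/u)^{ut}$ for the upper bound and $(1-UQF(q^*\Vert\pi)/u)^{2ut}$ for the lower bound.)
   Context: $\theta_{\mathcal{C}}=(\theta_k)_{k\in\mathcal{C}}$, $\theta_{\mathcal{U}}=(\theta_k)_{k\in\mathcal{U}}$; $\mathcal{Q}=\{q: q(\theta)=q(\theta_{\mathcal{C}}\mid\theta_{\mathcal{U}})\prod_{k\in\mathcal{U}}q(\theta_k)\}$; $V(q\Vert\pi)=\mathbb{E}_{q(\theta)}[\log\pi(\theta)-\log q(\theta)]$ (the maximizer $q^*$ over $\mathcal{Q}$ exists and is unique). The uncertainty quantification fraction is $UQF(q\Vert\pi)=\inf_{v\in\mathbb{R}^p\setminus\{0\}}\frac{\mathrm{var}_{q}(\theta^Tv)}{\mathrm{var}_{\pi}(\theta^Tv)}$. *)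

(* Defs.v *)
From HB Require Import structures.
From mathcomp Require Import all_boot all_order all_algebra.
From mathcomp Require Import all_classical all_reals all_analysis.
Set Implicit Arguments. Unset Strict Implicit. Unset Printing Implicit Defensive.
Import Order.TTheory GRing.Theory Num.Theory.
Local Open Scope classical_set_scope.
Local Open Scope ring_scope.

Section PFCAVI.
Variable R : realType.
Variables p K : nat.
(* blk i = index of the block containing coordinate i of theta in R^p *)
Variable blk : 'I_p -> 'I_K.+1.
(* the set U of "unrestricted / factorized" blocks; C is its complement ~: U *)
Variable U : {set 'I_K.+1}.
Variable mu : 'rV[R]_p.
Variable Q : 'M[R]_p.

(* theta in R^p is represented as a p-tuple (carries the Borel product sigma-algebra) *)
Definition vec (x : p.-tuple R) : 'rV[R]_p := \row_i tnth x i.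

Definition set_coord (x : p.-tuple R) (i : 'I_p) (t : R) : p.-tuple R :=
  [tuple (if j == i then t else tnth x j) | j < p].

Definition origin : p.-tuple R := [tuple (0 : R) | _ < p].

(* Lebesgue integral of a nonnegative function over the coordinates listed in S,
   the remaining coordinates being those of x (iterated one-dimensional integrals,
   which by Tonelli is the Lebesgue integral over R^|S|). *)
Fixpoint iint (S : seq 'I_p) (f : p.-tuple R -> \bar R) (x : p.-tuple R) : \bar R :=
  match S with
  | [::] => f x
  | i :: S' => (\int[lebesgue_measure]_t iint S' f (set_coord x i t))%E
  end.

Definition sint (S : seq 'I_p) (h : p.-tuple R -> R) (x : p.-tuple R) : \bar R :=
  (iint S (fun y => (Num.max (h y) 0)%:E) x - iint S (fun y => (Num.max (- h y) 0)%:E) x)%E.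

Definition coords (B : {set 'I_K.+1}) : seq 'I_p := [seq i <- enum 'I_p | blk i \in B].
Definition allc : seq 'I_p := enum 'I_p.

Definition posdef (A : 'M[R]_p) : Prop :=
  A^T = A /\ forall v : 'rV[R]_p, v != 0 -> 0 < (v *m A *m v^T) 0 0.

Definition gauss (x : p.-tuple R) : R :=
  (Num.sqrt (2 * pi)) ^- p * Num.sqrt (\det Q) *
  expR (- (1 / 2) * (((vec x - mu) *m Q *m (vec x - mu)^T) 0 0)).

Definition pi_marg (x : p.-tuple R) : R := fine (iint (coords (~: U)) (fun y => (gauss y)%:E) x).

Definition cond_pi (x : p.-tuple R) : R := gauss x / pi_marg x.

Definition block_density (k : 'I_K.+1) (f : p.-tuple R -> R) : Prop :=
  [/\ forall x, 0 <= f x,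
      measurable_fun setT f,
      forall x y, (forall i, blk i = k -> tnth x i = tnth y i) -> f x = f y
    & forall x, iint (coords [set k]) (fun y => (f y)%:E) x = 1%E].

(* V(q || pi) = E_q[log pi(theta) - log q(theta)] (with 0 * log 0 = 0) *)
Definition V (q : p.-tuple R -> R) : \bar R :=
  sint allc (fun x => q x * (ln (gauss x) - ln (q x))) origin.

Definition in_Q (q : p.-tuple R -> R) : Prop :=
  exists (c : p.-tuple R -> R) (qs : 'I_K.+1 -> p.-tuple R -> R),
    [/\ forall k, k \in U -> block_density k (qs k),
        forall x, 0 <= c x,
        measurable_fun setT c,
        forall x, iint (coords (~: U)) (fun y => (c y)%:E) x = 1%E
      & forall x, q x = c x * \prod_(k in U) qs k x].

Definition mf (qs : 'I_K.+1 -> p.-tuple R -> R) (x : p.-tuple R) : R :=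
  cond_pi x * \prod_(k in U) qs k x.

Definition upd (qs : 'I_K.+1 -> p.-tuple R -> R) (k : 'I_K.+1) (x : p.-tuple R) : R :=
  let g y := expR (fine (sint (coords (U :\ k))
                   (fun z => (\prod_(m in U :\ k) qs m z) * ln (pi_marg z)) y)) in
  g x / fine (iint (coords [set k]) (fun y => (g y)%:E) x).

Definition step (qs : 'I_K.+1 -> p.-tuple R -> R) (k : 'I_K.+1) :
  'I_K.+1 -> p.-tuple R -> R :=
  fun m => if m == k then upd qs k else qs m.

Definition run (qs : 'I_K.+1 -> p.-tuple R -> R) (w : seq 'I_K.+1) := foldl step qs w.

(* E[V(q* || pi) - V(q_s || pi)] for the random scan: uniform average over all
   sequences of s indices drawn from U *)
Definition exp_gap (qstar : p.-tuple R -> R) (qs0 : 'I_K.+1 -> p.-tuple R -> R) (s : nat) : \bar R :=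
  (((#|U| ^ s)%:R)^-1%:E *
   \sum_(w : {ffun 'I_s -> 'I_K.+1} | [forall i, w i \in U])
      (V qstar - V (mf (run qs0 [seq w i | i <- enum 'I_s]))))%E.

Definition var (q : p.-tuple R -> R) (v : 'rV[R]_p) : \bar R :=
  let f x := (vec x *m v^T) 0 0 in
  let m := fine (sint allc (fun x => q x * f x) origin) in
  sint allc (fun x => q x * (f x - m) ^+ 2) origin.

Definition UQF (q : p.-tuple R -> R) : R :=
  inf [set fine (var q v) / fine (var gauss v) | v in [set v : 'rV[R]_p | v != 0]].

End PFCAVI.

(* Main.v *)
(* Let S be the Schur complement of Q on the coordinates in U (the precision of
   pi(theta_U)) and D its block-diagonal part.  For q in the mean-field family with
   block means m_k, put d = m - mu on the coordinates in U.  Then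
     V(q* || pi) - V(q || pi) = 1/2 d S d^T + sum_k KL(q_k || N(m_k, S_kk^-1)).
   Updating block k sets the k-th divergence to 0 and minimises 1/2 d S d^T exactly
   over the k-th block of d.  With lambda the smallest eigenvalue of S relative to D,
   the average over k of the quadratic part contracts by 1 - lambda / u, and
   UQF(q* || pi) = lambda, since q* is Gaussian with precision Q - S + D.  As lambda <= 1, the divergences contract at least
   as fast.
   For the lower bound, start at N(mu_k + d0_k, S_kk^-1) with d0 a minimising
   eigenvector: E[d_s] S d0^T = (1 - lambda / u)^s d0 S d0^T, and
   d S d^T >= 2 x d S d0^T - x^2 d0 S d0^T with x = (1 - lambda / u)^s. *)
Require Import Defs.
From HB Require Import structures.
From mathcomp Require Import all_boot all_order all_algebra.
From mathcomp Require Import all_classical all_reals all_analysis.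
From mathcomp Require Import measurable_realfun lebesgue_integral.
From mathcomp Require Import ring lra.
Set Implicit Arguments. Unset Strict Implicit. Unset Printing Implicit Defensive.
Import Order.TTheory GRing.Theory Num.Theory.
Import numFieldNormedType.Exports.
Local Open Scope classical_set_scope.
Local Open Scope ring_scope.

(** * Iterated integrals over coordinates *)

(** UQF compares variances, that is inverses of precision matrices, whereas the contraction needs a
    bound on the precisions. Write Qs = Q - S + D. Inversion reverses the order of forms, so for t
    >= 0 the bound t Q^-1 <= Qs^-1 amounts to t Qs <= Q; as Q and Qs share the summand Q - S, for 0
    <= t <= 1 this is t D <= S. So lambda enters as an infimum; it is attained because a positive
    definite S - lambda D would leave room for a larger t.

    The analytic obstacle is that the initial factors are arbitrary densities. Before block means or
    the gap formula make sense, V > -oo has to yield finite second moments and a finite divergence;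
    both come from comparing q pointwise with integrable Gaussians. Divergences are integrals of a
    nonnegative integrand, so that Tonelli suffices even when they are infinite. Gaussian masses and
    moments are computed directly from iterated integrals, using volume-preserving maps only.

    The maximiser q* is given abstractly and is identified only almost everywhere, which is enough
    because UQF sees it through integrals. *)

Section SetCoord.
Variables (R : realType) (p : nat).
Implicit Types (x y : p.-tuple R) (i j : 'I_p) (t : R).

Lemma tnth_set_coord x i t j :
  tnth (set_coord x i t) j = if j == i then t else tnth x j.
Proof. by rewrite tnth_mktuple. Qed.

Lemma set_coord_swap x i j s t : i != j ->
  set_coord (set_coord x i s) j t = set_coord (set_coord x j t) i s.
Proof.
move=> ij; apply: eq_from_tnth => l; rewrite !tnth_set_coord.
by case: (eqVneq l j) => // ->; rewrite eq_sym (negbTE ij).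
Qed.

Lemma set_coord_id x i s t : set_coord (set_coord x i s) i t = set_coord x i t.
Proof. by apply: eq_from_tnth => l; rewrite !tnth_set_coord; case: eqP. Qed.

Lemma measurable_set_coord i d (X : measurableType d) (f : X -> p.-tuple R)
    (g : X -> R) : measurable_fun setT f -> measurable_fun setT g ->
  measurable_fun setT (fun u : X => set_coord (f u) i (g u)).
Proof.
move=> mf mg; apply/measurable_fun_tnthP => j.
rewrite (_ : _ \o _ = fun u : X => if j == i then g u else tnth (f u) j); last first.
  by apply/funext => u /=; rewrite tnth_set_coord.
case: (j == i) => //.
exact: (measurableT_comp (measurable_tnth j) mf).
Qed.

End SetCoord.

Section Iint.
Variables (R : realType) (p : nat).
Local Notation T := (p.-tuple R).
Implicit Types (x y : T) (i j : 'I_p) (t : R) (S : seq 'I_p) (f g : T -> \bar R).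
Local Open Scope ereal_scope.

Lemma iint_ge0 S f x : (forall y, 0 <= f y) -> 0 <= iint S f x.
Proof.
move=> f0; elim: S x => [|i S IH] x //=.
by apply: integral_ge0 => t _; exact: IH.
Qed.

(** For each further coordinate the integrand is jointly measurable in the point and in the new
    value, so the measurability part of Tonelli's theorem applies. *)
Lemma measurable_iint S f : measurable_fun setT f -> (forall y, 0 <= f y) ->
  measurable_fun setT (iint S f).
Proof.
move=> mf f0; elim: S => [|i S IH] //=.
have mh : measurable_fun setT (fun z : T * measurableTypeR R => iint S f (set_coord z.1 i z.2)).
  apply: (measurableT_comp IH); apply: measurable_set_coord => //.
exact: (measurable_fun_fubini_tonelli_F (m2 := lebesgue_measure) _ mh
  (fun z => iint_ge0 S _ f0)).
Qed.

Lemma measurable_iint_coord S f x i : measurable_fun setT f -> (forall y, 0 <= f y) ->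
  measurable_fun setT (fun t : measurableTypeR R => iint S f (set_coord x i t)).
Proof.
move=> mf f0; apply: (measurableT_comp (measurable_iint S mf f0)).
apply: measurable_set_coord => //.
Qed.

Lemma eq_iint S f g x : (forall y, (forall i, i \notin S -> tnth y i = tnth x i) -> f y = g y) ->
  iint S f x = iint S g x.
Proof.
elim: S x => [|i S IH] x fg /=; first by apply: fg.
apply: eq_integral => t _; apply: IH => y Hy; apply: fg => j.
rewrite inE negb_or => /andP[ji jS]; rewrite Hy// tnth_set_coord.
by rewrite (negbTE ji).
Qed.

Lemma iint_cat S1 S2 f x : iint (S1 ++ S2) f x = iint S1 (iint S2 f) x.
Proof.
elim: S1 x => [|i S IH] x //=.
by apply: eq_integral => t _; rewrite IH.
Qed.

Lemma le_iint S f g x : measurable_fun setT f -> (forall y, 0 <= f y) ->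
  measurable_fun setT g -> (forall y, f y <= g y) -> iint S f x <= iint S g x.
Proof.
move=> mf f0 mg fg; have g0 y : 0 <= g y by exact: le_trans (fg y).
elim: S x => [|i S IH] x //=.
apply: ge0_le_integral => //.
- by move=> t _; exact: iint_ge0.
- exact: measurable_iint_coord.
- exact: measurable_iint_coord.
Qed.

Lemma iintD S f g x : measurable_fun setT f -> (forall y, 0 <= f y) ->
  measurable_fun setT g -> (forall y, 0 <= g y) ->
  iint S (fun y => f y + g y) x = iint S f x + iint S g x.
Proof.
move=> mf f0 mg g0; elim: S x => [|i S IH] x //=.
under eq_integral do rewrite IH.
by rewrite ge0_integralD//; do ?[exact: measurable_iint_coord|
  by move=> *; exact: iint_ge0].
Qed.

(* [g] is constant along the integrated coordinates, hence can be pulled out *)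
Lemma iint_Mindep S f g x : measurable_fun setT f -> (forall y, 0 <= f y) ->
  (forall y, 0 <= g y) ->
  (forall y, (forall i, i \notin S -> tnth y i = tnth x i) -> g y = g x) ->
  iint S (fun y => g y * f y) x = g x * iint S f x.
Proof.
move=> mf f0 g0; elim: S x => [|i S IH] x gS //=.
under eq_integral.
  move=> t _; rewrite IH; last first.
    move=> y Hy; rewrite !gS// => j; rewrite inE negb_or => /andP[ji jS].
      by rewrite tnth_set_coord (negbTE ji).
    by rewrite Hy// tnth_set_coord (negbTE ji).
  rewrite gS; last first.
    by move=> j; rewrite inE negb_or => /andP[ji jS]; rewrite tnth_set_coord (negbTE ji).
  over.
rewrite ge0_integralZl//; [exact: measurable_iint_coord|by move=> ? _; exact: iint_ge0].
Qed.

(** Tonelli on the plane of the two coordinates; distinctness makes the two assignments commute. *)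
Lemma iint_swap i j S f x : i != j -> measurable_fun setT f -> (forall y, 0 <= f y) ->
  iint [:: i, j & S] f x = iint [:: j, i & S] f x.
Proof.
move=> ij mf f0 /=.
pose F (z : measurableTypeR R * measurableTypeR R) :=
  iint S f (set_coord (set_coord x i z.1) j z.2).
have mF : measurable_fun setT F.
  apply: (measurableT_comp (measurable_iint S mf f0)).
  by apply: measurable_set_coord => //; apply: measurable_set_coord.
have F0 z : 0 <= F z by exact: iint_ge0.
have := fubini_tonelli (m1 := lebesgue_measure) (m2 := lebesgue_measure) F mF F0.
rewrite /F /= => ->; apply: eq_integral => t _; apply: eq_integral => s _.
by rewrite set_coord_swap.
Qed.

Lemma perm_iint S1 S2 f x : uniq S1 -> perm_eq S1 S2 ->
  measurable_fun setT f -> (forall y, 0 <= f y) -> iint S1 f x = iint S2 f x.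
Proof.
move=> + + mf f0.
(* Carries the head coordinate past a whole prefix by successive swaps; a general permutation then
   follows by induction. *)
have key i S x' : i \notin S -> uniq S -> forall S1', S = S1' -> 
  forall S2', iint (i :: S1' ++ S2') f x' = iint (S1' ++ i :: S2') f x'.
  move=> + + S1' SE S2'; subst S; elim: S1' x' => [|j S' IH] x' //=.
  rewrite inE negb_or => /andP[ij iS] /andP[jS uS].
  rewrite -/(iint [:: i, j & S' ++ S2'] f x') iint_swap//=.
  by apply: eq_integral => t _; rewrite -IH.
elim: S1 S2 x => [|i S1 IH] S2 x; first by move=> _; rewrite perm_sym => /perm_nilP ->.
move=> /= /andP[iS1 uS1] pS.
have iS2 : i \in S2 by rewrite -(perm_mem pS) mem_head.
have uS2 : uniq S2 by rewrite -(perm_uniq pS) /= iS1.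
move: pS uS2; case/splitPr: iS2 => A B pS.
rewrite cat_uniq /= => /and4P[uA].
rewrite negb_or => /andP[iA _] iB uB.
rewrite -(key i A x)//=; apply: eq_integral => t _; apply: IH => //.
by rewrite -(perm_cons i) (perm_trans pS)// perm_catC /= perm_cons perm_catC.
Qed.

Lemma iint0 S x : iint S (fun=> 0) x = 0.
Proof.
elim: S x => [|i S IH] x //=.
by under eq_integral do rewrite IH; rewrite integral0.
Qed.

(** Monotone convergence, applied once per coordinate. It gives both the sigma-additivity of [fiber]
    and the passage from simple to general functions in [integral_fiber]. *)
Lemma cvg_iint S (f : (T -> \bar R)^nat) g x :
  (forall n, measurable_fun setT (f n)) -> (forall n y, 0 <= f n y) ->
  (forall y m n, (m <= n)%N -> f m y <= f n y) ->
  (forall y, f ^~ y @ \oo --> g y) ->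
  (fun n => iint S (f n) x) @ \oo --> iint S g x.
Proof.
move=> mf f0 ndf fg; elim: S x => [|i S IH] x /=; first exact: fg.
rewrite [X in _ --> X](_ : _ =
  \int[lebesgue_measure]_t limn (fun n => iint S (f n) (set_coord x i t))); last first.
  by apply: eq_integral => t _; apply/esym/cvg_lim => //; exact: IH.
apply: cvg_monotone_convergence => //.
- by move=> n; exact: measurable_iint_coord.
- by move=> n t _; exact: iint_ge0.
- by move=> t _ m n mn; apply: le_iint => // y; exact: ndf.
Qed.

End Iint.

(** * The measure behind the iterated integrals *)

Section FiberMeasure.
Variables (R : realType) (p : nat).
Local Notation T := (p.-tuple R).
Implicit Types (x y : T) (S : seq 'I_p).
Local Open Scope ereal_scope.

Lemma iint_sum S (I : Type) (r : seq I) (F : I -> T -> \bar R) x :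
  (forall i, measurable_fun setT (F i)) -> (forall i y, 0 <= F i y) ->
  iint S (fun y => \sum_(i <- r) F i y) x = \sum_(i <- r) iint S (F i) x.
Proof.
move=> mF F0; elim: r => [|a r IH].
  by rewrite big_nil -[RHS](iint0 S x); congr iint; apply/funext => y; rewrite big_nil.
rewrite big_cons -IH -iintD//.
- by congr iint; apply/funext => y; rewrite big_cons.
- by apply: emeasurable_sum.
- by move=> y; apply: sume_ge0.
Qed.

Lemma iintZl S (c : \bar R) f x : measurable_fun setT f -> (forall y, 0 <= f y) ->
  0 <= c -> iint S (fun y : T => c * f y) x = c * iint S f x.
Proof. by move=> mf f0 c0; exact: (iint_Mindep (g := fun=> c)). Qed.

(* Lebesgue measure on the affine subspace of the points agreeing with [x] outside [S]. *)
Definition fiber S x (A : set T) : \bar R := iint S (fun y => \d_y A) x.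

Lemma measurable_dirac_fun (A : set T) : measurable A ->
  measurable_fun setT (fun y : T => \d_y A : \bar R).
Proof. by move=> mA; apply/measurable_EFinP; exact: measurable_indic. Qed.

Section fiber_measure.
Variables (S : seq 'I_p) (x : T).

Let fiber0 : fiber S x set0 = 0.
Proof.
rewrite /fiber -[RHS](iint0 S x); congr iint; apply/funext => y.
by rewrite measure0.
Qed.

Let fiber_ge0 A : 0 <= fiber S x A.
Proof. exact: iint_ge0. Qed.

Let fiber_sigma_additive : semi_sigma_additive (fiber S x).
Proof.
move=> F mF tF mUF.
rewrite [X in X @ _ --> _](_ : _ =
    fun n => iint S (fun y => \sum_(0 <= i < n) \d_y (F i)) x); last first.
  apply/funext => n; rewrite iint_sum// => i; exact: measurable_dirac_fun.
apply: cvg_iint.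
- by move=> n; apply: emeasurable_sum => i; exact: measurable_dirac_fun.
- by move=> n y; exact: sume_ge0.
- by move=> y m n mn; exact: lee_sum_nneg_natr.
- by move=> y; exact: measure_semi_sigma_additive.
Qed.

HB.instance Definition _ := isMeasure.Build _ _ _
  (fiber S x) fiber0 fiber_ge0 fiber_sigma_additive.

End fiber_measure.

Import HBNNSimple.

(** True for indicators by construction of the measure, hence for simple functions by additivity,
    hence in general by monotone convergence. *)
Lemma integral_fiber S x (f : T -> \bar R) : measurable_fun setT f ->
  (forall y, 0 <= f y) -> \int[fiber S x]_y f y = iint S f x.
Proof.
move=> mf f0.
have nns (g : {nnsfun T >-> R}) :
    \int[fiber S x]_y (g y)%:E = iint S (fun y => (g y)%:E) x.
  rewrite integralT_nnsfun sintegralE.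
  transitivity (iint S (fun y => \sum_(r \in range g) r%:E * \d_y (g @^-1` [set r])) x).
    have fing : finite_set (range g) by [].
    rewrite (fsbig_finite _ _ fing)//=.
    under [in RHS]eq_fun do rewrite (fsbig_finite _ _ fing)//=.
    (* The values of [g] are nonnegative, but [iint_sum] asks for nonnegative summands at every
       index [r], hence the truncation. *)
    rewrite [RHS](_ : _ = iint S (fun y => \sum_(r <- finmap.enum_fset (fset_set (range g))) 
      (Num.max r 0)%:E * \d_y (g @^-1` [set r])) x).
      rewrite iint_sum.
      - apply: eq_big_seq => r.
        rewrite in_fset_set// inE => -[z _ zr].
        have r0 : (0 <= r)%R by rewrite -zr.
        rewrite max_l// iintZl//.
        by apply: measurable_dirac_fun.
      - move=> r; apply: measurable_funeM; exact: measurable_dirac_fun.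
      - by move=> r y; rewrite mule_ge0// lee_fin le_max lexx orbT.
    congr iint; apply/funext => y; apply: eq_big_seq => r.
    rewrite in_fset_set// inE => -[z _ zr].
    by rewrite max_l// -zr.
  congr iint; apply/funext => y.
  have := integral_dirac y measurableT (f := EFin \o g).
  rewrite diracT mul1e /= => <-; last exact/measurable_EFinP.
  by rewrite integralT_nnsfun sintegralE.
pose g := nnsfun_approx measurableT mf.
transitivity (limn (fun n => \int[fiber S x]_y (g n y)%:E)).
  rewrite -monotone_convergence//.
  - apply: eq_integral => y _; apply/esym/cvg_lim => //; exact: cvg_nnsfun_approx.
  - by move=> n; exact/measurable_EFinP.
  - by move=> n y _; rewrite lee_fin.
  - by move=> y _ m n mn; rewrite lee_fin; exact/lefP/nd_nnsfun_approx.
apply/cvg_lim => //; under eq_fun do rewrite nns.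
apply: cvg_iint.
- by move=> n; exact/measurable_EFinP.
- by move=> n y; rewrite lee_fin.
- by move=> y m n mn; rewrite lee_fin; exact/lefP/nd_nnsfun_approx.
- by move=> y; exact: cvg_nnsfun_approx.
Qed.

(** Opens the signed integrals of the definitions to Lebesgue theory: linearity, domination,
    equality almost everywhere. *)
Lemma sint_fiber S x (h : T -> R) : measurable_fun setT h ->
  sint S h x = \int[fiber S x]_y (h y)%:E.
Proof.
move=> mh; rewrite integralE /sint.
congr (_ - _).
- rewrite integral_fiber//.
    by congr iint; apply/funext => y; rewrite funeposE -EFin_max.
  by apply: measurable_funepos; exact/measurable_EFinP.
- rewrite integral_fiber//.
    by congr iint; apply/funext => y; rewrite funenegE -EFinN -EFin_max.
  by apply: measurable_funeneg; exact/measurable_EFinP.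
Qed.

End FiberMeasure.

(** * Volume-preserving affine substitutions *)

Section ChangeOfVariables.
Variables (R : realType) (p : nat).
Local Notation T := (p.-tuple R).
Implicit Types (x y : T) (S : seq 'I_p).
Local Open Scope ereal_scope.

(** The translate gives each interval []a, b]] its length, and this characterises Lebesgue
    measure. *)
Lemma lebesgue_measureD (c : R) (A : set R) : measurable A ->
  pushforward lebesgue_measure ((fun t => t + c)%R : _ -> measurableTypeR R) A
  = lebesgue_measure A.
Proof.
move=> mA.
have mphi : measurable_fun setT ((fun t => t + c)%R : measurableTypeR R -> measurableTypeR R).
  exact: measurable_funD.
apply/esym/lebesgue_measure_unique => //= _ [[a b]] _ <-.
rewrite /pushforward/=.
rewrite (_ : _ @^-1` _ = `](a - c)%R, (b - c)%R]%classic); last first.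
  apply/seteqP; split=> t /=; rewrite !in_itv/= ltrBlDr lerBrDr; exact.
rewrite !lebesgue_measure_itv/= !lte_fin ltrD2r.
by rewrite -!EFinB opprB addrA subrK.
Qed.

(** With [e] equal to 1 or -1 no Jacobian appears; scalings are confined to the one-dimensional
    Gaussian integral. *)
Lemma integral_signed_shift (e c : R) (f : R -> \bar R) : (e = 1 \/ e = -1)%R ->
  measurable_fun setT f -> (forall t, 0 <= f t) ->
  \int[lebesgue_measure]_t f (e * t + c)%R = \int[lebesgue_measure]_t f t.
Proof.
move=> he mf f0.
have sh (g : R -> \bar R) : measurable_fun setT g -> (forall t, 0 <= g t) ->
    \int[lebesgue_measure]_t g (t + c)%R = \int[lebesgue_measure]_t g t.
  move=> mg g0; symmetry.
  have mphi : measurable_fun setT ((fun t => t + c)%R : measurableTypeR R -> measurableTypeR R).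
    exact: measurable_funD.
  rewrite -(ge0_integral_pushforward mphi lebesgue_measure (D := setT))//=.
  by apply: eq_measure_integral => //= A mA _; exact/esym/lebesgue_measureD.
case: he => ->; first by under eq_integral do rewrite mul1r; exact: sh.
have mh : measurable_fun setT (fun t : measurableTypeR R => f ((t : R) + c)%R).
  by apply: (measurableT_comp mf); exact: measurable_funD.
rewrite -(sh f)//.
transitivity (\int[lebesgue_measure]_(t in setT) ((fun t => f (t + c)%R) \o -%R) t).
  by apply: eq_integral => t _ /=; rewrite mulN1r.
rewrite -[X in \int[_]_(t in X) _](preimage_setT (-%R : R -> R)).
have mN : measurable_fun setT (-%R : measurableTypeR R -> measurableTypeR R) by [].
rewrite -(ge0_integral_pushforward mN lebesgue_measure (D := setT))//=.
by apply: eq_measure_integral => //= A mA _; exact/lebesgue_measureN.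
Qed.

(** The shift of a coordinate may depend on the point, so that one construction covers translations,
    reflections, shears and recentring at a conditional mean. *)
Definition affmap S (e : R) (l : 'I_p -> T -> R) x : T :=
  [tuple (if i \in S then e * tnth x i + l i x else tnth x i)%R | i < p].

Lemma tnth_affmap S e l x i : tnth (affmap S e l x) i =
  if i \in S then (e * tnth x i + l i x)%R else tnth x i.
Proof. by rewrite tnth_mktuple. Qed.

Lemma measurable_affmap S e (l : 'I_p -> T -> R) :
  (forall i, measurable_fun setT (l i)) -> measurable_fun setT (affmap S e l).
Proof.
move=> ml; apply/measurable_fun_tnthP => i.
have -> : (fun y : T => tnth y i) \o affmap S e l =
    fun y : T => if i \in S then (e * tnth y i + l i y)%R else tnth y i.
  by apply/funext => y /=; rewrite tnth_affmap.
case: (i \in S); last exact: measurable_tnth.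
by apply: measurable_funD => //; apply: measurable_funM => //; exact: measurable_tnth.
Qed.

(** The shifts depend only on coordinates that are not integrated, so each one-dimensional integral
    sees a constant shift. *)
Lemma iint_affmap S e (l : 'I_p -> T -> R) f x : uniq S -> (e = 1 \/ e = -1)%R ->
  (forall i, measurable_fun setT (l i)) ->
  (forall i, i \in S -> forall y y', (forall j, j \notin S -> tnth y j = tnth y' j) ->
      l i y = l i y') ->
  measurable_fun setT f -> (forall y, 0 <= f y) ->
  iint S (f \o affmap S e l) x = iint S f x.
Proof.
move=> uS he ml lS mf f0; elim: S uS lS f mf f0 x => [|i S IH].
  move=> _ _ f mf f0 x /=; congr f; apply: eq_from_tnth => j.
  by rewrite tnth_affmap.
move=> /= /andP[iS uS] lS f mf f0 x.
pose g y := f (set_coord y i (e * tnth y i + l i y)%R).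
have mg : measurable_fun setT g.
  apply: (measurableT_comp mf); apply: measurable_set_coord => //.
  by apply: measurable_funD => //; apply: measurable_funM => //; exact: measurable_tnth.
have g0 y : 0 <= g y by exact: f0.
have fg : f \o affmap (i :: S) e l = g \o affmap S e l.
  apply/funext => y /=; congr f; apply: eq_from_tnth => j.
  rewrite tnth_set_coord !tnth_affmap inE.
  case: (eqVneq j i) => [->|ji] //=.
  rewrite (negbTE iS); congr (_ + _)%R; apply: lS; first exact: mem_head.
  by move=> k; rewrite inE negb_or => /andP[_ kS]; rewrite tnth_affmap (negbTE kS).
rewrite fg; under eq_integral.
  move=> t _; rewrite IH//; last first.
    move=> j jS y y' yy'; apply: lS; first by rewrite inE jS orbT.
    by move=> k; rewrite inE negb_or => /andP[_ kS]; exact: yy'.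
  over.
rewrite -[RHS](@integral_signed_shift e (l i x))//; last 2 first.
- exact: measurable_iint_coord.
- by move=> t; exact: iint_ge0.
apply: eq_integral => t _.
(* On the fibre coordinate [i] has the value [t] and the shift is that of [x], so the value assigned
   to [i] is constant for the inner integrals and can be moved out of them. *)
transitivity (iint S (fun y => f (set_coord y i (e * t + l i x)%R)) (set_coord x i t)).
  apply: eq_iint => y yS; rewrite /g.
  rewrite [tnth y i]yS// tnth_set_coord eqxx.
  congr (f (set_coord y i (_ + _)%R)); apply: lS; first exact: mem_head.
  by move=> k; rewrite inE negb_or => /andP[ki kS]; rewrite yS// tnth_set_coord (negbTE ki).
move: (_ + _)%R => c.
elim: S {IH uS lS fg} x t iS => [|j S IH] x t iS /=; first by rewrite set_coord_id.
move: iS; rewrite inE negb_or => /andP[ij iS].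
by apply: eq_integral => s _; rewrite !(set_coord_swap _ _ _ ij) IH.
Qed.

End ChangeOfVariables.

(** * Gaussian integrals *)

Section BilinearForms.
Variables (R : realType) (n : nat).
Implicit Types (A B : 'M[R]_n) (x y z : 'rV[R]_n) (a : R).

Definition bf A x y : R := (x *m A *m y^T) 0 0.
Definition qf A x : R := bf A x x.
Definition psd A := A^T = A /\ forall v, 0 <= qf A v.

Lemma bfDl A x y z : bf A (x + y) z = bf A x z + bf A y z.
Proof. by rewrite /bf !mulmxDl mxE. Qed.
Lemma bfNl A x z : bf A (- x) z = - bf A x z.
Proof. by rewrite /bf !mulNmx mxE. Qed.
Lemma bfBl A x y z : bf A (x - y) z = bf A x z - bf A y z.
Proof. by rewrite bfDl bfNl. Qed.
Lemma bfZl A a x z : bf A (a *: x) z = a * bf A x z.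
Proof. by rewrite /bf -!scalemxAl mxE. Qed.
Lemma bfDr A x y z : bf A z (x + y) = bf A z x + bf A z y.
Proof. by rewrite /bf linearD mulmxDr mxE. Qed.
Lemma bfNr A x z : bf A z (- x) = - bf A z x.
Proof. by rewrite /bf linearN mulmxN mxE. Qed.
Lemma bfBr A x y z : bf A z (x - y) = bf A z x - bf A z y.
Proof. by rewrite bfDr bfNr. Qed.
Lemma bfZr A a x z : bf A z (a *: x) = a * bf A z x.
Proof. by rewrite /bf linearZ /= -scalemxAr mxE. Qed.
Lemma bf0l A x : bf A 0 x = 0.
Proof. by rewrite /bf !mul0mx mxE. Qed.
Lemma bfDm A B x y : bf (A + B) x y = bf A x y + bf B x y.
Proof. by rewrite /bf mulmxDr mulmxDl mxE. Qed.
Lemma bfNm A x y : bf (- A) x y = - bf A x y.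
Proof. by rewrite /bf mulmxN mulNmx mxE. Qed.
Lemma bfBm A B x y : bf (A - B) x y = bf A x y - bf B x y.
Proof. by rewrite bfDm bfNm. Qed.
Lemma bfZm a A x y : bf (a *: A) x y = a * bf A x y.
Proof. by rewrite /bf -scalemxAr -scalemxAl mxE. Qed.
Lemma bf_sum (I : Type) (r : seq I) (P : pred I) (F : I -> 'M[R]_n) x y :
  bf (\sum_(i <- r | P i) F i) x y = \sum_(i <- r | P i) bf (F i) x y.
Proof. by rewrite /bf mulmx_sumr mulmx_suml summxE. Qed.

Lemma bfC A x y : A^T = A -> bf A x y = bf A y x.
Proof.
move=> sA; rewrite /bf -[in LHS]sA.
have -> : x *m A^T *m y^T = (y *m A *m x^T)^T by rewrite !trmx_mul trmxK mulmxA.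
by rewrite mxE.
Qed.

Lemma bfMl A B x y : bf A (x *m B) y = bf (B *m A) x y.
Proof. by rewrite /bf !mulmxA. Qed.
Lemma bfMr A B x y : bf A x (y *m B) = bf (A *m B^T) x y.
Proof. by rewrite /bf trmx_mul !mulmxA. Qed.

Lemma bfE A x y : bf A x y = \sum_i \sum_j A i j * (x 0 i * y 0 j).
Proof.
rewrite /bf mxE exchange_big; apply: eq_bigr => j _ /=; rewrite !mxE mulr_suml.
by apply: eq_bigr => i _; rewrite mulrA [A _ _ * _]mulrC.
Qed.

Lemma bf1 x y : bf 1%:M x y = (x *m y^T) 0 0.
Proof. by rewrite /bf mulmx1. Qed.

Lemma qfD A x y : A^T = A -> qf A (x + y) = qf A x + 2 * bf A x y + qf A y.
Proof. by move=> sA; rewrite /qf bfDl !bfDr (bfC y x sA); ring. Qed.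
Lemma qfB A x y : A^T = A -> qf A (x - y) = qf A x - 2 * bf A x y + qf A y.
Proof. by move=> sA; rewrite /qf bfBl !bfBr (bfC y x sA); ring. Qed.
Lemma qfZ A a x : qf A (a *: x) = a ^+ 2 * qf A x.
Proof. by rewrite /qf bfZl bfZr; ring. Qed.
Lemma qfN A x : qf A (- x) = qf A x.
Proof. by rewrite /qf bfNl bfNr opprK. Qed.
Lemma qf0 A : qf A 0 = 0.
Proof. by rewrite /qf bf0l. Qed.

Lemma posdef_psd A : posdef A -> psd A.
Proof.
case=> sA pA; split=> // v; have [->|/pA/ltW//] := eqVneq v 0.
by rewrite qf0.
Qed.

Lemma posdef_sym A : posdef A -> A^T = A. Proof. by case. Qed.

Lemma posdef_gt0 A v : posdef A -> v != 0 -> 0 < qf A v.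
Proof. by case=> _ pA /pA. Qed.

(** Nonnegativity of [t |-> qf A (x + t *: y)], tested at one well-chosen [t]. *)
Lemma psd_CS A x y : psd A -> bf A x y ^+ 2 <= qf A x * qf A y.
Proof.
case=> sA pA.
have key t : 0 <= qf A x + 2 * t * bf A x y + t ^+ 2 * qf A y.
  rewrite [leRHS](_ : _ = qf A (x + t *: y)) ?pA// qfD// bfZr qfZ; ring.
have := pA x; have := pA y.
rewrite le_eqVlt => /predU1P[y0|ygt0] x0.
  rewrite -y0 mulr0; have [->|b0] := eqVneq (bf A x y) 0; first by rewrite expr0n.
  (* When [qf A y = 0] the polynomial is affine in [t], and this [t] gives it the value -1. *)
  exfalso; have := key (- (qf A x + 1) / (2 * bf A x y)).
  rewrite -y0 mulr0 addr0.
  have -> : 2 * (- (qf A x + 1) / (2 * bf A x y)) * bf A x y = - (qf A x + 1) by field.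
  lra.
(* The minimiser of the quadratic polynomial in [t]. *)
have := key (- bf A x y / qf A y).
have -> : qf A x + 2 * (- bf A x y / qf A y) * bf A x y +
    (- bf A x y / qf A y) ^+ 2 * qf A y = qf A x - bf A x y ^+ 2 / qf A y.
  by field; rewrite gt_eqF.
by rewrite subr_ge0 ler_pdivrMr.
Qed.

(** Cauchy-Schwarz against the basis vectors makes each coordinate of [v *m A] vanish. *)
Lemma psd_ker A v : psd A -> qf A v = 0 -> v *m A = 0.
Proof.
move=> pA v0; apply/rowP => j; rewrite !mxE.
have := psd_CS v (delta_mx 0 j) pA; rewrite v0 mul0r => h.
have : bf A v (delta_mx 0 j) ^+ 2 == 0 by rewrite eq_le h sqr_ge0.
rewrite sqrf_eq0 => /eqP; rewrite /bf trmx_delta -colE !mxE; exact.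
Qed.

Lemma posdef_unit A : posdef A -> A \in unitmx.
Proof.
move=> pA; rewrite -row_free_unit -kermx_eq0; apply/eqP/row_matrixP => i.
rewrite row0; apply/eqP; apply: contraT => /(posdef_gt0 pA).
by rewrite /qf /bf -row_mul mulmx_ker row0 mul0mx mxE ltxx.
Qed.

Lemma psd_unit_posdef A : psd A -> A \in unitmx -> posdef A.
Proof.
move=> pA uA; split; first by case: pA.
move=> v v0; rewrite lt_neqAle eq_sym (pA.2 v) andbT.
apply: contra v0 => /eqP /(psd_ker pA) vA.
by rewrite -[v](mulmxK uA) vA mul0mx.
Qed.

Lemma posdef_inv A : posdef A -> posdef (invmx A).
Proof.
move=> pA; have uA := posdef_unit pA; have sA := posdef_sym pA.
have siA : (invmx A)^T = invmx A by rewrite trmx_inv sA.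
split=> // v v0.
have := @posdef_gt0 A (v *m invmx A) pA.
rewrite /qf bfMl bfMr mulVmx// siA mul1mx; apply.
by apply: contra v0 => /eqP vA; rewrite -[v](mulmxKV uA) vA mul0mx.
Qed.

Lemma posdefZ a A : 0 < a -> posdef A -> posdef (a *: A).
Proof.
move=> a0 pA; split; first by rewrite linearZ /= (posdef_sym pA).
by move=> v v0; have := @bfZm a A v v; rewrite /bf => ->; rewrite mulr_gt0// (posdef_gt0 pA v0).
Qed.

End BilinearForms.

(** * Triangular factorisation of positive definite matrices *)

Section Cholesky.
Variable R : realType.

Lemma block_sym n (a : 'M[R]_1) (b : 'rV[R]_n) c (D : 'M[R]_n) :
  (block_mx a b c D)^T = block_mx a b c D -> c = b^T /\ D^T = D.
Proof. by rewrite tr_block_mx => /eq_block_mx[_ _ <- ->]. Qed.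

(** The diagonal is kept separate so that [L] has unit diagonal: it is then a product of shears and
    preserves Lebesgue measure, and all scaling sits in [d]. Induction on the Schur complement of
    the first pivot. *)
Lemma cholesky n (A : 'M[R]_n) : posdef A ->
  exists (L : 'M[R]_n) (d : 'rV[R]_n),
    [/\ forall i, 0 < d 0 i, forall i j : 'I_n, (i < j)%N -> L i j = 0,
        forall i, L i i = 1 & A = L *m diag_mx d *m L^T].
Proof.
elim: n A => [|n IH] A pA.
  exists 0, 0; split; try by case.
  by apply/matrixP => -[].
move: A pA; rewrite -[n.+1]/(1 + n)%N => A.
rewrite -[A]submxK; move: (ulsubmx A) (ursubmx A) (dlsubmx A) (drsubmx A).
move=> a b c D; clear A; move=> pA; have [sA _] := pA.
have [cE sD] := block_sym sA; rewrite {}cE in pA sA *.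
have a0 : 0 < a 0 0.
  have := @posdef_gt0 _ _ _ (row_mx (1 : 'M[R]_1) 0) pA.
  rewrite /qf /bf mul_row_block tr_row_mx mul_row_col !mul0mx !addr0 mul1mx.
  rewrite trmx0 mulmx0 addr0 trmx1 mulmx1; apply.
  apply/negP => /eqP/matrixP/(_ 0 0); rewrite (_ : 0 = lshift n (0 : 'I_1)) ?row_mxEl ?mxE//.
  by move=> /eqP; rewrite oner_eq0.
  by apply/val_inj.
have aE : a = (a 0 0)%:M by rewrite -mx11_scalar.
pose D' := D - (a 0 0)^-1 *: (b^T *m b).
have sD' : D'^T = D'.
  by rewrite /D' linearB linearZ /= trmx_mul trmxK sD.
have pD' : posdef D'.
  split=> // v v0.
  (* The first entry is the one that minimises the form for given [v]; the minimum is the value of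
     [D'] at [v]. *)
  have := @posdef_gt0 _ _ _ (row_mx (- (a 0 0)^-1 *: (v *m b^T)) v) pA.
  have -> : qf (block_mx a b b^T D) (row_mx (- (a 0 0)^-1 *: (v *m b^T)) v) =
     (v *m D' *m v^T) 0 0; last first.
    apply; apply: contra v0 => /eqP/matrixP E; apply/eqP/rowP => i.
    by have := E 0 (rshift 1 i); rewrite row_mxEr !mxE.
  rewrite /qf /bf mul_row_block tr_row_mx mul_row_col.
  have -> : - (a 0 0)^-1 *: (v *m b^T) *m a = - (v *m b^T).
    by rewrite [X in _ *m X]aE mul_mx_scalar scalerA mulrN divff ?gt_eqF// scaleN1r.
  rewrite addNr mul0mx add0r.
  by congr (fun_of_matrix (_ *m _) _ _); rewrite /D' mulmxBr -scalemxAr mulmxA scaleNr mulNmx -scalemxAl addrC.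
have [L [d [d0 Ltri Ldiag LE]]] := IH _ pD'.
exists (block_mx 1 0 ((a 0 0)^-1 *: b^T) L : 'M[R]_(1 + n)), (row_mx a d); split.
- move=> i; case: (@split_ordP 1 n i) => j ->; rewrite ?row_mxEl ?row_mxEr//.
  by rewrite ord1.
- move=> i j; case: (@split_ordP 1 n i) => i' ->; case: (@split_ordP 1 n j) => j' ->;
    rewrite ?block_mxEul ?block_mxEur ?block_mxEdl ?block_mxEdr ?mxE//=.
  + by rewrite !ord1.
  + by rewrite ord1.
  + by rewrite ltn_add2l; exact: Ltri.
- move=> i; case: (@split_ordP 1 n i) => i' ->; rewrite ?block_mxEul ?block_mxEdr ?mxE ?Ldiag//.
  by rewrite ord1.
- rewrite diag_mx_row tr_block_mx !mulmx_block.
  have -> : diag_mx a = a by rewrite [RHS]aE; apply/matrixP => i j; rewrite !ord1 !mxE eqxx.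
  rewrite !mul1mx !mul0mx !mulmx0 !addr0 !add0r trmx1 mulmx1 linearZ /= trmxK.
  have aZ m (B : 'M[R]_(1, m)) : a *m B = a 0 0 *: B by rewrite {1}aE mul_scalar_mx.
  have Za m (B : 'M[R]_(m, 1)) : B *m a = a 0 0 *: B by rewrite {1}aE mul_mx_scalar.
  rewrite trmx0 !mulmx0 !mul0mx !addr0 mulmx1 aZ Za !scalerA mulfV ?gt_eqF// !scale1r.
  by rewrite -scalemxAr -LE /D' addrC subrK.
Qed.

End Cholesky.

Section Products.
Variables (R : realType) (p : nat).
Local Notation T := (p.-tuple R).
Implicit Types (x y : T) (S : seq 'I_p).

Lemma prodEFin (I : Type) (r : seq I) (P : pred I) (F : I -> R) :
  (\prod_(i <- r | P i) (F i)%:E)%E = (\prod_(i <- r | P i) F i)%:E.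
Proof.
by elim/big_rec2: _ => // i a b _ ->; rewrite EFinM.
Qed.

Lemma measurable_prodE (I : Type) (r : seq I) (F : I -> T -> \bar R) :
  (forall i, measurable_fun setT (F i)) ->
  measurable_fun setT (fun y => \prod_(i <- r) F i y)%E.
Proof.
move=> mF; elim: r => [|a r IH].
  by under eq_fun do rewrite big_nil; exact: measurable_cst.
under eq_fun do rewrite big_cons.
exact: emeasurable_funM.
Qed.

Lemma prode_ge0 (I : Type) (r : seq I) (F : I -> \bar R) :
  (forall i, 0 <= F i)%E -> (0 <= \prod_(i <- r) F i)%E.
Proof. by move=> F0; elim/big_rec: _ => // i a _ ?; rewrite mule_ge0. Qed.

(** Unlike in [eq_iint], the base points may differ: this shows that a function of the integrated
    coordinates alone has the same integral over every fibre. *)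
Lemma eq_iint2 S (f g : T -> \bar R) x x' :
  (forall y y', (forall i, i \notin S -> tnth y i = tnth x i) ->
     (forall i, i \notin S -> tnth y' i = tnth x' i) ->
     (forall i, i \in S -> tnth y i = tnth y' i) -> f y = g y') ->
  iint S f x = iint S g x'.
Proof.
elim: S x x' => [|i S IH] x x' fg /=; first exact: fg.
apply: eq_integral => t _; apply: IH => y y' yx yx' yy'; apply: fg.
- by move=> j; rewrite inE negb_or => /andP[ji jS]; rewrite yx// tnth_set_coord (negbTE ji).
- by move=> j; rewrite inE negb_or => /andP[ji jS]; rewrite yx'// tnth_set_coord (negbTE ji).
- move=> j; rewrite inE; case jS: (j \in S); first by move=> _; exact: yy'.
  by rewrite orbF => /eqP ->; case iS: (i \in S); [exact: yy'|rewrite yx ?yx' ?iS// !tnth_set_coord eqxx].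
Qed.

(** One group of coordinates is peeled off at a time; the integral of the remaining factors does not
    depend on the base point and comes out as a constant. *)
Lemma iint_prod (J : eqType) (s : seq J) (c : J -> seq 'I_p) (F : J -> T -> \bar R) x :
  uniq (flatten [seq c k | k <- s]) ->
  (forall k, measurable_fun setT (F k)) -> (forall k y, 0 <= F k y)%E ->
  (forall k, k \in s -> forall y y',
     (forall i, i \in c k -> tnth y i = tnth y' i) -> F k y = F k y') ->
  iint (flatten [seq c k | k <- s]) (fun y => \prod_(k <- s) F k y)%E x
  = (\prod_(k <- s) iint (c k) (F k) x)%E.
Proof.
move=> + mF F0; elim: s x => [|k s IH] x /=; first by rewrite !big_nil.
rewrite cat_uniq => /and3P[uk dis us] Fc; rewrite big_cons iint_cat.
have Fc' m : m \in s -> forall y y',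
    (forall i, i \in c m -> tnth y i = tnth y' i) -> F m y = F m y'.
  by move=> ms; apply: Fc; rewrite inE ms orbT.
pose G y := (\prod_(m <- s) iint (c m) (F m) y)%E.
have G0 y : (0 <= G y)%E by apply: prode_ge0 => m; exact: iint_ge0.
have Gcst y y' : G y = G y'.
  apply: eq_big_seq => m ms; apply: eq_iint2 => z z' _ _; exact: Fc'.
transitivity (iint (c k) (fun y => G y * F k y)%E x).
  congr iint; apply/funext => y; rewrite /G -IH//.
  rewrite muleC -iint_Mindep//.
  - by congr iint; apply/funext => z; rewrite big_cons.
  - exact: measurable_prodE.
  - by move=> z; exact: prode_ge0.
  - move=> z zy; apply: Fc; first exact: mem_head.
    move=> i ik; apply: zy; apply/negP => iS.
    by move/negP: dis; apply; apply/hasP; exists i.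
by rewrite iint_Mindep// muleC.
Qed.

End Products.

Section GaussianIntegral.
Variables (R : realType) (p : nat).
Local Notation T := (p.-tuple R).
Local Notation allc := (@allc p).
Implicit Types (x y : T) (S : seq 'I_p) (m v : 'rV[R]_p) (P : 'M[R]_p).

Definition rvec m : T := [tuple m 0 i | i < p].

Lemma vecE x i : vec x 0 i = tnth x i. Proof. by rewrite mxE. Qed.
Lemma tnth_rvec m i : tnth (rvec m) i = m 0 i. Proof. by rewrite tnth_mktuple. Qed.
Lemma rvecK m : vec (rvec m) = m.
Proof. by apply/rowP => i; rewrite vecE tnth_rvec. Qed.
Lemma mem_allc i : i \in allc. Proof. by rewrite mem_enum. Qed.
Lemma uniq_allc : uniq allc. Proof. exact: enum_uniq. Qed.

Lemma measurable_coord i : measurable_fun setT (fun x => tnth x i).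
Proof. exact: measurable_tnth. Qed.

Lemma measurable_vec_sub m i : measurable_fun setT (fun x => (vec x - m) 0 i).
Proof.
under eq_fun do rewrite !mxE.
by apply: measurable_funB => //; exact: measurable_coord.
Qed.

Lemma measurable_bf P (f g : T -> 'rV[R]_p) :
  (forall i, measurable_fun setT (fun x => f x 0 i)) ->
  (forall i, measurable_fun setT (fun x => g x 0 i)) ->
  measurable_fun setT (fun x => bf P (f x) (g x)).
Proof.
move=> mf mg; under eq_fun do rewrite bfE.
apply: measurable_sum => i; apply: measurable_sum => j.
by apply: measurable_funM => //; exact: measurable_funM.
Qed.

Definition gexp m P x := expR (- (1 / 2) * qf P (vec x - m)).

Lemma measurable_gexp m P : measurable_fun setT (gexp m P).
Proof.
apply: (measurableT_comp (@measurable_expR R)).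
apply: measurable_funM => //.
by apply: measurable_bf => i; exact: measurable_vec_sub.
Qed.

Lemma gexp_gt0 m P x : 0 < gexp m P x. Proof. exact: expR_gt0. Qed.

Lemma iint_all_shift m (f : T -> \bar R) x :
  measurable_fun setT f -> (forall y, 0 <= f y)%E ->
  iint allc (fun y => f (rvec (vec y + m))) x = iint allc f x.
Proof.
move=> mf f0.
have ua := uniq_allc; have e1 : (1 : R) = 1 \/ (1 : R) = -1 by left.
rewrite -[RHS](iint_affmap (l := fun i _ => m 0 i) x ua e1)//.
congr iint; apply/funext => y /=; congr f; apply: eq_from_tnth => i.
by rewrite tnth_affmap mem_allc tnth_rvec mxE vecE mul1r.
Qed.

Lemma iint_all_reflect m (f : T -> \bar R) x :
  measurable_fun setT f -> (forall y, 0 <= f y)%E ->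
  iint allc (fun y => f (rvec (m - vec y))) x = iint allc f x.
Proof.
move=> mf f0.
have ua := uniq_allc; have e1 : (-1 : R) = 1 \/ (-1 : R) = -1 by right.
rewrite -[RHS](iint_affmap (l := fun i _ => m 0 i) x ua e1)//.
congr iint; apply/funext => y /=; congr f; apply: eq_from_tnth => i.
by rewrite tnth_affmap mem_allc tnth_rvec !mxE mulN1r addrC.
Qed.

(* The linear map is a composition of shears, each changing one coordinate. *)
Lemma iint_unitriangular (L : 'M[R]_p) (f : T -> \bar R) x :
  (forall i j : 'I_p, (i < j)%N -> L i j = 0) -> (forall i, L i i = 1) ->
  measurable_fun setT f -> (forall y, 0 <= f y)%E ->
  iint allc (fun y => f (rvec (vec y *m L))) x = iint allc f x.
Proof.
move=> Ltri Ldiag mf f0.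
pose Psi (r : nat) y : T := [tuple (if (r <= i)%N then (vec y *m L) 0 i else tnth y i) | i < p].
have mL i : measurable_fun setT (fun y => (vec y *m L) 0 i).
  under eq_fun do rewrite mxE.
  apply: measurable_sum => j; apply: measurable_funM => //.
  by under eq_fun do rewrite mxE; exact: measurable_coord.
have PsiE r y i : tnth (Psi r y) i = if (r <= i)%N then (vec y *m L) 0 i else tnth y i.
  by rewrite /Psi tnth_mktuple.
have mPsi r : measurable_fun setT (Psi r).
  apply/measurable_fun_tnthP => i.
  have -> : (fun y : T => tnth y i) \o Psi r =
      fun y => if (r <= i)%N then (vec y *m L) 0 i else tnth y i.
    by apply/funext => y /=; rewrite PsiE.
  by case: (r <= i)%N; [exact: mL|exact: measurable_coord].
transitivity (iint allc (f \o Psi 0) x).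
  by congr iint; apply/funext => y /=; congr f.
have step r : (r < p)%N -> iint allc (f \o Psi r) x = iint allc (f \o Psi r.+1) x.
  move=> rp; pose k := Ordinal rp.
  pose l (i : 'I_p) y := (vec y *m L) 0 k - tnth y k.
  have lE i y : l i y = \sum_(j < p | j != k) tnth y j * L j k.
    rewrite /l mxE (bigD1 k)//= Ldiag mulr1 vecE addrAC subrr add0r.
    by apply: eq_bigr => j _; rewrite vecE.
  (* [Psi 0] is the whole map and [Psi p] the identity. Consecutive ones differ by a shear in
     coordinate [k]: for [i > k] the entry [L k i] is 0, so the later coordinates do not notice the
     change in coordinate [k]. *)
  have -> : f \o Psi r = (f \o Psi r.+1) \o affmap [:: k] 1 l.
    apply/funext => y /=; congr f; apply: eq_from_tnth => i.
    rewrite !PsiE tnth_affmap inE mul1r.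
    have [->|ik] := eqVneq i k; first by rewrite leqnn ltnn subrKC.
    have -> : (r <= i)%N = (r < i)%N.
      by rewrite ltn_neqAle; case: eqP => //= E; move: ik; rewrite -val_eqE /= -E eqxx.
    case: ltnP => // ri; rewrite !mxE; apply: eq_bigr => j _.
    rewrite !vecE tnth_affmap inE; case: (eqVneq j k) => // ->.
    by rewrite Ltri ?mulr0//.
  have perm_k : perm_eq allc (rem k allc ++ [:: k]).
    by rewrite perm_sym perm_catC /= perm_sym perm_to_rem// mem_allc.
  have mfP : measurable_fun setT (f \o Psi r.+1) by exact: measurableT_comp.
  have ml i : measurable_fun setT (l i) by apply: measurable_funB => //; exact: measurable_coord.
  have mfa : measurable_fun setT ((f \o Psi r.+1) \o affmap [:: k] 1 l).
    by apply: (measurableT_comp mfP); exact: measurable_affmap.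
  have fP0 y : (0 <= (f \o Psi r.+1) y)%E by exact: f0.
  have fa0 y : (0 <= ((f \o Psi r.+1) \o affmap [:: k] 1 l) y)%E by exact: f0.
  rewrite (perm_iint _ uniq_allc perm_k mfa) ?(perm_iint _ uniq_allc perm_k mfP)//.
  rewrite !iint_cat; congr iint; apply/funext => y.
  apply: iint_affmap => //; first by left.
  move=> i; rewrite inE => /eqP -> z z' zz'; rewrite !lE.
  by apply: eq_bigr => j jk; rewrite zz'// inE.
have steps q : (q <= p)%N -> iint allc (f \o Psi 0) x = iint allc (f \o Psi q) x.
  by elim: q => [//|k IH] kp; exact: (etrans (IH (ltnW kp)) (step k kp)).
rewrite (steps p (leqnn p)); congr iint; apply/funext => y /=; congr f.
by apply: eq_from_tnth => i; rewrite PsiE leqNgt ltn_ord.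
Qed.

Lemma integral_gauss1 (d : R) : 0 < d ->
  (\int[lebesgue_measure]_t (expR (- (1 / 2) * (d * t ^+ 2)))%:E
   = (Num.sqrt (2 * pi) / Num.sqrt d)%:E)%E.
Proof.
move=> d0; pose s := (Num.sqrt d)^-1.
have s0 : 0 < s by rewrite invr_gt0 sqrtr_gt0.
have s2 : s ^+ 2 = d^-1 by rewrite exprVn sqr_sqrtr// ltW.
have pk0 := @normal_peak_gt0 _ s (lt0r_neq0 s0).
have := integral_normal_pdf 0 s; rewrite normal_pdfE ?gt_eqF//.
under eq_integral do rewrite EFinM.
rewrite ge0_integralZl//=; last 3 first.
- by apply/measurable_EFinP; exact: measurable_normal_fun.
- by move=> t _; rewrite lee_fin normal_fun_ge0.
- by rewrite lee_fin ltW.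
have -> : (fun t : R => (expR (- (1 / 2) * (d * t ^+ 2)))%:E) = (fun t => (normal_fun 0 s t)%:E).
  apply/funext => t; rewrite /normal_fun subr0 s2; congr (expR _)%:E.
  by field; rewrite gt_eqF.
have -> : Num.sqrt (2 * pi) / Num.sqrt d = (normal_peak s)^-1.
  rewrite /normal_peak invrK s2 -sqrtrV ?ltW// -sqrtrM ?mulr_ge0 ?pi_ge0//.
  by congr Num.sqrt; rewrite -mulr_natr; ring.
move=> h; rewrite -[LHS]mul1e -(divff (lt0r_neq0 pk0)) [_ / _]mulrC EFinM -muleA.
by rewrite h mule1.
Qed.

(** With P = L diag(d) L^T, the substitution [y *m L] turns the form into a sum of [d_i y_i^2]
    without a Jacobian. The integral becomes a product of one-dimensional ones, and [\det P] is the
    product of the [d_i]. *)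
Lemma iint_gexp m P x : posdef P ->
  iint allc (fun y => (gexp m P y)%:E) x
  = (Num.sqrt (2 * pi) ^+ p / Num.sqrt (\det P))%:E.
Proof.
move=> pP; have [L [d [d0 Ltri Ldiag PE]]] := cholesky pP.
pose H y := (\prod_(i <- allc) (expR (- (1 / 2) * (d 0 i * tnth y i ^+ 2)))%:E)%E.
have mF i : measurable_fun setT (fun y => (expR (- (1 / 2) * (d 0 i * tnth y i ^+ 2)))%:E).
  apply/measurable_EFinP; apply: (measurableT_comp (@measurable_expR R)).
  apply: measurable_funM => //; apply: measurable_funM => //.
  exact: (measurable_funX 2 (measurable_coord i)).
have F0 i y : (0 <= (expR (- (1 / 2) * (d 0 i * tnth y i ^+ 2)))%:E)%E.
  by rewrite lee_fin expR_ge0.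
have mH : measurable_fun setT H by exact: measurable_prodE.
have H0 y : (0 <= H y)%E by exact: prode_ge0.
transitivity (iint allc H x).
  rewrite -(iint_unitriangular x Ltri Ldiag mH H0).
  rewrite -(iint_all_shift m x); last 2 first.
  - by apply/measurable_EFinP; exact: measurable_gexp.
  - by move=> y; rewrite lee_fin ltW ?gexp_gt0.
  congr iint; apply/funext => y; rewrite /gexp rvecK addrK /H prodEFin -expR_sum.
  congr (expR _)%:E; rewrite -mulr_sumr; congr (_ * _).
  have -> : qf P (vec y) = bf (diag_mx d) (vec y *m L) (vec y *m L).
    by rewrite bfMr bfMl mulmxA -PE.
  rewrite bfE big_enum /=.
  apply: eq_bigr => i _; rewrite (bigD1 i)//= big1 ?addr0.
    by rewrite mxE eqxx mulr1n tnth_rvec expr2.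
  by move=> j ji; rewrite mxE eq_sym (negbTE ji) mul0r.
rewrite /H.
have E1 : allc = flatten [seq [:: i] | i <- allc].
  by elim: allc => //= a s <-.
rewrite {1}E1 (iint_prod (c := fun i => [:: i]))//; last 2 first.
- by rewrite -E1 uniq_allc.
- by move=> k _ y y' ->//; rewrite inE.
transitivity (\prod_(i <- allc) (Num.sqrt (2 * pi) / Num.sqrt (d 0 i))%:E)%E.
  apply: eq_bigr => i _ /=; rewrite -integral_gauss1//.
  by apply: eq_integral => t _; rewrite tnth_set_coord eqxx.
rewrite prodEFin big_enum /= prodf_div; congr (_ / _)%:E.
  by rewrite prodr_const card_ord.
have -> : \det P = \prod_i d 0 i.
  rewrite PE !det_mulmx det_tr det_diag det_trig; last by apply/is_trig_mxP => i j ij; exact: Ltri.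
  by rewrite [\prod_i L i i]big1 ?mul1r ?mulr1.
have : 0 <= \prod_i d 0 i by apply: prodr_ge0 => i _; exact: ltW.
elim/big_rec2: _ => [|i a b _ IH]; first by rewrite sqrtr1.
by rewrite pmulr_rge0// => b0; rewrite sqrtrM 1?ltW// IH.
Qed.

End GaussianIntegral.

Section RankOne.
Variables (R : realType) (p : nat).
Implicit Types (u v y : 'rV[R]_p) (P : 'M[R]_p) (t : R).

(** The matrix determinant lemma, from two triangular factorisations of the same bordered matrix. *)
Lemma det_rank_one P u v : P \in unitmx ->
  \det (P + v^T *m u) = \det P * (1 + (u *m invmx P *m v^T) 0 0).
Proof.
move=> uP.
have E1 : block_mx 1 (- u) v^T P =
    block_mx 1 0 v^T 1%:M *m block_mx 1 (- u) 0 (P + v^T *m u) :> 'M[R]_(1 + p).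
  rewrite mulmx_block !mul1mx !mul0mx ?mulmx0 ?addr0 mulmx1 mulmxN.
  by congr block_mx; rewrite addrC addrK.
have E2 : block_mx 1 (- u) v^T P =
    block_mx 1 (- u *m invmx P) 0 1%:M *m block_mx (1 + u *m invmx P *m v^T) 0 v^T P :> 'M[R]_(1 + p).
  rewrite mulmx_block !mul1mx !mul0mx ?mulmx0 ?add0r -!mulmxA mulVmx// mulmx1.
  by congr block_mx; rewrite mulNmx mulmxA addrK.
have := congr1 determinant E1; rewrite E2 !det_mulmx !det_ublock !det_lblock !det1 !mul1r => <-.
by rewrite mulrC; congr (_ * _); rewrite det_mx11 mxE mxE eqxx.
Qed.

Lemma bf_rank_one P v y t : qf (P + t *: (v^T *m v)) y = qf P y + t * ((y *m v^T) 0 0) ^+ 2.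
Proof.
rewrite /qf bfDm bfZm; congr (_ + _ * _).
rewrite /bf !mulmxA -mulmxA mxE big_ord1 expr2; congr (_ * _).
have -> : v *m y^T = (y *m v^T)^T by rewrite trmx_mul trmxK.
by rewrite mxE.
Qed.

(** Cauchy-Schwarz in the metric [P] bounds [(y v^T)^2] by [qf P y * qf (invmx P) v]. For negative
    [t] the perturbation therefore removes less than [qf P y]. *)
Lemma posdef_rank_one P v t : posdef P -> -1 < t * qf (invmx P) v ->
  posdef (P + t *: (v^T *m v)).
Proof.
move=> pP t1; have uP := posdef_unit pP; have pV := posdef_psd (posdef_inv pP).
split.
  by rewrite linearD linearZ /= trmx_mul trmxK (posdef_sym pP).
move=> y y0; have := bf_rank_one P v y t; rewrite /qf /bf => ->.
have y1 := posdef_gt0 pP y0; rewrite -/(bf P y y) -/(qf P y).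
have CS : ((y *m v^T) 0 0) ^+ 2 <= qf P y * qf (invmx P) v.
  have := psd_CS (y *m P) v pV.
  by rewrite bfMl mulmxV// bf1 /qf bfMl bfMr mulmxV// mul1mx (posdef_sym pP).
have := pV.2 v; have := sqr_ge0 ((y *m v^T) 0 0).
move: CS t1 y1; move: (qf P y) (qf _ v) (_ ^+ 2) => a k w CS t1 a0 w0 k0.
have [t0|t0] := leP 0 t; first by nra.
have : t * w >= t * (a * k) by rewrite ler_nM2l.
nra.
Qed.

End RankOne.

(** Together with the next lemma this lets [b] tend to 1 in the bounds on a second moment; explicit
    values of [b] replace the limit. *)
Lemma squeeze_quadratic_lb (R : realType) (m : R) :
  (forall b, 1 < b -> 2 <= m * (b * (b + 1))) -> 1 <= m.
Proof.
move=> H; rewrite leNgt; apply/negP => m1.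
(* [b = 2] refutes [m <= 0]; the other value refutes [0 < m < 1]. *)
have := H (1 + (1 - m) / 4); have := H 2.
case: (lerP m 0) => m0; nra.
Qed.

Lemma squeeze_quadratic_ub (R : realType) (m : R) :
  (forall b, 0 < b -> b < 1 -> m * (b * (b + 1)) <= 2) -> m <= 1.
Proof.
move=> H; rewrite leNgt; apply/negP => m1.
have m0 : 0 < m by lra.
(* With this [e], at [b = 1 - e] one has m b (b + 1) = m + 1 + m e^2, which exceeds 2. *)
pose e := (m - 1) / (3 * m).
have em : m * (3 * e) = m - 1 by rewrite /e; field; rewrite gt_eqF.
have e0 : 0 < e by rewrite divr_gt0//; lra.
have e1 : e < 1/3 by nra.
have := H (1 - e); nra.
Qed.

Section GaussianMoments.
Variables (R : realType) (p : nat).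
Local Notation T := (p.-tuple R).
Local Notation allc := (@allc p).
Implicit Types (x y : T) (S : seq 'I_p) (m v : 'rV[R]_p) (P : 'M[R]_p).

Definition lin v (z : 'rV[R]_p) : R := (z *m v^T) 0 0.

Lemma linE v z : lin v z = \sum_i z 0 i * v 0 i.
Proof. by rewrite /lin mxE; apply: eq_bigr => i _; rewrite mxE. Qed.

Lemma linB v z z' : lin v (z - z') = lin v z - lin v z'.
Proof. by rewrite /lin mulmxBl !mxE. Qed.

Lemma linN v z : lin v (- z) = - lin v z.
Proof. by rewrite /lin mulNmx !mxE. Qed.

Lemma measurable_lin v m : measurable_fun setT (fun x => lin v (vec x - m)).
Proof.
under eq_fun do rewrite linE.
apply: measurable_sum => i; apply: measurable_funM => //; exact: measurable_vec_sub.
Qed.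

Definition gmass P : R := Num.sqrt (2 * pi) ^+ p / Num.sqrt (\det P).

Lemma det_posdef_gt0 P : posdef P -> 0 < \det P.
Proof.
move=> /cholesky[L [d [d0 Ltri Ldiag ->]]].
rewrite !det_mulmx det_tr det_diag det_trig; last by apply/is_trig_mxP => i j ij; exact: Ltri.
by rewrite [\prod_i L i i]big1 ?mul1r ?mulr1// prodr_gt0.
Qed.

Lemma gmass_gt0 P : posdef P -> 0 < gmass P.
Proof.
by move=> pP; rewrite divr_gt0 ?exprn_gt0 ?sqrtr_gt0 ?mulr_gt0 ?pi_gt0 ?det_posdef_gt0.
Qed.

Lemma gexp_rank_one m P v t x :
  gexp m (P + t *: (v^T *m v)) x = gexp m P x * expR (- (t / 2) * lin v (vec x - m) ^+ 2).
Proof. by rewrite /gexp bf_rank_one -expRD; congr expR; rewrite /lin; ring. Qed.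

Lemma gmass_rank_one P v t b : posdef P -> 0 < b -> 1 + t * qf (invmx P) v = b ^+ 2 ->
  gmass (P + t *: (v^T *m v)) = gmass P / b.
Proof.
move=> pP b0 tb; rewrite /gmass scalemxAr det_rank_one ?posdef_unit//.
have -> : 1 + (t *: v *m invmx P *m v^T) 0 0 = b ^+ 2.
  by rewrite -tb /qf /bf -!scalemxAl mxE.
rewrite [Num.sqrt (\det P * _)]sqrtrM ?ltW ?det_posdef_gt0// sqrtr_sqr gtr0_norm//.
by rewrite invfM mulrA.
Qed.

Lemma measurable_gexp_lin2 m P v :
  measurable_fun setT (fun x => (gexp m P x * lin v (vec x - m) ^+ 2)%:E).
Proof.
apply/measurable_EFinP; apply: measurable_funM; first exact: measurable_gexp.
exact: (measurable_funX 2 (measurable_lin v m)).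
Qed.

(* Differentiating the total mass of [P + t v^T v] at [t = 0] gives the second moment;
   convexity of [exp] turns this into two-sided bounds for [t > 0] and [t < 0]. *)
Lemma iint_gexp_lin2 m P v x : posdef P ->
  iint allc (fun y => (gexp m P y * lin v (vec y - m) ^+ 2)%:E) x
  = (gmass P * qf (invmx P) v)%:E.
Proof.
move=> pP; have [->|v0] := eqVneq v 0.
  rewrite qf0 mulr0 -[RHS](iint0 allc x); congr iint; apply/funext => y.
  by rewrite /lin trmx0 mulmx0 mxE expr0n mulr0.
pose k := qf (invmx P) v.
have k0 : 0 < k := posdef_gt0 (posdef_inv pP) v0.
have Z0 := gmass_gt0 pP.
set M := iint _ _ _.
have M0 : (0 <= M)%E.
  by apply: iint_ge0 => y; rewrite lee_fin mulr_ge0 ?sqr_ge0// ltW ?gexp_gt0.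
have mg P' : measurable_fun setT (fun x => (gexp m P' x)%:E).
  by apply/measurable_EFinP; exact: measurable_gexp.
have g0 P' y : (0 <= (gexp m P' y)%:E)%E by rewrite lee_fin ltW ?gexp_gt0.
have mw := measurable_gexp_lin2 m P v.
have w0 y : (0 <= (gexp m P y * lin v (vec y - m) ^+ 2)%:E)%E.
  by rewrite lee_fin mulr_ge0 ?sqr_ge0// ltW ?gexp_gt0.
have ub b : 0 < b -> b < 1 ->
    ((gmass P)%:E + ((1 - b ^+ 2) / (2 * k))%:E * M <= (gmass P / b)%:E)%E.
  (* This [t] makes the determinant factor [1 + t * k] the square of [b], so that the perturbed mass
     is [gmass P / b], free of square roots in [b]. *)
  move=> b0 b1; pose t := (b ^+ 2 - 1) / k.
  have tk : 1 + t * k = b ^+ 2 by rewrite /t; field; rewrite gt_eqF.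
  have b20 : 0 < b ^+ 2 by rewrite exprn_gt0.
  have b21 : b ^+ 2 < 1 by rewrite expr_lt1// ltW.
  have pPt : posdef (P + t *: (v^T *m v)).
    by apply: posdef_rank_one => //; rewrite -/k; lra.
  rewrite -(gmass_rank_one pP b0 tk) -(iint_gexp m x pPt) -(iint_gexp m x pP).
  have c0 : 0 <= (1 - b ^+ 2) / (2 * k) by rewrite divr_ge0 ?subr_ge0 1?ltW// mulr_gt0.
  rewrite -iintZl// -iintD//; last 2 first.
  - exact: measurable_funeM.
  - by move=> y; rewrite mule_ge0.
  apply: le_iint => //.
  - by apply: emeasurable_funD => //; exact: measurable_funeM.
  - by move=> y; rewrite adde_ge0// mule_ge0.
  move=> y; rewrite -EFinM -EFinD lee_fin gexp_rank_one.
  have -> : (1 - b ^+ 2) / (2 * k) = - (t / 2) by rewrite /t; field; rewrite gt_eqF.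
  have := expR_ge1Dx (- (t / 2) * lin v (vec y - m) ^+ 2).
  have := gexp_gt0 m P y; move: (gexp _ _ _) (lin _ _) => g l; move: (expR _) => e; nra.
(* One instance of the upper bound already shows that the moment is finite; the rest of the argument
   is real arithmetic. *)
have Mfin : M \is a fin_num.
  rewrite ge0_fin_numE//; have := ub (1 / 2) ltac:(lra) ltac:(lra).
  move: M0; clearbody M; clear ub; case: M => [r _ _|_|//]; rewrite ?ltry//.
  by rewrite gt0_muley ?addey// lte_fin divr_gt0; lra.
have lb b : 1 < b ->
    ((gmass P)%:E <= (gmass P / b)%:E + ((b ^+ 2 - 1) / (2 * k))%:E * M)%E.
  move=> b1; have b0 : 0 < b by lra.
  pose t := (b ^+ 2 - 1) / k.
  have tk : 1 + t * k = b ^+ 2 by rewrite /t; field; rewrite gt_eqF.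
  have b21 : 1 < b ^+ 2 by rewrite expr_gt1// ltW.
  have pPt : posdef (P + t *: (v^T *m v)).
    by apply: posdef_rank_one => //; rewrite -/k; lra.
  rewrite -(gmass_rank_one pP b0 tk) -(iint_gexp m x pPt) -(iint_gexp m x pP).
  have c0 : 0 <= (b ^+ 2 - 1) / (2 * k) by rewrite divr_ge0 ?subr_ge0 1?ltW// mulr_gt0.
  rewrite -iintZl// -iintD//; last 2 first.
  - exact: measurable_funeM.
  - by move=> y; rewrite mule_ge0.
  apply: le_iint => //.
  - by apply: emeasurable_funD => //; exact: measurable_funeM.
  move=> y; rewrite -EFinM -EFinD lee_fin gexp_rank_one.
  have -> : (b ^+ 2 - 1) / (2 * k) = t / 2 by rewrite /t; field; rewrite gt_eqF.
  have := expR_ge1Dx (- (t / 2) * lin v (vec y - m) ^+ 2).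
  have := gexp_gt0 m P y; move: (gexp _ _ _) (lin _ _) => g l; move: (expR _) => e; nra.
clearbody M; move: M Mfin M0 ub lb => [M _|//|//].
rewrite lee_fin => M0 ub lb.
congr (_%:E).
have Zk : 0 < gmass P * k by rewrite mulr_gt0.
suff h : M / (gmass P * k) = 1 by rewrite -[LHS](mulfVK (lt0r_neq0 Zk)) h mul1r.
pose mu := M / (gmass P * k).
have ME : M = mu * (gmass P * k) by rewrite mulfVK ?gt_eqF.
rewrite -/mu; move: ub lb; rewrite ME; clearbody mu => ub lb.
apply/eqP; rewrite eq_le; apply/andP; split.
- apply: squeeze_quadratic_ub => b b0 b1.
  have := ub b b0 b1; rewrite -EFinM -EFinD lee_fin.
  have -> : gmass P + (1 - b ^+ 2) / (2 * k) * (mu * (gmass P * k)) =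
     gmass P * (1 + (1 - b ^+ 2) / 2 * mu) by field; rewrite gt_eqF.
  rewrite ler_pM2l// -[b^-1]mul1r ler_pdivlMr// => h.
  (* Cancelling the common factor [1 - b] plays the part of forming the difference quotient. *)
  have b10 : 0 < 1 - b by lra.
  rewrite -(ler_pM2l b10); clear - h; nra.
- apply: squeeze_quadratic_lb => b b1; have b0 : 0 < b by lra.
  have := lb b b1; rewrite -EFinM -EFinD lee_fin.
  have -> : gmass P / b + (b ^+ 2 - 1) / (2 * k) * (mu * (gmass P * k)) =
     gmass P * (b^-1 + (b ^+ 2 - 1) / 2 * mu) by field; rewrite !gt_eqF.
  rewrite -{1}[gmass P]mulr1 ler_pM2l// -(ler_pM2r b0) mulrDl mulVf ?gt_eqF// => h.
  have b10 : 0 < b - 1 by lra.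
  rewrite -(ler_pM2l b10); clear - h; nra.
Qed.

End GaussianMoments.

Section GaussianDensity.
Variables (R : realType) (p : nat).
Local Notation T := (p.-tuple R).
Local Notation allc := (@allc p).
Local Notation lam := (fiber allc (@origin R p)).
Implicit Types (x y : T) (S : seq 'I_p) (m v : 'rV[R]_p) (P : 'M[R]_p).

Lemma integrable_fiber_ge0 S x (f : T -> R) : measurable_fun setT f ->
  (forall y, 0 <= f y) -> (iint S (fun y => (f y)%:E) x < +oo)%E ->
  (fiber S x).-integrable setT (EFin \o f).
Proof.
move=> mf f0 fy; apply/integrableP; split; first exact/measurable_EFinP.
under eq_integral do rewrite /= ger0_norm//.
by rewrite integral_fiber//; exact/measurable_EFinP.
Qed.

Variables (m : 'rV[R]_p) (P : 'M[R]_p) (c : R).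
Hypothesis pP : posdef P.
Hypothesis cP : c * gmass P = 1.
Let f x := c * gexp m P x.

Let c0 : 0 < c.
Proof.
have Z0 := gmass_gt0 pP.
by rewrite -(pmulr_lgt0 c Z0) cP.
Qed.

Let f0 x : 0 <= f x. Proof. by rewrite mulr_ge0 ?ltW ?gexp_gt0. Qed.

Let mf : measurable_fun setT f.
Proof. by apply: measurable_funM => //; exact: measurable_gexp. Qed.

Let w v x := lin v (vec x - m).

Let mfw v : measurable_fun setT (fun x => f x * w v x).
Proof. by apply: measurable_funM => //; exact: measurable_lin. Qed.

Let mfw2 v : measurable_fun setT (fun x => f x * w v x ^+ 2).
Proof.
by apply: measurable_funM => //; exact: (measurable_funX 2 (measurable_lin v m)).
Qed.

Lemma iint_gauss_density x : iint allc (fun y => (f y)%:E) x = 1%E.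
Proof.
have -> : (fun y => (f y)%:E) = (fun y => c%:E * (gexp m P y)%:E)%E by [].
rewrite iintZl ?lee_fin ?ltW//.
- by rewrite iint_gexp// -/(gmass P) -EFinM cP.
- by apply/measurable_EFinP; exact: measurable_gexp.
- by move=> y; rewrite lee_fin ltW ?gexp_gt0.
Qed.

Lemma iint_gauss_density_lin2 v x :
  iint allc (fun y => (f y * w v y ^+ 2)%:E) x = (qf (invmx P) v)%:E.
Proof.
have -> : (fun y => (f y * w v y ^+ 2)%:E) =
    (fun y => c%:E * (gexp m P y * lin v (vec y - m) ^+ 2)%:E)%E.
  by apply/funext => y; rewrite -EFinM; congr EFin; rewrite /f /w; ring.
rewrite iintZl ?lee_fin ?ltW//.
- by rewrite iint_gexp_lin2// -EFinM mulrA cP mul1r.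
- exact: measurable_gexp_lin2.
- by move=> y; rewrite lee_fin mulr_ge0 ?sqr_ge0// ltW ?gexp_gt0.
Qed.

Lemma integrable_gauss_density : lam.-integrable setT (EFin \o f).
Proof. by apply: integrable_fiber_ge0 => //; rewrite iint_gauss_density ltry. Qed.

Lemma integrable_gauss_density_lin2 v :
  lam.-integrable setT (fun y => (f y * w v y ^+ 2)%:E).
Proof.
apply: integrable_fiber_ge0 => //; first by move=> y; rewrite mulr_ge0 ?sqr_ge0.
by rewrite iint_gauss_density_lin2 ltry.
Qed.

Lemma integrable_gauss_density_lin v : lam.-integrable setT (fun y => (f y * w v y)%:E).
Proof.
apply: (le_integrable measurableT (g := fun y => (f y)%:E + (f y * w v y ^+ 2)%:E)%E).
- exact/measurable_EFinP.
- move=> y _; rewrite -EFinD !abse_EFin lee_fin normrM (ger0_norm (f0 y)).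
  rewrite [leRHS]ger0_norm; last by rewrite addr_ge0 ?f0// mulr_ge0 ?f0 ?sqr_ge0.
  rewrite -[X in X + _]mulr1 -mulrDr ler_wpM2l// ler_norml; apply/andP; split; nra.
- by apply: integrableD => //; [exact: integrable_gauss_density|exact: integrable_gauss_density_lin2].
Qed.

(** Reflection in the centre preserves the density and exchanges the positive and negative parts of
    the integrand; integrability allows their equal integrals to be subtracted. *)
Lemma integral_gauss_density_lin v : (\int[lam]_y (f y * w v y)%:E = 0)%E.
Proof.
have I := integrable_gauss_density_lin v.
set h := fun y => (f y * w v y)%:E.
have mh : measurable_fun setT h by exact/measurable_EFinP.
have E : (\int[lam]_y h^\- y = \int[lam]_y h^\+ y)%E.
  have mp := measurable_funepos mh; have mn := measurable_funeneg mh.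
  rewrite !integral_fiber//.
  rewrite -(iint_all_reflect (m + m) _ mp)//.
  congr iint; apply/funext => y; rewrite funeposE funenegE; congr (maxe _ _).
  rewrite /h /f /w -EFinN rvecK; congr (_%:E).
  have -> : m + m - vec y - m = - (vec y - m) by rewrite addrAC addrK opprB.
  rewrite linN mulrN; congr (- (c * _ * _)).
  rewrite /gexp rvecK; congr expR.
  have -> : m + m - vec y - m = - (vec y - m) by rewrite addrAC addrK opprB.
  by rewrite qfN.
rewrite integralE E subee//.
exact: integrable_pos_fin_num.
Qed.

Lemma integral_gauss_density v : (\int[lam]_y (f y * lin v (vec y))%:E = (lin v m)%:E)%E.
Proof.
have -> : (fun y => (f y * lin v (vec y))%:E) =
   (fun y => (f y * w v y)%:E + (lin v m)%:E * (f y)%:E)%E.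
  by apply/funext => y; rewrite -EFinM -EFinD /w linB; congr EFin; ring.
have If := integrable_gauss_density.
rewrite integralD//; last 2 first.
- exact: integrable_gauss_density_lin.
- exact: integrableZl.
rewrite integral_gauss_density_lin add0e integralZl//.
rewrite integral_fiber ?iint_gauss_density ?mule1//; exact/measurable_EFinP.
Qed.

Lemma var_gauss_density v : var f v = (qf (invmx P) v)%:E.
Proof.
rewrite /var -/(lin v m).
have E : sint allc (fun x => f x * (vec x *m v^T) 0 0) (@origin R p) = (lin v m)%:E.
  rewrite sint_fiber ?integral_gauss_density//.
  by apply: measurable_funM => //; have := measurable_lin v 0; under eq_fun do rewrite subr0.
rewrite E /=.
have -> : (fun x => f x * ((vec x *m v^T) 0 0 - lin v m) ^+ 2) = (fun x => f x * w v x ^+ 2).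
  by apply/funext => x; rewrite /w linB.
rewrite sint_fiber// integral_fiber; [exact: iint_gauss_density_lin2|exact/measurable_EFinP|].
by move=> y; rewrite lee_fin mulr_ge0 ?sqr_ge0.
Qed.

(** The maximiser is known only almost everywhere, which variances cannot detect. *)
Lemma var_ae_gauss_density q v : measurable_fun setT q ->
  {ae lam, forall x, q x = f x} -> var q v = var f v.
Proof.
move=> mq qf; rewrite /var.
have ml : measurable_fun setT (fun x : T => (vec x *m v^T) 0 0).
  by have := measurable_lin v 0; under eq_fun do rewrite subr0.
have E (g : T -> R) : measurable_fun setT g ->
    sint allc (fun x => q x * g x) (@origin R p) = sint allc (fun x => f x * g x) (@origin R p).
  move=> mg; rewrite !sint_fiber//; [|exact: measurable_funM..].
  apply: ae_eq_integral => //.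
  - by apply/measurable_EFinP; exact: measurable_funM.
  - by apply/measurable_EFinP; exact: measurable_funM.
  - by apply: filterS qf => x -> _.
rewrite (E _ ml) E//.
by apply: (measurable_funX 2); exact: measurable_funB.
Qed.

End GaussianDensity.

(** * Schur complements and block projections *)

Section Forms.
Variables (R : realType) (p : nat).
Implicit Types (x v : 'rV[R]_p) (A B : 'M[R]_p) (t : R).

(** Matrix inversion reverses the order. Put x = v A^-1; Cauchy-Schwarz for [B] between v B^-1 and x
    gives (qf A^-1 v)^2 <= qf B^-1 v * qf B x, and the hypothesis bounds t qf B x by qf A x = qf
    A^-1 v. No square roots of matrices are involved. *)
Lemma loewner_inv A B t : posdef A -> posdef B -> 0 <= t ->
  (forall x, t * qf B x <= qf A x) -> forall v, t * qf (invmx A) v <= qf (invmx B) v.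
Proof.
move=> pA pB t0 AB v.
have uA := posdef_unit pA; have uB := posdef_unit pB.
have [->|v0] := eqVneq v 0; first by rewrite !qf0 mulr0.
pose x := v *m invmx A.
have xA : qf A x = qf (invmx A) v.
  by rewrite /x /qf bfMl bfMr mulVmx// mul1mx trmx_inv (posdef_sym pA).
have Av0 := posdef_gt0 (posdef_inv pA) v0.
have CS := psd_CS (v *m invmx B) x (posdef_psd pB).
have E1 : bf B (v *m invmx B) x = qf (invmx A) v.
  by rewrite bfMl mulVmx// /x bfMr mul1mx trmx_inv (posdef_sym pA).
have E2 : qf B (v *m invmx B) = qf (invmx B) v.
  by rewrite /qf bfMl bfMr mulVmx// mul1mx trmx_inv (posdef_sym pB).
rewrite E1 E2 in CS; have := AB x; rewrite xA.
have := (posdef_psd (posdef_inv pB)).2 v.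
move: CS Av0; move: (qf (invmx A) v) (qf (invmx B) v) (qf B x) => a b c CS a0 b0 tc.
rewrite -(ler_pM2r a0) -mulrA -expr2.
apply: (@le_trans _ _ (t * (b * c))); first exact: ler_wpM2l.
by rewrite mulrCA; apply: ler_wpM2l.
Qed.

(** Replaces compactness of the unit sphere: Cauchy-Schwarz bounds each squared coordinate of [x] by
    [qf A x] times a diagonal entry of the inverse of [A]. *)
Lemma posdef_dominates A B : posdef A -> exists2 e, 0 < e & forall x, e * qf B x <= qf A x.
Proof.
move=> pA; pose a (i : 'I_p) := qf (invmx A) (delta_mx 0 i).
have a0 i : 0 <= a i by exact: (posdef_psd (posdef_inv pA)).2.
have xa x i : x 0 i ^+ 2 <= qf A x * a i.
  have := psd_CS x (delta_mx 0 i *m invmx A) (posdef_psd pA).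
  rewrite bfMr trmx_inv (posdef_sym pA) mulmxV ?posdef_unit// bf1 trmx_delta -colE mxE.
  by rewrite /qf bfMl bfMr mulVmx ?posdef_unit// mul1mx trmx_inv (posdef_sym pA).
(* The sum comes from y z <= (y^2 + z^2) / 2 applied entrywise to [B]; the added 1 keeps [C]
   positive. *)
pose C := 1 + \sum_i \sum_j `|B i j| * ((a i + a j) / 2).
have C1 : 1 <= C.
  rewrite lerDl; apply: sumr_ge0 => i _; apply: sumr_ge0 => j _.
  by rewrite mulr_ge0// divr_ge0// addr_ge0.
have C0 : 0 < C by rewrite (lt_le_trans _ C1).
exists C^-1; first by rewrite invr_gt0.
move=> x; rewrite mulrC ler_pdivrMr// /C mulrDr mulr1.
have Ax := (posdef_psd pA).2 x; apply: ler_wpDl => //.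
rewrite /qf bfE mulr_sumr; apply: ler_sum => i _.
rewrite mulr_sumr; apply: ler_sum => j _.
rewrite [leRHS]mulrCA (le_trans (ler_norm _))// normrM ler_wpM2l// normrM.
have := xa x i; have := xa x j; rewrite -/(qf A x) -(real_normK (num_real (x 0 i))) -(real_normK (num_real (x 0 j))).
move: (`|x 0 i|) (`|x 0 j|) => y z; have := sqr_ge0 (y - z); nra.
Qed.

End Forms.

Section Blocks.
Variables (R : realType) (p : nat) (J : finType) (blk : 'I_p -> J).
Implicit Types (x v : 'rV[R]_p) (A M : 'M[R]_p) (B C : {set J}).

(** Blocks are handled by projections of the full space instead of submatrices, so that all vectors
    and matrices keep the size [p]. *)
Definition bproj B : 'M[R]_p := diag_mx (\row_i (blk i \in B)%:R).

Lemma mul_proj x B i : (x *m bproj B) 0 i = (blk i \in B)%:R * x 0 i.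
Proof. by rewrite /bproj mul_mx_diag !mxE mulrC. Qed.

Lemma proj_tr B : (bproj B)^T = bproj B. Proof. by rewrite tr_diag_mx. Qed.

Lemma projI B C : bproj B *m bproj C = bproj (B :&: C).
Proof.
rewrite /bproj mulmx_diag; congr diag_mx; apply/rowP => i; rewrite !mxE inE.
by case: (_ \in B); case: (_ \in C); rewrite /= ?mulr0 ?mul0r ?mulr1.
Qed.

Lemma proj_idem B : bproj B *m bproj B = bproj B. Proof. by rewrite projI finset.setIid. Qed.

Lemma proj0 : bproj finset.set0 = 0.
Proof. by apply/matrixP => i j; rewrite !mxE inE mul0rn. Qed.

Lemma projC B : bproj (~: B) = 1%:M - bproj B.
Proof.
apply/matrixP => i j; rewrite !mxE inE; case: (i == j); case: (_ \in B) => /=.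
all: by rewrite ?subrr ?subr0.
Qed.

Lemma projDC B : bproj B + bproj (~: B) = 1%:M. Proof. by rewrite projC addrC subrK. Qed.

Lemma proj_projC B : bproj B *m bproj (~: B) = 0.
Proof. by rewrite projI finset.setICr proj0. Qed.
Lemma projC_proj B : bproj (~: B) *m bproj B = 0.
Proof. by rewrite projI finset.setIC finset.setICr proj0. Qed.

Lemma proj_decomp x B : x = x *m bproj B + x *m bproj (~: B).
Proof. by rewrite -mulmxDr projDC mulmx1. Qed.

Definition pd_on B A := A^T = A /\ forall x, x *m bproj B = x -> x != 0 -> 0 < qf A x.

(** The [B]-block of [A] padded with the identity, which gives an invertible matrix of full size. *)
Definition complete B A := bproj B *m A *m bproj B + bproj (~: B).

Lemma qf_complete B A x : qf (complete B A) x = qf A (x *m bproj B) + qf 1%:M (x *m bproj (~: B)).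
Proof.
rewrite /complete /qf bfDm !bfMl !bfMr !proj_tr; congr (_ + _).
by rewrite mulmx1 proj_idem.
Qed.

Lemma qf1_ge0 x : 0 <= qf 1%:M x.
Proof. by rewrite /qf bf1 mxE sumr_ge0// => i _; rewrite mxE -expr2 sqr_ge0. Qed.

Lemma qf1_gt0 x : x != 0 -> 0 < qf 1%:M x.
Proof.
move=> x0; rewrite lt_neqAle qf1_ge0 andbT eq_sym; apply: contra x0 => /eqP.
rewrite /qf bf1 mxE => /eqP; rewrite psumr_eq0; last by move=> i _; rewrite mxE -expr2 sqr_ge0.
move=> /allP h; apply/eqP/rowP => i; have := h i (mem_index_enum _).
by rewrite mxE -expr2 sqrf_eq0 mxE => /eqP.
Qed.

Lemma posdef_complete B A : pd_on B A -> posdef (complete B A).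
Proof.
move=> [sA pA]; split.
  by rewrite /complete linearD /= !trmx_mul !proj_tr sA mulmxA.
move=> x x0; rewrite -/(bf (complete B A) x x) -/(qf (complete B A) x) qf_complete.
have [xB|xB] := eqVneq (x *m bproj B) 0.
  rewrite xB qf0 add0r qf1_gt0//; apply: contra x0 => /eqP xC.
  by rewrite (proj_decomp x B) xB xC addr0.
by rewrite ltr_pwDl ?qf1_ge0// pA// -mulmxA proj_idem.
Qed.

(* The inverse of the [B]-block of [A], extended by zero. *)
Definition cinv B A := bproj B *m invmx (complete B A) *m bproj B.

Section cinv.
Variables (B : {set J}) (A : 'M[R]_p).
Hypothesis pA : pd_on B A.
Let W := complete B A.
Let uW : W \in unitmx := posdef_unit (posdef_complete pA).

Lemma proj_complete : bproj B *m W = bproj B *m A *m bproj B.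
Proof. by rewrite /W /complete mulmxDr !mulmxA proj_idem proj_projC addr0. Qed.

Lemma complete_proj : W *m bproj B = bproj B *m A *m bproj B.
Proof. by rewrite /W /complete mulmxDl -!mulmxA proj_idem projC_proj addr0. Qed.

Lemma proj_invW : bproj B *m invmx W = invmx W *m bproj B.
Proof.
apply: (can_inj (mulKmx uW)); rewrite mulKVmx// mulmxA complete_proj -proj_complete.
by rewrite mulmxK.
Qed.

Lemma cinvE : cinv B A = bproj B *m invmx W.
Proof. by rewrite /cinv proj_invW -mulmxA proj_idem. Qed.

Lemma cinv_tr : (cinv B A)^T = cinv B A.
Proof.
by rewrite /cinv !trmx_mul !proj_tr trmx_inv (posdef_sym (posdef_complete pA)) mulmxA.
Qed.

Lemma proj_cinv : bproj B *m cinv B A = cinv B A.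
Proof. by rewrite /cinv !mulmxA proj_idem. Qed.

Lemma cinv_proj : cinv B A *m bproj B = cinv B A.
Proof. by rewrite /cinv -!mulmxA proj_idem. Qed.

Lemma proj_mul_cinv : bproj B *m A *m cinv B A = bproj B.
Proof.
by rewrite cinvE mulmxA -proj_complete mulmxK.
Qed.

Lemma cinv_mul_proj : cinv B A *m A *m bproj B = bproj B.
Proof.
have := congr1 trmx proj_mul_cinv.
by rewrite trmx_mul cinv_tr trmx_mul proj_tr pA.1 mulmxA.
Qed.

Lemma cinvK : cinv B A *m A *m cinv B A = cinv B A.
Proof.
rewrite -{1}cinv_proj -(mulmxA (cinv B A) (bproj B) A).
by rewrite -(mulmxA (cinv B A) (bproj B *m A)) proj_mul_cinv cinv_proj.
Qed.

End cinv.

Lemma posdef_pd_on B A : posdef A -> pd_on B A.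
Proof. by case=> sA pA; split=> // x _; exact: pA. Qed.

Section schur.
Variables (U : {set J}) (Q : 'M[R]_p).
Hypothesis pQ : posdef Q.
Let C := ~: U.
Let pC : pd_on C Q := posdef_pd_on C pQ.

Definition condT := cinv C Q.
(* [mu_C - (x - mu)_U Q condT] is the mean of [theta_C] given [theta_U = x_U]; the
   conditional density has the quadratic form [condQ] in [x - mu]. *)
Definition condQ := Q *m condT *m Q.
Definition schur := Q - condQ.

Lemma condT_tr : condT^T = condT. Proof. exact: cinv_tr. Qed.

Lemma projC_condT : bproj C *m Q *m condT = bproj C. Proof. exact: proj_mul_cinv. Qed.

Lemma condTK : condT *m Q *m condT = condT. Proof. exact: cinvK. Qed.

Lemma condQ_tr : condQ^T = condQ.
Proof. by rewrite /condQ trmx_mul trmx_mul condT_tr (posdef_sym pQ) mulmxA. Qed.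

Lemma schur_tr : schur^T = schur.
Proof. by rewrite /schur linearB /= condQ_tr (posdef_sym pQ). Qed.

Lemma projC_schur : bproj C *m schur = 0.
Proof. by rewrite /schur /condQ mulmxBr (mulmxA (bproj C) (Q *m condT)) (mulmxA (bproj C) Q) projC_condT subrr. Qed.

Lemma schur_projC : schur *m bproj C = 0.
Proof. by have := congr1 trmx projC_schur; rewrite trmx_mul proj_tr schur_tr trmx0. Qed.

Lemma schur_proj : schur *m bproj U = schur.
Proof.
by rewrite -[in RHS](mulmx1 schur) -(projDC U) mulmxDr schur_projC addr0.
Qed.

Lemma proj_schur : bproj U *m schur = schur.
Proof. by have := congr1 trmx schur_proj; rewrite trmx_mul proj_tr schur_tr. Qed.

Lemma condQK x : x *m Q *m condT *m Q *m condT = x *m Q *m condT.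
Proof.
by rewrite -(mulmxA (x *m Q) condT) -(mulmxA (x *m Q) (condT *m Q)) condTK.
Qed.

Lemma qf_condQ x : qf condQ x = qf Q (x *m Q *m condT).
Proof.
rewrite [in RHS]/qf -(mulmxA x Q) bfMr trmx_mul condT_tr (posdef_sym pQ) bfMl.
rewrite -(mulmxA Q condT) (mulmxA Q condT Q) (mulmxA condT (Q *m condT) Q).
by rewrite (mulmxA condT Q condT) condTK mulmxA.
Qed.

(** [x *m Q *m condT] is the [Q]-orthogonal projection of [x] on the vectors supported in the blocks
    of [C]; the formula is Pythagoras. Its right-hand side is the least value of [Q] among the
    vectors that agree with [x] on [U]. *)
Lemma qf_schur x : qf schur x = qf Q (x - x *m Q *m condT).
Proof.
have sQ := posdef_sym pQ.
rewrite qfB// /schur /qf bfBm -/(qf condQ x) qf_condQ -/(qf Q x).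
have -> : bf Q x (x *m Q *m condT) = qf Q (x *m Q *m condT).
  by rewrite -qf_condQ bfMr bfMr condT_tr sQ.
rewrite /qf; ring.
Qed.

Lemma psd_condQ : psd condQ.
Proof. by split; [exact: condQ_tr|move=> v; rewrite qf_condQ (posdef_psd pQ).2]. Qed.

Lemma psd_schur : psd schur.
Proof. by split; [exact: schur_tr|move=> v; rewrite qf_schur (posdef_psd pQ).2]. Qed.

Lemma condT_projU : condT *m bproj U = 0.
Proof. by rewrite /condT -cinv_proj// -mulmxA projC_proj mulmx0. Qed.

Lemma pd_schur : pd_on U schur.
Proof.
split; first exact: schur_tr.
move=> x xU x0; rewrite qf_schur posdef_gt0//.
apply: contra x0 => /eqP /(congr1 (mulmx^~ (bproj U))).
by rewrite mulmxBl -(mulmxA _ condT) condT_projU mulmx0 subr0 xU mul0mx => ->.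
Qed.

Lemma pd_schur_sub B : B \subset U -> pd_on B schur.
Proof.
move=> BU; split; first exact: schur_tr.
move=> x xB; apply: pd_schur.2; rewrite -xB -mulmxA projI.
by move/finset.setIidPl : BU => ->.
Qed.

Definition bdiag := \sum_(k in U) bproj [set k]%SET *m schur *m bproj [set k]%SET.

Lemma bdiag_tr : bdiag^T = bdiag.
Proof.
rewrite /bdiag linear_sum /=; apply: eq_bigr => k _.
by rewrite !trmx_mul proj_tr schur_tr mulmxA.
Qed.

Lemma bf_bdiag x y : bf bdiag x y =
  \sum_(k in U) bf schur (x *m bproj [set k]%SET) (y *m bproj [set k]%SET).
Proof.
by rewrite /bdiag bf_sum; apply: eq_bigr => k _; rewrite bfMl bfMr proj_tr.
Qed.

Lemma psd_bdiag : psd bdiag.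
Proof.
split; first exact: bdiag_tr.
by move=> v; rewrite /qf bf_bdiag sumr_ge0// => k _; exact: psd_schur.2.
Qed.

Lemma proj_bdiag : bproj U *m bdiag = bdiag.
Proof.
rewrite /bdiag mulmx_sumr; apply: eq_bigr => k kU; rewrite !mulmxA projI.
by have /finset.setIidPr -> : [set k]%SET \subset U by rewrite finset.sub1set.
Qed.

Lemma bdiag_proj : bdiag *m bproj U = bdiag.
Proof. by have := congr1 trmx proj_bdiag; rewrite trmx_mul proj_tr bdiag_tr. Qed.

Lemma qf_bdiag_projU x : qf bdiag (x *m bproj U) = qf bdiag x.
Proof. by rewrite /qf bfMl bfMr proj_tr proj_bdiag bdiag_proj. Qed.

Lemma qf_schur_projU x : qf schur (x *m bproj U) = qf schur x.
Proof. by rewrite /qf bfMl bfMr proj_tr proj_schur schur_proj. Qed.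

Lemma pd_bdiag : pd_on U bdiag.
Proof.
split; first exact: bdiag_tr.
move=> x xU x0; rewrite lt_neqAle psd_bdiag.2 andbT eq_sym; apply: contra x0.
rewrite /qf bf_bdiag psumr_eq0; last by move=> k _; exact: psd_schur.2.
move=> /allP h; apply/eqP/rowP => i; rewrite -xU mul_proj !mxE.
case: (boolP (blk i \in U)) => iU; last by rewrite mul0r.
have := h (blk i) (mem_index_enum _); rewrite iU /= => q0.
have : x *m bproj [set blk i]%SET = 0.
  apply/eqP; apply: contraTT q0 => xi0; rewrite gt_eqF//.
  have sub : [set blk i]%SET \subset U by rewrite finset.sub1set.
  by apply: (pd_schur_sub sub).2 => //; rewrite -mulmxA proj_idem.
by move=> /rowP/(_ i); rewrite mul_proj !mxE inE eqxx mul1r => ->; rewrite ?mulr0.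
Qed.

(* The precision matrix of the maximiser. *)
Definition mfprec := condQ + bdiag.

(** If [x] has a component in [U], the [bdiag] part is positive; otherwise [x] is supported in [C],
    where [condQ] coincides with [Q]. *)
Lemma posdef_mfprec : posdef mfprec.
Proof.
split; first by rewrite /mfprec linearD /= condQ_tr bdiag_tr.
move=> x x0; rewrite -/(bf mfprec x x) -/(qf mfprec x).
have -> : qf mfprec x = qf condQ x + qf bdiag x by rewrite /qf bfDm.
have [xU|xU] := eqVneq (x *m bproj U) 0; last first.
  rewrite ltr_wpDl ?psd_condQ.2// -qf_bdiag_projU pd_bdiag.2//.
  by rewrite -mulmxA proj_idem.
rewrite ltr_pwDl ?psd_bdiag.2// qf_condQ.
have xC : x *m bproj C = x by rewrite {2}(proj_decomp x U) xU add0r.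
by rewrite -{1}xC -(mulmxA x) -(mulmxA x) projC_condT xC posdef_gt0.
Qed.

End schur.

End Blocks.

(** * The uncertainty fraction as an extreme eigenvalue *)

Section Spectral.
Variables (R : realType) (p : nat) (J : finType) (blk : 'I_p -> J).
Variables (U : {set J}) (Q : 'M[R]_p).
Hypothesis pQ : posdef Q.
Local Notation S := (schur blk U Q).
Local Notation D := (bdiag blk U Q).
Local Notation Qs := (mfprec blk U Q).
Local Notation PU := (@bproj R p J blk U).
Local Notation PC := (@bproj R p J blk (~: U)).
Local Notation P1 k := (@bproj R p J blk [set k]%SET).
Implicit Types (d x v : 'rV[R]_p).

(** The form that [UQF] takes once the maximiser is known to be Gaussian with precision [Qs]. *)
Definition uqf_ratio : R :=
  inf [set qf (invmx Qs) v / qf (invmx Q) v | v in [set v : 'rV[R]_p | v != 0]].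

Lemma proj1U k : k \in U -> P1 k *m PU = P1 k.
Proof.
by move=> kU; rewrite projI; congr bproj; apply/finset.setIidPl; rewrite finset.sub1set.
Qed.

Lemma proj11 k l : P1 k *m P1 l = if k == l then P1 k else 0.
Proof.
rewrite projI; case: eqVneq => [->|kl]; first by rewrite finset.setIid.
rewrite (_ : _ :&: _ = finset.set0)%SET ?proj0//.
by apply/setP => m; rewrite !inE; case: eqVneq => // ->; rewrite (negbTE kl).
Qed.

Lemma sum_proj1 : \sum_(k in U) P1 k = PU.
Proof.
apply/row_matrixP => i; rewrite !rowE; apply/rowP => j.
rewrite mulmx_sumr summxE mul_proj.
under eq_bigr do rewrite mul_proj inE.
rewrite -mulr_suml; congr (_ * _).
case: (boolP (blk j \in U)) => jU.
  by rewrite (bigD1 (blk j))//= eqxx big1 ?addr0// => k /andP[_]; rewrite eq_sym => /negbTE ->.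
by rewrite big1// => k kU; case: eqVneq jU => // ->; rewrite kU.
Qed.

Lemma qf_bdiag_block k x : k \in U -> qf D (x *m P1 k) = qf S (x *m P1 k).
Proof.
move=> kU; rewrite /qf bf_bdiag (bigD1 k)//= big1 ?addr0.
  by rewrite -mulmxA proj11 eqxx.
move=> l /andP[_ lk]; rewrite -mulmxA proj11 eq_sym (negbTE lk) mulmx0 bf0l//.
Qed.

Lemma block_nonzero k : (exists i, blk i = k) -> exists2 x : 'rV[R]_p, x *m P1 k = x & x != 0.
Proof.
move=> [i ik]; exists (delta_mx 0 i).
  apply/rowP => j; rewrite mul_proj !mxE inE eqxx /=.
  by case: (eqVneq j i) => [->|]; rewrite ?ik ?eqxx ?mulr1 ?mulr0.
by apply/negP => /eqP/rowP/(_ i); rewrite !mxE !eqxx => /eqP; rewrite oner_eq0.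
Qed.

Let ratio_set := [set qf (invmx Qs) v / qf (invmx Q) v | v in [set v : 'rV[R]_p | v != 0]].

Lemma invQ_gt0 v : v != 0 -> 0 < qf (invmx Q) v.
Proof. exact/posdef_gt0/posdef_inv. Qed.

Lemma ratio_ge0 z : ratio_set z -> 0 <= z.
Proof.
move=> [v v0 <-]; rewrite divr_ge0 ?(ltW (invQ_gt0 v0))//.
exact: (posdef_psd (posdef_inv (posdef_mfprec blk U pQ))).2.
Qed.

Lemma uqf_ratio_le v : uqf_ratio * qf (invmx Q) v <= qf (invmx Qs) v.
Proof.
have [->|v0] := eqVneq v 0; first by rewrite !qf0 mulr0.
rewrite -ler_pdivlMr ?invQ_gt0//; apply: ge_inf; last by exists v.
by exists 0 => z; exact: ratio_ge0.
Qed.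

Hypothesis U0 : U != finset.set0.
Hypothesis blk_surj : forall k, exists i, blk i = k.

Let v1 : exists v : 'rV[R]_p, v != 0.
Proof.
by have /set0Pn[k kU] := U0; have [x _ x0] := block_nonzero (blk_surj k); exists x.
Qed.

Lemma le_uqf_ratio t : (forall v, t * qf (invmx Q) v <= qf (invmx Qs) v) -> t <= uqf_ratio.
Proof.
move=> H; apply: lb_le_inf.
  by have [v v0] := v1; exists (qf (invmx Qs) v / qf (invmx Q) v), v.
by move=> _ [v v0 <-]; rewrite ler_pdivlMr ?invQ_gt0.
Qed.

Lemma uqf_ratio_ge0 : 0 <= uqf_ratio.
Proof.
apply: le_uqf_ratio => v; rewrite mul0r.
exact: (posdef_psd (posdef_inv (posdef_mfprec blk U pQ))).2.
Qed.

Lemma qf_mfprec x : qf Qs x = qf (condQ blk U Q) x + qf D x.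
Proof. by rewrite /qf bfDm. Qed.

Lemma qf_Q x : qf Q x = qf (condQ blk U Q) x + qf S x.
Proof. by rewrite /schur /qf bfBm addrC subrK. Qed.

(** Inverting gives [uqf_ratio] Qs <= Q. At the completion [x - x *m Q *m condT] the right-hand side
    is [qf S x], while on the left the nonnegative [condQ] part is dropped and [D] sees only the [U]
    coordinates of [x]. *)
Lemma uqf_bdiag_le x : uqf_ratio * qf D x <= qf S x.
Proof.
have pQs := posdef_mfprec blk U pQ.
have dual := @loewner_inv _ _ (invmx Qs) (invmx Q) uqf_ratio (posdef_inv pQs)
  (posdef_inv pQ) uqf_ratio_ge0 uqf_ratio_le.
rewrite !invmxK in dual.
have := dual (x - x *m Q *m condT blk U Q).
rewrite qf_mfprec -qf_schur// => h; apply: le_trans h; rewrite ler_wpM2l ?uqf_ratio_ge0//.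
rewrite -[leLHS]add0r lerD ?(psd_condQ blk U pQ).2//.
rewrite -[leRHS](qf_bdiag_projU blk U pQ) mulmxBl -(mulmxA (x *m Q)).
by rewrite condT_projU// mulmx0 subr0 qf_bdiag_projU.
Qed.

(** On a nonzero vector supported in a single block of [U], the forms [D] and [S] agree and are
    positive. *)
Lemma uqf_ratio_le1 : uqf_ratio <= 1.
Proof.
have /set0Pn[k kU] := U0; have [x xk x0] := block_nonzero (blk_surj k).
have := uqf_bdiag_le x; rewrite -xk qf_bdiag_block// xk => h.
have sub : [set k]%SET \subset U by rewrite finset.sub1set.
by have q0 := (pd_schur_sub blk pQ sub).2 x xk x0; rewrite -(ler_pM2r q0) mul1r.
Qed.

Lemma qf_proj_U (N : 'M[R]_p) x : PU *m N = N -> N *m PU = N -> qf N (x *m PU) = qf N x.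
Proof. by move=> E1 E2; rewrite /qf bfMl bfMr proj_tr E1 E2. Qed.

(** [S - uqf_ratio *: D] is positive semidefinite, so a null vector of its form is an eigenvector.
    Were there none in [U], the form would dominate a multiple of [D], and a constant larger than
    the infimum would be admissible. *)
Lemma uqf_eigenvector :
  exists d : 'rV[R]_p, [/\ d != 0, d *m PU = d & d *m S = uqf_ratio *: (d *m D)].
Proof.
pose N := S - uqf_ratio *: D.
have NU1 : PU *m N = N by rewrite /N mulmxBr -scalemxAr proj_schur// proj_bdiag.
have NU2 : N *m PU = N by rewrite /N mulmxBl -scalemxAl schur_proj// bdiag_proj.
have qfN x : qf N x = qf S x - uqf_ratio * qf D x by rewrite /qf bfBm bfZm.
have pN : psd N.
  split; first by rewrite /N linearB linearZ /= schur_tr// bdiag_tr.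
  by move=> v; rewrite qfN subr_ge0 uqf_bdiag_le.
suff [d [d0 dU dN]] : exists d : 'rV[R]_p, [/\ d != 0, d *m PU = d & d *m N = 0].
  exists d; split => //; apply/eqP.
  by rewrite -subr_eq0 scalemxAr -mulmxBr -/N dN.
(* The contradiction below needs a constant above [uqf_ratio] but at most 1. At the value 1 any
   vector in a single block already lies in the kernel. *)
have [l1|l1] := eqVneq uqf_ratio 1.
  have /set0Pn[k kU] := U0; have [x xk x0] := block_nonzero (blk_surj k).
  exists x; split => //; first by rewrite -xk -mulmxA proj1U.
  by apply: psd_ker => //; rewrite qfN l1 mul1r -xk qf_bdiag_block// subrr.
have {}l1 : uqf_ratio < 1 by rewrite lt_neqAle l1 uqf_ratio_le1.
(* [N] vanishes on the blocks outside [U]; adding the identity there makes singularity of [W]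
   equivalent to singularity of [N] on [U]. *)
pose W := N + PC.
have WE x : qf W x = qf N (x *m PU) + qf 1%:M (x *m PC).
  rewrite qf_proj_U// /W /qf bfDm [in RHS]bfMl [in RHS]bfMr proj_tr.
  by rewrite mulmx1 proj_idem.
have pW : psd W.
  split; first by rewrite /W linearD /= proj_tr pN.1.
  by move=> v; rewrite WE addr_ge0 ?qf1_ge0 ?pN.2.
case: (boolP (W \in unitmx)) => uW; last first.
  move: uW; rewrite unitmxE unitfE negbK => /det0P[x x0 xW].
  have xPC : x *m PC = 0.
    have := congr1 (mulmx^~ PC) xW; rewrite mul0mx -mulmxA mulmxDl proj_idem.
    by rewrite -NU2 -(mulmxA N) proj_projC mulmx0 add0r.
  have xU : x *m PU = x by rewrite {2}(proj_decomp blk x U) xPC addr0.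
  exists x; split => //.
  by have := xW; rewrite /W mulmxDr xPC addr0.
exfalso; have pdW := psd_unit_posdef pW uW.
have [e e0 He] := posdef_dominates D pdW.
(* The cap at 1 allows t D <= S to be lifted to t Qs <= Q, since both sides contain the same
   [condQ]. *)
pose t := Num.min (uqf_ratio + e) 1.
have t1 : t <= 1 by rewrite ge_min lexx orbT.
have te : t <= uqf_ratio + e by rewrite ge_min lexx.
have lt : uqf_ratio < t by rewrite lt_min l1 ltrDl e0.
clearbody t.
have tSD x : t * qf D x <= qf S x.
  have := He (x *m PU); rewrite WE -mulmxA proj_idem -(mulmxA x) proj_projC mulmx0 qf0 addr0.
  rewrite qf_bdiag_projU// qf_proj_U// qfN.
  have := ler_wpM2r ((psd_bdiag blk U pQ).2 x) te; lra.
have tQ x : t * qf Qs x <= qf Q x.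
  rewrite qf_mfprec qf_Q mulrDr lerD ?tSD//.
  by rewrite -[leRHS]mul1r ler_wpM2r ?(psd_condQ blk U pQ).2.
have t0 : 0 <= t by rewrite (le_trans uqf_ratio_ge0)// ltW.
have := le_uqf_ratio (loewner_inv pQ (posdef_mfprec blk U pQ) t0 tQ).
by rewrite leNgt lt.
Qed.

Definition blockT k : 'M[R]_p := cinv blk [set k]%SET S.

Section block.
Variable k : J.
Hypothesis kU : k \in U.
Let pk : pd_on blk [set k]%SET S.
Proof. by apply: pd_schur_sub => //; rewrite finset.sub1set. Qed.

Lemma blockT_tr : (blockT k)^T = blockT k. Proof. exact: cinv_tr. Qed.
Lemma blockT_proj : blockT k *m P1 k = blockT k. Proof. exact: cinv_proj. Qed.
Lemma proj_blockT : P1 k *m blockT k = blockT k. Proof. exact: proj_cinv. Qed.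
Lemma proj_mul_blockT : P1 k *m S *m blockT k = P1 k. Proof. exact: proj_mul_cinv. Qed.
Lemma blockT_mul_proj : blockT k *m S *m P1 k = P1 k. Proof. exact: cinv_mul_proj. Qed.
Lemma blockTK : blockT k *m S *m blockT k = blockT k. Proof. exact: cinvK. Qed.

Lemma blockT_bdiag : blockT k *m D = P1 k.
Proof.
rewrite -[in LHS]blockT_proj -mulmxA.
have -> : P1 k *m D = P1 k *m S *m P1 k.
  rewrite /bdiag mulmx_sumr (bigD1 k)//= big1 ?addr0.
    by rewrite !mulmxA proj_idem.
  by move=> l /andP[_ lk]; rewrite !mulmxA proj11 eq_sym (negbTE lk) !mul0mx.
by rewrite !mulmxA blockT_proj blockT_mul_proj.
Qed.

(* Exact minimisation of [qf S d] over the [k]-th block of [d]. *)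
Definition dstep d := d - d *m S *m blockT k.

Lemma dstep_projU d : d *m PU = d -> dstep d *m PU = dstep d.
Proof.
move=> dU; rewrite /dstep mulmxBl dU -(mulmxA (d *m S)); congr (_ - _ *m _).
by rewrite -[in LHS]blockT_proj -mulmxA proj1U// blockT_proj.
Qed.

Lemma qf_dstep d : qf S (dstep d) = qf S d - qf (blockT k) (d *m S).
Proof.
have sS := schur_tr blk U pQ.
rewrite /dstep qfB//.
have -> : bf S d (d *m S *m blockT k) = qf (blockT k) (d *m S).
  by rewrite bfMr blockT_tr [in RHS]/qf [in RHS]bfMl.
have -> : qf S (d *m S *m blockT k) = qf (blockT k) (d *m S).
  by rewrite /qf bfMl bfMr blockT_tr blockTK.
ring.
Qed.

End block.

(** The total decrease of the quadratic part over all single-block updates. The sum of the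
    [blockT k] inverts [D] on [U], and for [e = d *m S *m Dinv] one has bf D e d = qf S d.
    Cauchy-Schwarz gives (qf S d)^2 <= qf D e * qf D d, and [uqf_bdiag_le] bounds the last
    factor. *)
Lemma sum_qf_blockT d : uqf_ratio * qf S d <= \sum_(k in U) qf (blockT k) (d *m S).
Proof.
pose Dinv := \sum_(k in U) blockT k.
have DinvD : Dinv *m D = PU.
  by rewrite /Dinv mulmx_suml -sum_proj1; apply: eq_bigr => k kU; rewrite blockT_bdiag.
have Dinv_tr : Dinv^T = Dinv.
  by rewrite /Dinv linear_sum /=; apply: eq_bigr => k kU; rewrite blockT_tr.
have -> : \sum_(k in U) qf (blockT k) (d *m S) = qf Dinv (d *m S).
  by rewrite /qf /Dinv bf_sum.
pose e := d *m S *m Dinv.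
have SU : S *m PU = S by rewrite schur_proj.
have E1 : qf Dinv (d *m S) = qf D e.
  have PUDinv : PU *m Dinv = Dinv.
    rewrite /Dinv mulmx_sumr; apply: eq_bigr => k kU.
    by rewrite -[in LHS]proj_blockT mulmxA projI finset.setIC -projI proj1U// proj_blockT.
  by rewrite /e [in RHS]/qf bfMl bfMr Dinv_tr DinvD PUDinv.
have E2 : bf D e d = qf S d.
  by rewrite /e bfMl DinvD bfMl SU.
have CS := psd_CS e d (psd_bdiag blk U pQ).
rewrite E2 -E1 in CS.
have := uqf_bdiag_le d; have := (psd_schur blk U pQ).2 d.
have := (psd_bdiag blk U pQ).2 e; rewrite -E1.
have := uqf_ratio_ge0.
move: CS; move: (qf S d) (qf Dinv _) (qf D d) uqf_ratio => s a b l CS l0 a0.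
rewrite le_eqVlt => /predU1P[<-|s0] lb; first by rewrite mulr0.
rewrite -(ler_pM2r s0) -mulrA -expr2.
apply: (le_trans (ler_wpM2l l0 CS)).
by rewrite mulrCA ler_wpM2l.
Qed.

(** Each step is linear in [d], and the corrections add up to [d *m S] times the inverse of [D] on
    [U]. Paired with [d0 *m S = uqf_ratio *: (d0 *m D)], that inverse cancels and a multiple of
    [bf S d d0] remains. *)
Lemma sum_bf_dstep d d0 : d0 *m PU = d0 -> d0 *m S = uqf_ratio *: (d0 *m D) ->
  \sum_(k in U) bf S (dstep k d) d0 = (#|U|%:R - uqf_ratio) * bf S d d0.
Proof.
move=> d0U d0E.
have sS := schur_tr blk U pQ.
under eq_bigr => k kU.
  have -> : bf S (dstep k d) d0 = bf S d d0 - uqf_ratio * bf 1%:M (d *m S *m P1 k) d0.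
    rewrite /dstep bfBl; congr (_ - _).
    transitivity (bf 1%:M (d *m S *m blockT k) (d0 *m S)); first by rewrite bfMr mul1mx sS.
    rewrite d0E bfZr; congr (_ * _).
    by rewrite bfMr mul1mx bdiag_tr// bfMl blockT_bdiag// [in RHS]bfMl mulmx1.
  over.
rewrite sumrB sumr_const -mulr_sumr mulrBl mulr_natl; congr (_ - _ * _).
transitivity (bf PU (d *m S) d0).
  rewrite -sum_proj1 bf_sum; apply: eq_bigr => k kU.
  by rewrite [in LHS]bfMl mulmx1.
by rewrite bfMl schur_proj.
Qed.

End Spectral.

(** * Block densities and their moments *)

Section BlockCoordinates.
Variables (R : realType) (p K : nat) (blk : 'I_p -> 'I_K.+1).
Local Notation T := (p.-tuple R).
Local Notation allc := (@allc p).
Local Notation coords := (coords blk).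
Local Notation block k := (coords [set k]%SET).
Implicit Types (x y z : T) (A B : {set 'I_K.+1}) (k l : 'I_K.+1).

Lemma mem_coords B i : (i \in coords B) = (blk i \in B).
Proof. by rewrite mem_filter mem_enum andbT. Qed.

Lemma mem_block k i : (i \in block k) = (blk i == k).
Proof. by rewrite mem_coords inE. Qed.

Lemma uniq_coords B : uniq (coords B). Proof. by rewrite filter_uniq ?enum_uniq. Qed.

Lemma perm_coordsC B : perm_eq allc (coords B ++ coords (~: B)).
Proof.
rewrite uniq_perm ?enum_uniq//.
  rewrite cat_uniq !uniq_coords andbT /=; apply/hasPn => i; rewrite !mem_coords inE => //.
by move=> i; rewrite mem_cat !mem_coords inE mem_enum orbN.
Qed.

Lemma uniq_blocks (s : seq 'I_K.+1) : uniq s -> uniq (flatten [seq block k | k <- s]).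
Proof.
elim: s => //= k s IH /andP[ks us]; rewrite cat_uniq uniq_coords IH// andbT /=.
apply/hasPn => i /flattenP[_ /mapP[l ls ->]]; rewrite !mem_block => /eqP il.
by rewrite il; apply: contra ks => /eqP <-.
Qed.

Lemma perm_blocks B : perm_eq (coords B) (flatten [seq block k | k <- enum B]).
Proof.
rewrite uniq_perm ?uniq_coords ?uniq_blocks ?enum_uniq//.
move=> i; rewrite mem_coords; apply/idP/flattenP.
  by move=> iB; exists (block (blk i)); rewrite ?mem_block//; apply/mapP; exists (blk i); rewrite ?mem_enum.
by move=> [_ /mapP[k + ->]]; rewrite mem_block mem_enum => + /eqP ->.
Qed.

Definition dep X B (f : T -> X) :=
  forall x y, (forall i, blk i \in B -> tnth x i = tnth y i) -> f x = f y.

Lemma dep_sub X A B (f : T -> X) : A \subset B -> dep A f -> dep B f.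
Proof. by move=> AB fA x y xy; apply: fA => i /(fintype.subsetP AB); exact: xy. Qed.

Lemma dep_iint B f x y : dep B f -> iint (coords B) f x = iint (coords B) f y.
Proof.
move=> fB; apply: eq_iint2 => z z' _ _ zz'; apply: fB => i.
by rewrite -mem_coords; exact: zz'.
Qed.

Lemma dep_comp X Y B (f : T -> X) (h : X -> Y) : dep B f -> dep B (h \o f).
Proof. by move=> fB x y xy /=; rewrite (fB x y). Qed.

Lemma dep_op X Y Z B (f : T -> X) (g : T -> Y) (h : X -> Y -> Z) : dep B f -> dep B g ->
  dep B (fun x => h (f x) (g x)).
Proof. by move=> fB gB x y xy /=; rewrite (fB x y)// (gB x y). Qed.

Lemma dep_proj B (x y : T) (m : 'rV[R]_p) : (forall i, blk i \in B -> tnth x i = tnth y i) ->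
  (vec x - m) *m bproj R blk B = (vec y - m) *m bproj R blk B.
Proof.
move=> xy; apply/rowP => i; rewrite !mul_proj !mxE.
by case: (boolP (blk i \in B)) => iB; rewrite ?mul0r ?xy.
Qed.

Lemma measurable_vec_proj B (m : 'rV[R]_p) i :
  measurable_fun setT (fun x => ((vec x - m) *m bproj R blk B) 0 i).
Proof.
have -> : (fun x => ((vec x - m) *m bproj R blk B) 0 i) =
    (fun x => (blk i \in B)%:R * (vec x - m) 0 i).
  by apply/funext => x; rewrite mul_proj.
by apply: measurable_funM => //; exact: measurable_vec_sub.
Qed.

Lemma iint_prod2 A B f g x : (A :&: B)%SET = finset.set0 ->
  measurable_fun setT f -> (forall y, 0 <= f y)%E ->
  measurable_fun setT g -> (forall y, 0 <= g y)%E -> dep A f -> dep B g ->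
  iint (coords A ++ coords B) (fun y => f y * g y)%E x
  = (iint (coords A) f x * iint (coords B) g x)%E.
Proof.
move=> dAB mf f0 mg g0 fA gB; rewrite iint_cat.
transitivity (iint (coords A) (fun y => iint (coords B) g y * f y)%E x).
  congr iint; apply/funext => y; rewrite iint_Mindep//; first by rewrite muleC.
  move=> z zy; apply: fA => i iA; apply: zy; rewrite mem_coords.
  by apply/negP => iB; have /finset.setP/(_ (blk i)) := dAB; rewrite !inE iA iB.
rewrite iint_Mindep//; first by rewrite muleC.
  by move=> y; exact: iint_ge0.
by move=> y _; exact: dep_iint.
Qed.

Lemma iint_blocks B (F : 'I_K.+1 -> T -> \bar R) x :
  (forall k, measurable_fun setT (F k)) -> (forall k y, 0 <= F k y)%E ->
  (forall k, k \in B -> dep [set k]%SET (F k)) ->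
  iint (coords B) (fun y => \prod_(k in B) F k y)%E x
  = (\prod_(k in B) iint (block k) (F k) x)%E.
Proof.
move=> mF F0 Fdep.
have E (G : 'I_K.+1 -> \bar R) : (\prod_(k in B) G k = \prod_(k <- enum B) G k)%E.
  by rewrite big_enum.
under [in LHS]eq_fun do rewrite E.
rewrite E (perm_iint _ (uniq_coords B) (perm_blocks B)).
- apply: iint_prod => //; first by rewrite uniq_blocks// enum_uniq.
  move=> k; rewrite mem_enum => kB y y' yy'; apply: (Fdep k kB) => i.
  by rewrite inE -mem_block; exact: yy'.
- exact: measurable_prodE.
- by move=> y; exact: prode_ge0.
Qed.

End BlockCoordinates.

Section BlockMass.
Variables (R : realType) (p K : nat) (blk : 'I_p -> 'I_K.+1).
Local Notation T := (p.-tuple R).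
Local Notation coords := (coords blk).
Variables (B : {set 'I_K.+1}) (A : 'M[R]_p).
Hypothesis pA : pd_on blk B A.
Local Notation PB := (bproj R blk B).

Definition bexp (m : 'rV[R]_p) (x : T) : R := expR (- (1 / 2) * qf A ((vec x - m) *m PB)).

Lemma bexp_gt0 m x : 0 < bexp m x. Proof. exact: expR_gt0. Qed.

Lemma dep_bexp m : dep blk B (bexp m).
Proof. by move=> x y xy; rewrite /bexp (dep_proj _ xy). Qed.

Lemma measurable_bexp m : measurable_fun setT (bexp m).
Proof.
apply: (measurableT_comp (@measurable_expR R)); apply: measurable_funM => //.
by apply: measurable_bf => i; exact: measurable_vec_proj.
Qed.

(** The normalising constant is kept as an integral; its positivity and finiteness are established
    in [bmass_spec]. *)
Definition bmass : R := fine (iint (coords B) (fun y => (bexp 0 y)%:E) (@origin R p)).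

Lemma iint_bexp_shift m x :
  iint (coords B) (fun y => (bexp m y)%:E) x = iint (coords B) (fun y => (bexp 0 y)%:E) x.
Proof.
have e1 : (1 : R) = 1 \/ (1 : R) = -1 by left.
have mb : measurable_fun setT (fun y => (bexp 0 y)%:E).
  by apply/measurable_EFinP; exact: measurable_bexp.
rewrite -[RHS](iint_affmap (l := fun i _ => - m 0 i) x (uniq_coords blk B) e1)//; last first.
  by move=> y; rewrite lee_fin ltW ?bexp_gt0.
congr iint; apply/funext => y /=; congr (expR (_ * qf A _))%:E.
apply/rowP => i; rewrite !mul_proj !mxE tnth_affmap mem_coords.
by case: ifP => iB; rewrite ?mul0r// mul1r subr0.
Qed.

(** Multiplied by a standard Gaussian kernel in the complementary coordinates, the kernel becomes
    that of [complete B A], whose mass is finite and positive. A product of nonnegative extended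
    reals with such a value has finite and positive factors. *)
Lemma bmass_spec x : 0 < bmass /\ iint (coords B) (fun y => (bexp 0 y)%:E) x = bmass%:E.
Proof.
set I := iint _ _ x.
have mb : measurable_fun setT (fun y => (bexp 0 y)%:E).
  by apply/measurable_EFinP; exact: measurable_bexp.
have b0 y : (0 <= (bexp 0 y)%:E)%E by rewrite lee_fin ltW ?bexp_gt0.
pose g (y : T) := expR (- (1 / 2) * qf 1%:M ((vec y - 0) *m bproj R blk (~: B))).
have mg : measurable_fun setT (fun y => (g y)%:E).
  apply/measurable_EFinP/(measurableT_comp (@measurable_expR R)).
  apply: measurable_funM => //.
  by apply: measurable_bf => i; exact: measurable_vec_proj.
have g0 y : (0 <= (g y)%:E)%E by rewrite lee_fin expR_ge0.
have pW := posdef_complete pA.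
have E := iint_gexp 0 x pW; rewrite -/(gmass _) in E.
have Z0 := gmass_gt0 pW.
have : (I * iint (coords (~: B)) (fun y => (g y)%:E) x = (gmass (complete blk B A))%:E)%E.
  rewrite /I -E -iint_prod2//.
  - rewrite (perm_iint _ (uniq_allc p) (perm_coordsC blk B)).
    + congr iint; apply/funext => y; rewrite -EFinM -expRD /gexp; congr (expR _)%:E.
      by rewrite qf_complete mulrDr.
    + by apply/measurable_EFinP; exact: measurable_gexp.
    + by move=> y; rewrite lee_fin ltW ?gexp_gt0.
  - exact: finset.setICr.
  - by apply: (dep_comp EFin); exact: dep_bexp.
  - by apply: (dep_comp EFin) => y y' yy'; rewrite /g (dep_proj _ yy').
have I0 : (0 <= I)%E by exact: iint_ge0.
have J0 : (0 <= iint (coords (~: B)) (fun y => (g y)%:E) x)%E by exact: iint_ge0.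
have IE : bmass = fine I.
  rewrite /bmass /I; congr fine; apply: dep_iint.
  by apply: (dep_comp EFin); exact: dep_bexp.
rewrite IE; move: I0 J0; move: (iint (coords (~: B)) _ x) I {IE} => J [r| |]//.
  rewrite lee_fin => r0 _ rJ; split => //=.
  rewrite lt_neqAle r0 andbT; apply/eqP => r00.
  by move: rJ; rewrite -r00 mul0e => -[z]; rewrite -z ltxx in Z0.
move=> _ J0 rJ; exfalso.
have [J00|Jn0] := eqVneq J 0%E; first by move: rJ; rewrite J00 mule0 => -[z]; rewrite -z ltxx in Z0.
by move: rJ; rewrite gt0_mulye// lt_neqAle eq_sym Jn0.
Qed.

Lemma bmass_gt0 : 0 < bmass. Proof. by have [] := bmass_spec (@origin R p). Qed.

Lemma iint_bexp m x : iint (coords B) (fun y => (bexp m y)%:E) x = bmass%:E.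
Proof. by rewrite iint_bexp_shift; have [] := bmass_spec x. Qed.

End BlockMass.

Section HasInt.
Context d (X : measurableType d) (R : realType) (mu : {measure set X -> \bar R}).
Implicit Types (f g h : X -> R) (a b : R).

(** Integrability and value are bundled so that each linearity rule transports both at once. *)
Definition has_int f a :=
  mu.-integrable setT (EFin \o f) /\ (\int[mu]_x (f x)%:E = a%:E)%E.

Lemma has_intD f g a b : has_int f a -> has_int g b -> has_int (fun x => f x + g x) (a + b).
Proof.
move=> [If Ef] [Ig Eg]; split.
  by have := integrableD measurableT If Ig.
under eq_integral do rewrite EFinD.
by rewrite integralD// Ef Eg.
Qed.

Lemma has_intZ f a c : has_int f a -> has_int (fun x => c * f x) (c * a).
Proof.
move=> [If Ef]; split; first by have := integrableZl measurableT c If.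
under eq_integral do rewrite EFinM.
by rewrite integralZl// Ef.
Qed.

Lemma has_int0 : has_int (fun=> 0) 0.
Proof. by split; [exact: integrable0|rewrite integral0]. Qed.

Lemma has_int_sum (I : Type) (r : seq I) (P : pred I) (F : I -> X -> R) (A : I -> R) :
  (forall i, P i -> has_int (F i) (A i)) ->
  has_int (fun x => \sum_(i <- r | P i) F i x) (\sum_(i <- r | P i) A i).
Proof.
move=> H; elim: r => [|i r IH].
  by rewrite big_nil; under eq_fun do rewrite big_nil; exact: has_int0.
rewrite big_cons; under eq_fun do rewrite big_cons.
by case: ifPn => // Pi; apply: has_intD => //; exact: H.
Qed.

Lemma has_intN f a : has_int f a -> has_int (fun x => - f x) (- a).
Proof.
move=> /(has_intZ (-1)); rewrite mulN1r; under eq_fun do rewrite mulN1r; exact.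
Qed.

Lemma has_intB f g a b : has_int f a -> has_int g b -> has_int (fun x => f x - g x) (a - b).
Proof. by move=> Hf /has_intN; exact: has_intD. Qed.

Lemma has_int_uniq f a b : has_int f a -> has_int f b -> a = b.
Proof. by move=> [_ E1] [_]; rewrite E1 => -[]. Qed.

Lemma has_int_measurable f a : has_int f a -> measurable_fun setT f.
Proof. by move=> [/measurable_int /measurable_EFinP]. Qed.

End HasInt.

Section BlockExpectation.
Variables (R : realType) (p K : nat) (blk : 'I_p -> 'I_K.+1).
Local Notation T := (p.-tuple R).
Local Notation coords := (coords blk).
Local Notation block k := (coords [set k]%SET).
Local Notation "0T" := (@origin R p).
Implicit Types (x y z : T) (k l : 'I_K.+1).

Variable qs : 'I_K.+1 -> T -> R.

(** [fine] turns an infinite integral into 0, so these moments are meaningful under [fin2]. The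
    fibre through the origin can be used because a block density ignores the other coordinates. *)
Definition bmean (i : 'I_p) : R :=
  fine (\int[fiber (block (blk i)) 0T]_z (qs (blk i) z * tnth z i)%:E).
Definition bcov (i j : 'I_p) : R :=
  fine (\int[fiber (block (blk i)) 0T]_z
    (qs (blk i) z * ((tnth z i - bmean i) * (tnth z j - bmean j)))%:E).
Definition fin2 k := forall i, blk i = k ->
  (iint (block k) (fun z => (qs k z * tnth z i ^+ 2)%:E) 0T < +oo)%E.

Variable A : {set 'I_K.+1}.
Hypothesis dq : forall k, k \in A -> block_density blk k (qs k).
Hypothesis q2 : forall k, k \in A -> fin2 k.

Definition bprod z := \prod_(k in A) qs k z.

Lemma density_ge0 k z : k \in A -> 0 <= qs k z. Proof. by move=> /dq[]. Qed.
Lemma density_meas k : k \in A -> measurable_fun setT (qs k). Proof. by move=> /dq[]. Qed.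
Lemma density_dep k : k \in A -> dep blk [set k]%SET (qs k).
Proof. by move=> /dq[_ _ H _] x y xy; apply: H => i ik; apply: xy; rewrite inE ik. Qed.
Lemma density_int k x : k \in A -> iint (block k) (fun z => (qs k z)%:E) x = 1%E.
Proof. by move=> /dq[]. Qed.

Lemma bprod_ge0 z : 0 <= bprod z.
Proof. by apply: prodr_ge0 => k kA; exact: density_ge0. Qed.

Lemma measurable_prod_in (B : {set 'I_K.+1}) (F : 'I_K.+1 -> T -> R) :
  (forall k, k \in B -> measurable_fun setT (F k)) ->
  measurable_fun setT (fun z => \prod_(k in B) F k z).
Proof.
move=> mF; have -> : (fun z => \prod_(k in B) F k z) = (fun z => \prod_(k <- enum B) F k z).
  by apply/funext => z; rewrite big_enum.
have : {subset enum B <= B} by move=> k; rewrite mem_enum.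
elim: (enum B) => [|k s IH] sB.
  by under eq_fun do rewrite big_nil; exact: measurable_cst.
under eq_fun do rewrite big_cons.
apply: measurable_funM; first by apply: mF; apply: sB; rewrite inE eqxx.
by apply: IH => l ls; apply: sB; rewrite inE ls orbT.
Qed.

Lemma measurable_bprod : measurable_fun setT bprod.
Proof. by apply: measurable_prod_in => k; exact: density_meas. Qed.

Lemma dep_bprod : dep blk A bprod.
Proof.
move=> x y xy; apply: eq_bigr => k kA; apply: density_dep => // i.
by rewrite inE => /eqP ik; apply: xy; rewrite ik.
Qed.

Lemma iint_bprod_family (g : 'I_K.+1 -> T -> R) y :
  (forall k, k \in A -> measurable_fun setT (g k)) ->
  (forall k z, k \in A -> 0 <= g k z) ->
  (forall k, k \in A -> dep blk [set k]%SET (g k)) ->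
  iint (coords A) (fun z => (bprod z * \prod_(k in A) g k z)%:E) y
  = (\prod_(k in A) iint (block k) (fun z => (qs k z * g k z)%:E) y)%E.
Proof.
move=> mg g0 gdep.
(* [iint_blocks] asks for measurability and sign at every index, whereas the hypotheses cover [A]
   only; hence the constant 1 elsewhere. *)
pose F k z := if k \in A then (qs k z * g k z)%:E else 1%E.
transitivity (iint (coords A) (fun z => \prod_(k in A) F k z)%E y).
  congr iint; apply/funext => z; rewrite -big_split -prodEFin /=.
  by apply: eq_bigr => k kA; rewrite /F kA.
rewrite iint_blocks.
- apply: eq_bigr => k kA; congr iint; apply/funext => z; by rewrite /F kA.
- move=> k; rewrite /F; case: (boolP (k \in A)) => kA; last exact: measurable_cst.
  by apply/measurable_EFinP/measurable_funM; [exact: density_meas|exact: mg].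
- move=> k z; rewrite /F; case: ifP => // kA.
  by rewrite lee_fin mulr_ge0 ?density_ge0 ?g0.
- move=> k kA x x' xx'; rewrite /F kA (density_dep kA xx').
  by rewrite (gdep k kA _ _ xx').
Qed.

Lemma prod_only1 (F : 'I_K.+1 -> \bar R) k : k \in A ->
  (forall l, l \in A -> l != k -> F l = 1%E) -> (\prod_(l in A) F l = F k)%E.
Proof.
move=> kA F1; rewrite (bigD1 k)//= big1 ?mule1//.
by move=> l /andP[lA lk]; exact: F1.
Qed.

Lemma iint_bprod1 k (g : T -> R) y : k \in A -> measurable_fun setT g ->
  (forall z, 0 <= g z) -> dep blk [set k]%SET g ->
  iint (coords A) (fun z => (bprod z * g z)%:E) y
  = iint (block k) (fun z => (qs k z * g z)%:E) y.
Proof.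
move=> kA mg g0 gk.
pose G l := if l == k then g else fun=> 1.
have -> : (fun z => (bprod z * g z)%:E) = (fun z => (bprod z * \prod_(l in A) G l z)%:E).
  apply/funext => z; rewrite (bigD1 k)//= /G eqxx big1 ?mulr1//.
  by move=> l /andP[_ /negbTE ->].
rewrite iint_bprod_family /G.
- rewrite (prod_only1 kA) ?eqxx// => l lA /negbTE ->.
  by under eq_fun do rewrite mulr1; exact: density_int.
- by move=> l _; case: eqP.
- by move=> l z _; case: eqP.
- by move=> l _; case: eqP => [->//|_] ? ?.
Qed.

Lemma iint_bprod2 k l (g h : T -> R) y : k \in A -> l \in A -> k != l ->
  measurable_fun setT g -> (forall z, 0 <= g z) -> dep blk [set k]%SET g ->
  measurable_fun setT h -> (forall z, 0 <= h z) -> dep blk [set l]%SET h ->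
  iint (coords A) (fun z => (bprod z * (g z * h z))%:E) y
  = (iint (block k) (fun z => (qs k z * g z)%:E) y *
     iint (block l) (fun z => (qs l z * h z)%:E) y)%E.
Proof.
move=> kA lA kl mg g0 gk mh h0 hl; have lk := kl; rewrite eq_sym in lk.
pose G m := if m == k then g else if m == l then h else fun=> 1.
have -> : (fun z => (bprod z * (g z * h z))%:E) = (fun z => (bprod z * \prod_(m in A) G m z)%:E).
  apply/funext => z; rewrite (bigD1 k)//= /G eqxx (bigD1 l) ?lA//= (negbTE lk) eqxx big1 ?mulr1//.
  by move=> m /andP[/andP[_ /negbTE ->] /negbTE ->].
rewrite iint_bprod_family /G.
- rewrite (bigD1 k)//= eqxx (bigD1 l) ?lA//= (negbTE lk) eqxx big1 ?mule1//.
  move=> m /andP[/andP[mA /negbTE ->] /negbTE ->].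
  by under eq_fun do rewrite mulr1; exact: density_int.
- by move=> m _; do 2?case: eqP.
- by move=> m z _; do 2?case: eqP.
- by move=> m _; case: eqP => [->//|_]; case: eqP => [->//|_] ? ?.
Qed.

Lemma iint_bprod y : iint (coords A) (fun z => (bprod z)%:E) y = 1%E.
Proof.
have -> : (fun z => (bprod z)%:E) = (fun z => (bprod z * \prod_(m in A) 1)%:E).
  by apply/funext => z; rewrite big1 ?mulr1.
rewrite (iint_bprod_family (g := fun _ _ => 1))//; rewrite big1// => k kA.
by under eq_fun do rewrite mulr1; exact: density_int.
Qed.

End BlockExpectation.

Section SignedParts.
Variables (R : realType) (p : nat).
Local Notation T := (p.-tuple R).
Implicit Types (f g w : T -> R) (S : seq 'I_p).

Definition rpos f z : R := Num.max (f z) 0.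
Definition rneg f z : R := Num.max (- f z) 0.

Lemma rpos_ge0 f z : 0 <= rpos f z. Proof. by rewrite le_max lexx orbT. Qed.
Lemma rneg_ge0 f z : 0 <= rneg f z. Proof. by rewrite le_max lexx orbT. Qed.
Lemma measurable_rpos f : measurable_fun setT f -> measurable_fun setT (rpos f).
Proof. by move=> mf; exact: measurable_maxr. Qed.
Lemma measurable_rneg f : measurable_fun setT f -> measurable_fun setT (rneg f).
Proof. by move=> mf; apply: measurable_maxr => //; exact: measurableT_comp. Qed.

(** Splits a signed product into products of nonnegative factors, to which the Tonelli formulas
    apply; with [- b] in place of [b] it yields the negative part. *)
Lemma max0M (a b : R) : Num.max (a * b) 0 =
  Num.max a 0 * Num.max b 0 + Num.max (- a) 0 * Num.max (- b) 0.
Proof.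
have P (c : R) : 0 <= c -> Num.max c 0 = c /\ Num.max (- c) 0 = 0.
  by move=> c0; rewrite max_l// max_r// oppr_le0.
have N (c : R) : c <= 0 -> Num.max c 0 = 0 /\ Num.max (- c) 0 = - c.
  by move=> c0; rewrite max_r// max_l// oppr_ge0.
have /orP[a0|a0] := le_total 0 a; have /orP[b0|b0] := le_total 0 b.
- by rewrite (P a a0).1 (P a a0).2 (P b b0).1 mul0r addr0 max_l// mulr_ge0.
- by rewrite (P a a0).1 (P a a0).2 (N b b0).1 mul0r mulr0 addr0 max_r// mulr_ge0_le0.
- by rewrite (N a a0).1 (N a a0).2 (P b b0).2 mul0r mulr0 addr0 max_r// mulr_le0_ge0.
- by rewrite (N a a0).1 (N a a0).2 (N b b0).2 mul0r add0r mulrNN max_l// mulr_le0.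
Qed.

Lemma rpos_le f z : rpos f z <= `|f z|.
Proof. by rewrite ge_max ler_norm normr_ge0. Qed.
Lemma rneg_le f z : rneg f z <= `|f z|.
Proof. by rewrite ge_max -normrN ler_norm normr_ge0. Qed.

Lemma integral_fiber_posneg S x w f : measurable_fun setT w -> (forall z, 0 <= w z) ->
  measurable_fun setT f ->
  (\int[fiber S x]_z (w z * f z)%:E =
   iint S (fun z => (w z * rpos f z)%:E) x - iint S (fun z => (w z * rneg f z)%:E) x)%E.
Proof.
move=> mw w0 mf; rewrite -sint_fiber; last exact: measurable_funM.
by rewrite /sint; congr (_ - _)%E; congr iint; apply/funext => z;
  rewrite /rpos /rneg maxr_pMr// mulr0 ?mulrN.
Qed.

Lemma integrable_fiberP S x w f : measurable_fun setT w -> (forall z, 0 <= w z) ->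
  measurable_fun setT f ->
  (fiber S x).-integrable setT (fun z => (w z * f z)%:E) <->
  (iint S (fun z => (w z * `|f z|)%:E) x < +oo)%E.
Proof.
move=> mw w0 mf.
have mwf : measurable_fun setT (fun z => (w z * f z)%:E).
  by apply/measurable_EFinP; exact: measurable_funM.
have mn : measurable_fun setT (fun z => (w z * `|f z|)%:E).
  by apply/measurable_EFinP; apply: measurable_funM => //; exact: measurableT_comp.
have E : (\int[fiber S x]_z `|(w z * f z)%:E| = iint S (fun z => (w z * `|f z|)%:E) x)%E.
  rewrite -integral_fiber//; last by move=> z; rewrite lee_fin mulr_ge0.
  by apply: eq_integral => z _; rewrite abse_EFin normrM (ger0_norm (w0 z)).
split; first by move=> /integrableP[_]; rewrite E.
by move=> h; apply/integrableP; split => //; rewrite E.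
Qed.

End SignedParts.

Section BlockCovariance.
Variables (R : realType) (p K : nat) (blk : 'I_p -> 'I_K.+1).
Local Notation T := (p.-tuple R).
Local Notation coords := (coords blk).
Local Notation block k := (coords [set k]%SET).
Local Notation "0T" := (@origin R p).
Implicit Types (x y z : T) (k l : 'I_K.+1).

Variable qs : 'I_K.+1 -> T -> R.
Variable A : {set 'I_K.+1}.
Hypothesis dq : forall k, k \in A -> block_density blk k (qs k).
Hypothesis q2 : forall k, k \in A -> fin2 blk qs k.
Local Notation bprod := (bprod qs A).
Local Notation bmean := (bmean blk qs).
Local Notation bcov := (bcov blk qs).
Let mb := measurable_bprod dq.
Let b0 := bprod_ge0 dq.

Lemma has_int_bprod1 k (f : T -> R) a y : k \in A -> measurable_fun setT f ->
  dep blk [set k]%SET f -> has_int (fiber (block k) 0T) (fun z => qs k z * f z) a ->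
  has_int (fiber (coords A) y) (fun z => bprod z * f z) a.
Proof.
move=> kA mf fk [If Ef].
have mq := density_meas dq kA; have q0 z := density_ge0 dq z kA; have qk := density_dep dq kA.
have mn : measurable_fun setT (fun z => `|f z|) by exact: measurableT_comp.
have fn : dep blk [set k]%SET (fun z => `|f z|) by exact: dep_comp fk.
have D (g : T -> R) : dep blk [set k]%SET g ->
    iint (block k) (fun z => (qs k z * g z)%:E) y = iint (block k) (fun z => (qs k z * g z)%:E) 0T.
  by move=> gk; apply: dep_iint; apply: (dep_comp EFin); exact: dep_op.
have mpf := measurable_rpos mf; have pf0 := rpos_ge0 f.
have mnf := measurable_rneg mf; have nf0 := rneg_ge0 f.
have dpf : dep blk [set k]%SET (rpos f) by apply: (dep_comp (fun t => Num.max t 0)).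
have dnf : dep blk [set k]%SET (rneg f) by apply: (dep_comp (fun t => Num.max (- t) 0)).
split.
  apply/integrable_fiberP => //; rewrite (iint_bprod1 dq y kA)// D//.
  exact/integrable_fiberP.
by rewrite -Ef !integral_fiber_posneg// !(iint_bprod1 dq y kA)// !D.
Qed.

(** Distinct blocks are independent. The mean of [f] being 0, its positive and negative parts have
    equal integrals, so the four products of parts cancel in pairs; integrability makes them finite
    and the subtraction legitimate. *)
Lemma has_int_bprod2 k l (f g : T -> R) b y : k \in A -> l \in A -> k != l ->
  measurable_fun setT f -> dep blk [set k]%SET f ->
  measurable_fun setT g -> dep blk [set l]%SET g ->
  has_int (fiber (block k) 0T) (fun z => qs k z * f z) 0 ->
  has_int (fiber (block l) 0T) (fun z => qs l z * g z) b ->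
  has_int (fiber (coords A) y) (fun z => bprod z * (f z * g z)) 0.
Proof.
move=> kA lA kl mf fk mg gl [If Ef] [Ig _].
have mqk := density_meas dq kA; have qk0 z := density_ge0 dq z kA; have qkd := density_dep dq kA.
have mql := density_meas dq lA; have ql0 z := density_ge0 dq z lA; have qld := density_dep dq lA.
have D k' (h : T -> R) : k' \in A -> dep blk [set k']%SET h ->
    iint (block k') (fun z => (qs k' z * h z)%:E) y = iint (block k') (fun z => (qs k' z * h z)%:E) 0T.
  move=> k'A hk; apply: dep_iint; apply: (dep_comp EFin); apply: dep_op => //.
  exact: (density_dep dq).
have depn k' (h : T -> R) : dep blk [set k']%SET h -> dep blk [set k']%SET (fun z => `|h z|).
  by move=> hk; exact: dep_comp hk.
have depp k' (h : T -> R) : dep blk [set k']%SET h -> dep blk [set k']%SET (rpos h).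
  by move=> hk; apply: (dep_comp (fun t => Num.max t 0)).
have depm k' (h : T -> R) : dep blk [set k']%SET h -> dep blk [set k']%SET (rneg h).
  by move=> hk; apply: (dep_comp (fun t => Num.max (- t) 0)).
have mn (h : T -> R) : measurable_fun setT h -> measurable_fun setT (fun z => `|h z|).
  by move=> mh; exact: measurableT_comp.
have mfg : measurable_fun setT (fun z => f z * g z) by exact: measurable_funM.
have Fn : (iint (block k) (fun z => (qs k z * `|f z|)%:E) y < +oo)%E.
  by rewrite D//; [exact/integrable_fiberP|exact: depn].
have Gn : (iint (block l) (fun z => (qs l z * `|g z|)%:E) y < +oo)%E.
  by rewrite D//; [exact/integrable_fiberP|exact: depn].
have fin k' (h h' : T -> R) : k' \in A -> measurable_fun setT h -> measurable_fun setT h' ->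
   (forall z, 0 <= h' z <= `|h z|) -> 
   (iint (block k') (fun z => (qs k' z * `|h z|)%:E) y < +oo)%E ->
   iint (block k') (fun z => (qs k' z * h' z)%:E) y \is a fin_num.
  move=> k'A mh mh' hh' hy.
  have mq := density_meas dq k'A; have q0 z := density_ge0 dq z k'A.
  rewrite ge0_fin_numE; last first.
    by apply: iint_ge0 => z; rewrite lee_fin mulr_ge0//; case/andP: (hh' z).
  apply: le_lt_trans hy; apply: le_iint.
  - by apply/measurable_EFinP; exact: measurable_funM.
  - by move=> z; rewrite lee_fin mulr_ge0//; case/andP: (hh' z).
  - by apply/measurable_EFinP; apply: measurable_funM => //; exact: mn.
  - by move=> z; rewrite lee_fin ler_wpM2l//; case/andP: (hh' z).
have fpE : iint (block k) (fun z => (qs k z * rpos f z)%:E) y =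
           iint (block k) (fun z => (qs k z * rneg f z)%:E) y.
  have := Ef; rewrite integral_fiber_posneg//.
  rewrite -!D//; [|exact: depm|exact: depp].
  have : iint (block k) (fun z => (qs k z * rpos f z)%:E) y \is a fin_num.
    by apply: (fin _ f) => //; [exact: measurable_rpos|move=> z; rewrite rpos_ge0 rpos_le].
  have : iint (block k) (fun z => (qs k z * rneg f z)%:E) y \is a fin_num.
    by apply: (fin _ f) => //; [exact: measurable_rneg|move=> z; rewrite rneg_ge0 rneg_le].
  move: (iint _ _ y) (iint _ _ y) => [b' | |] [a' | |]// _ _.
  by rewrite -EFinB => -[] /eqP; rewrite subr_eq0 => /eqP ->.
split.
  apply/integrable_fiberP => //.
  under eq_fun do rewrite normrM.
  have mnf := mn f mf; have mng := mn g mg; have dnf := depn _ _ fk; have dng := depn _ _ gl.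
  rewrite (iint_bprod2 dq y kA lA kl mnf _ dnf mng _ dng)//.
  rewrite lte_mul_pinfty//.
    by apply: iint_ge0 => z; rewrite lee_fin mulr_ge0.
  rewrite ge0_fin_numE//.
  by apply: iint_ge0 => z; rewrite lee_fin mulr_ge0.
rewrite integral_fiber_posneg//.
have mprod (h h' : T -> R) : measurable_fun setT h -> measurable_fun setT h' ->
    measurable_fun setT (fun z => (bprod z * (h z * h' z))%:E).
  by move=> mh mh'; apply/measurable_EFinP; apply: measurable_funM => //; exact: measurable_funM.
have -> : (fun z => (bprod z * rpos (fun z => f z * g z) z)%:E) =
  (fun z => (bprod z * (rpos f z * rpos g z))%:E + (bprod z * (rneg f z * rneg g z))%:E)%E.
  by apply/funext => z; rewrite -EFinD -mulrDr /rpos max0M.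
have -> : (fun z => (bprod z * rneg (fun z => f z * g z) z)%:E) =
  (fun z => (bprod z * (rpos f z * rneg g z))%:E + (bprod z * (rneg f z * rpos g z))%:E)%E.
  apply/funext => z; rewrite -EFinD -mulrDr /rpos /rneg; congr (_ * _)%:E.
  by rewrite -mulrN max0M opprK.
have pf := measurable_rpos mf; have nf := measurable_rneg mf.
have pg := measurable_rpos mg; have ng := measurable_rneg mg.
have pf0 := rpos_ge0 f; have nf0 := rneg_ge0 f.
have pg0 := rpos_ge0 g; have ng0 := rneg_ge0 g.
have dpf := depp _ _ fk; have dnf := depm _ _ fk.
have dpg := depp _ _ gl; have dng := depm _ _ gl.
have nn (h h' : T -> R) : (forall z, 0 <= h z) -> (forall z, 0 <= h' z) ->
    forall z, (0 <= (bprod z * (h z * h' z))%:E)%E.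
  by move=> h0 h0' z; rewrite lee_fin !mulr_ge0.
rewrite (iintD _ y (mprod _ _ pf pg) (nn _ _ pf0 pg0) (mprod _ _ nf ng) (nn _ _ nf0 ng0)).
rewrite (iintD _ y (mprod _ _ pf ng) (nn _ _ pf0 ng0) (mprod _ _ nf pg) (nn _ _ nf0 pg0)).
rewrite !(iint_bprod2 dq y kA lA kl)//.
have fpg : iint (block l) (fun z => (qs l z * rpos g z)%:E) y \is a fin_num.
  by apply: (fin _ g) => // z; rewrite rpos_ge0 rpos_le.
have fng : iint (block l) (fun z => (qs l z * rneg g z)%:E) y \is a fin_num.
  by apply: (fin _ g) => // z; rewrite rneg_ge0 rneg_le.
have fnf : iint (block k) (fun z => (qs k z * rneg f z)%:E) y \is a fin_num.
  by apply: (fin _ f) => // z; rewrite rneg_ge0 rneg_le.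
by rewrite fpE [X in (X - _)%E]addeC subee// fin_numD !fin_numM.
Qed.

End BlockCovariance.

Section BlockMoments.
Variables (R : realType) (p K : nat) (blk : 'I_p -> 'I_K.+1).
Local Notation T := (p.-tuple R).
Local Notation coords := (coords blk).
Local Notation block k := (coords [set k]%SET).
Local Notation "0T" := (@origin R p).
Implicit Types (x y z : T) (k l : 'I_K.+1).

Variable qs : 'I_K.+1 -> T -> R.
Variable A : {set 'I_K.+1}.
Hypothesis dq : forall k, k \in A -> block_density blk k (qs k).
Hypothesis q2 : forall k, k \in A -> fin2 blk qs k.
Local Notation bprod := (bprod qs A).
Local Notation bmean := (bmean blk qs).
Local Notation bcov := (bcov blk qs).
Local Notation PA := (bproj R blk A).
Let mb := measurable_bprod dq.
Let b0 := bprod_ge0 dq.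

Lemma dep_coord k i : blk i = k -> dep blk [set k]%SET (fun z => tnth z i).
Proof. by move=> ik x y xy; apply: xy; rewrite inE ik. Qed.

Lemma has_int_density k : k \in A -> has_int (fiber (block k) 0T) (qs k) 1.
Proof.
move=> kA; have mq := density_meas dq kA; have q0 z := density_ge0 dq z kA.
split; last by rewrite integral_fiber ?(density_int dq)//; exact/measurable_EFinP.
by apply: integrable_fiber_ge0 => //; rewrite (density_int dq)// ltry.
Qed.

Lemma integrable_le_quad k i j (f : T -> R) (C : R) : k \in A -> blk i = k -> blk j = k ->
  measurable_fun setT f -> (forall z, `|f z| <= tnth z i ^+ 2 + tnth z j ^+ 2 + C) ->
  (fiber (block k) 0T).-integrable setT (fun z => (qs k z * f z)%:E).
Proof.
move=> kA ik jk mf fC.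
have mq := density_meas dq kA; have q0 z := density_ge0 dq z kA.
have mc (n : 'I_p) : measurable_fun setT (fun z => (qs k z * tnth z n ^+ 2)%:E).
  apply/measurable_EFinP/measurable_funM => //.
  exact: (measurable_funX 2 (measurable_coord n)).
have I2 (n : 'I_p) : blk n = k -> (fiber (block k) 0T).-integrable setT (fun z => (qs k z * tnth z n ^+ 2)%:E).
  move=> nk; apply: integrable_fiber_ge0; first by apply/measurable_EFinP; exact: mc.
    by move=> z; rewrite mulr_ge0 ?sqr_ge0.
  exact: q2.
have [Iq _] := has_int_density kA.
apply: (le_integrable measurableT (g := fun z => ((qs k z * tnth z i ^+ 2)%:E +
   (qs k z * tnth z j ^+ 2)%:E + C%:E * (qs k z)%:E)%E)).
- by apply/measurable_EFinP; exact: measurable_funM.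
- move=> z _; rewrite -EFinM -!EFinD !abse_EFin lee_fin normrM (ger0_norm (q0 z)).
  rewrite [C * _]mulrC -!mulrDr [leRHS]ger0_norm; last first.
    by rewrite mulr_ge0// (le_trans _ (fC z)).
  by rewrite ler_wpM2l.
- apply: integrableD => //; last exact: integrableZl.
  by apply: integrableD => //; exact: I2.
Qed.

Lemma has_int_coord i : blk i \in A ->
  has_int (fiber (block (blk i)) 0T) (fun z => qs (blk i) z * tnth z i) (bmean i).
Proof.
move=> iA; have I : (fiber (block (blk i)) 0T).-integrable setT (fun z => (qs (blk i) z * tnth z i)%:E).
  apply: (@integrable_le_quad _ i i _ 1) => //; first exact: measurable_coord.
  move=> z; rewrite ler_norml; apply/andP; split; nra.
by split => //; rewrite /(bmean _) fineK// integrable_fin_num.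
Qed.

Lemma has_int_centered i : blk i \in A ->
  has_int (fiber (block (blk i)) 0T) (fun z => qs (blk i) z * (tnth z i - bmean i)) 0.
Proof.
move=> iA; have := has_intB (has_int_coord iA) (has_intZ (bmean i) (has_int_density iA)).
rewrite mulr1 subrr; congr has_int; apply/funext => z; ring.
Qed.

Lemma measurable_centered i : measurable_fun setT (fun z => tnth z i - bmean i).
Proof. by apply: measurable_funB => //; exact: measurable_coord. Qed.

Lemma dep_centered k i : blk i = k -> dep blk [set k]%SET (fun z => tnth z i - bmean i).
Proof. by move=> ik x y xy; rewrite (dep_coord ik xy). Qed.

Lemma has_int_cov i j : blk i \in A -> blk j = blk i ->
  has_int (fiber (block (blk i)) 0T)
    (fun z => qs (blk i) z * ((tnth z i - bmean i) * (tnth z j - bmean j))) (bcov i j).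
Proof.
move=> iA ji.
have mm : measurable_fun setT (fun z => (tnth z i - bmean i) * (tnth z j - bmean j)).
  by apply: measurable_funM; exact: measurable_centered.
have I : (fiber (block (blk i)) 0T).-integrable setT
   (fun z => (qs (blk i) z * ((tnth z i - bmean i) * (tnth z j - bmean j)))%:E).
  apply: (@integrable_le_quad _ i j _ (bmean i ^+ 2 + bmean j ^+ 2)) => //.
  move=> z; rewrite ler_norml; move: (tnth z i) (tnth z j) (bmean i) (bmean j) => a c m n.
  by apply/andP; split; have := sqr_ge0 (a - m + (c - n)); have := sqr_ge0 (a - m - (c - n));
    have := sqr_ge0 (a + m); have := sqr_ge0 (c + n); nra.
by split => //; rewrite /(bcov _ _) fineK// integrable_fin_num.
Qed.

(** Entries in blocks that carry no density are arbitrary; they are projected away wherever the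
    vector enters an integral. *)
Definition bmeanv : 'rV[R]_p := \row_i bmean i.

(** The trace of [M] times the covariance of the product density, which is block diagonal by
    independence. *)
Definition blocktr (M : 'M[R]_p) : R :=
  \sum_i \sum_j if (blk i \in A) && (blk j == blk i) then M i j * bcov i j else 0.

Lemma has_int_bprod y : has_int (fiber (coords A) y) bprod 1.
Proof.
split; last by rewrite integral_fiber ?(iint_bprod dq)//; exact/measurable_EFinP.
by apply: integrable_fiber_ge0 => //; rewrite (iint_bprod dq) ltry.
Qed.

Lemma centeredE z i : ((vec z - bmeanv) *m PA) 0 i =
  if blk i \in A then tnth z i - bmean i else 0.
Proof. by rewrite mul_proj !mxE; case: ifP; rewrite ?mul1r ?mul0r. Qed.

Lemma has_int_bprod_centered y i :
  has_int (fiber (coords A) y) (fun z => bprod z * ((vec z - bmeanv) *m PA) 0 i) 0.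
Proof.
under eq_fun do rewrite centeredE.
case: (boolP (blk i \in A)) => iA; last by under eq_fun do rewrite mulr0; exact: has_int0.
apply: (has_int_bprod1 dq y iA).
- exact: measurable_centered.
- exact: dep_centered.
- exact: has_int_centered.
Qed.

Lemma has_int_bprod_cov y i j :
  has_int (fiber (coords A) y)
    (fun z => bprod z * (((vec z - bmeanv) *m PA) 0 i * ((vec z - bmeanv) *m PA) 0 j))
    (if (blk i \in A) && (blk j == blk i) then bcov i j else 0).
Proof.
under eq_fun do rewrite !centeredE.
case: (boolP (blk i \in A)) => iA /=; last first.
  by under eq_fun do rewrite mul0r mulr0; exact: has_int0.
case: (boolP (blk j \in A)) => jA; last first.
  under eq_fun do rewrite !mulr0.
  by case: eqVneq => [ji|_]; [rewrite ji iA in jA|exact: has_int0].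
case: eqVneq => [ji|ji].
  apply: (has_int_bprod1 dq y iA).
  - by apply: measurable_funM; exact: measurable_centered.
  - by apply: dep_op; exact: dep_centered.
  - exact: has_int_cov.
rewrite eq_sym in ji.
apply: (has_int_bprod2 dq y iA jA ji).
- exact: measurable_centered.
- exact: dep_centered.
- exact: measurable_centered.
- exact: dep_centered.
- exact: has_int_centered.
- exact: has_int_centered.
Qed.

(** Bias plus variance: the term linear in the centred variable integrates to 0 and the quadratic
    one gives the trace. *)
Lemma has_int_qf (M : 'M[R]_p) (b : 'rV[R]_p) y : M^T = M ->
  has_int (fiber (coords A) y)
    (fun z => bprod z * qf M (b + (vec z - bmeanv) *m PA)) (qf M b + blocktr M).
Proof.
move=> sM.
have H1 := has_intZ (qf M b) (has_int_bprod y).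
have H2 : has_int (fiber (coords A) y) (fun z => \sum_j (2 * (b *m M) 0 j) *
    (bprod z * ((vec z - bmeanv) *m PA) 0 j)) (\sum_(j < p) (2 * (b *m M) 0 j) * 0).
  by apply: has_int_sum => j _; apply: has_intZ; exact: has_int_bprod_centered.
have H3 : has_int (fiber (coords A) y) (fun z => \sum_i \sum_j M i j *
    (bprod z * (((vec z - bmeanv) *m PA) 0 i * ((vec z - bmeanv) *m PA) 0 j)))
    (\sum_i \sum_j M i j * (if (blk i \in A) && (blk j == blk i) then bcov i j else 0)).
  apply: has_int_sum => i _; apply: has_int_sum => j _; apply: has_intZ.
  exact: has_int_bprod_cov.
have := has_intD (has_intD H1 H2) H3.
rewrite [X in _ + X + _]big1 ?addr0; last by move=> j _; rewrite mulr0.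
rewrite mulr1 /blocktr.
have -> : \sum_i \sum_j M i j * (if (blk i \in A) && (blk j == blk i) then bcov i j else 0) =
    \sum_i \sum_j (if (blk i \in A) && (blk j == blk i) then M i j * bcov i j else 0).
  by apply: eq_bigr => i _; apply: eq_bigr => j _; case: ifP; rewrite ?mulr0.
congr has_int; apply/funext => z; rewrite qfD// !mulrDr.
rewrite [qf M b * _]mulrC; congr (_ + _ + _).
- have -> : bf M b ((vec z - bmeanv) *m PA) =
      \sum_j (b *m M) 0 j * ((vec z - bmeanv) *m PA) 0 j.
    by rewrite /bf mxE; apply: eq_bigr => j _; congr (_ * _); rewrite mxE.
  rewrite !mulr_sumr; apply: eq_bigr => j _; ring.
- rewrite /qf bfE mulr_sumr; apply: eq_bigr => i _; rewrite mulr_sumr; apply: eq_bigr => j _; ring.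
Qed.

End BlockMoments.

(** * Marginals of the Gaussian target *)

Section GaussianMarginals.
Variables (R : realType) (p K : nat) (blk : 'I_p -> 'I_K.+1).
Local Notation T := (p.-tuple R).
Local Notation coords := (coords blk).
Local Notation block k := (coords [set k]%SET).
Local Notation "0T" := (@origin R p).
Implicit Types (x y z : T) (k l : 'I_K.+1).
Variables (U : {set 'I_K.+1}) (mu : 'rV[R]_p) (Q : 'M[R]_p).
Hypothesis pQ : posdef Q.
Local Notation S := (schur blk U Q).
Local Notation Tc := (condT blk U Q).
Local Notation PU := (bproj R blk U).
Local Notation PC := (bproj R blk (~: U)).
Local Notation P1 k := (bproj R blk [set k]%SET).

Definition gconst : R := (Num.sqrt (2 * pi)) ^- p * Num.sqrt (\det Q).

Lemma gaussE x : gauss mu Q x = gconst * gexp mu Q x.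
Proof. by []. Qed.

Lemma sqrt2pi_gt0 : 0 < Num.sqrt (2 * pi) :> R.
Proof. by rewrite sqrtr_gt0 mulr_gt0// pi_gt0. Qed.

Lemma gconst_gmass : gconst * gmass Q = 1.
Proof.
rewrite /gconst /gmass; field.
by rewrite !gt_eqF// ?exprn_gt0 ?sqrtr_gt0 ?det_posdef_gt0 ?sqrt2pi_gt0 ?mulr_gt0 ?pi_gt0.
Qed.

Lemma gconst_gt0 : 0 < gconst.
Proof. by rewrite -(pmulr_lgt0 _ (gmass_gt0 pQ)) gconst_gmass. Qed.

Lemma gauss_gt0 x : 0 < gauss mu Q x.
Proof. by rewrite gaussE mulr_gt0 ?gconst_gt0 ?gexp_gt0. Qed.

Lemma measurable_gauss : measurable_fun setT (gauss mu Q).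
Proof. by apply: measurable_funM => //; exact: measurable_gexp. Qed.

(** With [mexp], splits the Gaussian kernel into the conditional kernel given theta_U and the
    marginal kernel of theta_U, following Q = condQ + S. *)
Definition cexp x : R := expR (- (1 / 2) * qf (condQ blk U Q) (vec x - mu)).
Definition mexp x : R := expR (- (1 / 2) * qf S (vec x - mu)).

Lemma gexp_split x : gexp mu Q x = cexp x * mexp x.
Proof.
rewrite /gexp /cexp /mexp -expRD -mulrDr; congr (expR (_ * _)).
by rewrite /schur /qf bfBm subrKC.
Qed.

Lemma cexp_gt0 x : 0 < cexp x. Proof. exact: expR_gt0. Qed.
Lemma mexp_gt0 x : 0 < mexp x. Proof. exact: expR_gt0. Qed.

Lemma measurable_expR_qf (M : 'M[R]_p) : measurable_fun setT
  (fun x => expR (- (1 / 2) * qf M (vec x - mu))).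
Proof.
apply: (measurableT_comp (@measurable_expR R)); apply: measurable_funM => //.
by apply: measurable_bf => i; exact: measurable_vec_sub.
Qed.

Lemma qf_schur_dep x : qf S (vec x - mu) = qf S ((vec x - mu) *m PU).
Proof. by rewrite qf_schur_projU. Qed.

Lemma dep_mexp : dep blk U mexp.
Proof. by move=> x y xy; rewrite /mexp !qf_schur_dep (dep_proj _ xy). Qed.

Let pC : pd_on blk (~: U) Q := posdef_pd_on blk (~: U) pQ.
Definition cmass := bmass blk (~: U) Q.

Lemma cmass_gt0 : 0 < cmass. Proof. exact: bmass_gt0. Qed.

(** Recentring the coordinates of [C] at their conditional mean is a shift that depends on the [U]
    coordinates only. It leaves a centred kernel, whose mass is the same for all [x]. *)
Lemma iint_cexp x : iint (coords (~: U)) (fun y => (cexp y)%:E) x = cmass%:E.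
Proof.
rewrite -(iint_bexp pC 0 x).
pose l i y := (((vec y - mu) *m PU) *m Q *m Tc - mu) 0 i.
have e1 : (1 : R) = 1 \/ (1 : R) = -1 by left.
have ml i : measurable_fun setT (l i).
  have -> : l i = fun y => \sum_j ((vec y - mu) *m PU) 0 j * (Q *m Tc) j i - mu 0 i.
    by apply/funext => y; rewrite /l -mulmxA mxE [in LHS]mxE [X in _ + X]mxE.
  apply: measurable_funB => //; apply: measurable_sum => j.
  by apply: measurable_funM => //; exact: measurable_vec_proj.
rewrite -[RHS](iint_affmap (l := l) x (uniq_coords blk (~: U)) e1 ml).
- congr iint; apply/funext => y /=; congr (expR (_ * _))%:E.
  rewrite qf_condQ//; congr (qf Q _); apply/rowP => i.
  rewrite [RHS]mul_proj subr0 [in RHS]mxE tnth_affmap mem_coords mul1r.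
  have TcPC : Tc *m PC = Tc by exact: cinv_proj.
  have -> : (vec y - mu) *m Q *m Tc = (vec y - mu) *m PC + (vec y - mu) *m PU *m Q *m Tc.
    rewrite {1}(proj_decomp blk (vec y - mu) U) 2!mulmxDl addrC; congr (_ + _).
    rewrite -(mulmxA (vec y - mu) PC Q) -(mulmxA (vec y - mu) (PC *m Q) Tc).
    by rewrite projC_condT.
  rewrite [LHS]mxE mul_proj /l; set w := (vec y - mu) *m PU *m Q.
  have -> : w *m Tc = w *m Tc *m PC by rewrite -(mulmxA w) TcPC.
  have -> : (w *m Tc *m PC - mu) 0 i = (w *m Tc *m PC) 0 i - mu 0 i by rewrite [LHS]mxE [X in _ + X]mxE.
  rewrite mul_proj; have -> : (vec y - mu) 0 i = tnth y i - mu 0 i by rewrite !mxE.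
  by case: (blk i \in ~: U); rewrite ?mul0r ?addr0// !mul1r; ring.
- move=> i iC y y' yy'; rewrite /l; congr ((_ *m _ *m _ - _) 0 i).
  by apply: dep_proj => j jU; apply: yy'; rewrite mem_coords inE jU.
- by apply/measurable_EFinP; exact: measurable_bexp.
- by move=> y; rewrite lee_fin ltW ?bexp_gt0.
Qed.

Lemma iint_gauss_C x :
  iint (coords (~: U)) (fun y => (gauss mu Q y)%:E) x = (gconst * cmass * mexp x)%:E.
Proof.
have -> : (fun y => (gauss mu Q y)%:E) = (fun y => (gconst * mexp y)%:E * (cexp y)%:E)%E.
  by apply/funext => y; rewrite -EFinM gaussE gexp_split; congr EFin; ring.
rewrite iint_Mindep.
- by rewrite iint_cexp -EFinM; congr EFin; ring.
- by apply/measurable_EFinP; exact: measurable_expR_qf.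
- by move=> y; rewrite lee_fin ltW ?cexp_gt0.
- by move=> y; rewrite lee_fin mulr_ge0 ?ltW ?gconst_gt0 ?mexp_gt0.
- move=> y yx; congr (_ * _)%:E; apply: dep_mexp => i iU; apply: yx.
  by rewrite mem_coords inE iU.
Qed.

Definition mconst : R := gconst * cmass.
Lemma mconst_gt0 : 0 < mconst. Proof. by rewrite mulr_gt0 ?gconst_gt0 ?cmass_gt0. Qed.

Lemma pi_margE x : pi_marg blk U mu Q x = mconst * mexp x.
Proof. by rewrite /pi_marg iint_gauss_C. Qed.

Lemma ln_pi_marg x : ln (pi_marg blk U mu Q x) = ln mconst - 1 / 2 * qf S (vec x - mu).
Proof.
rewrite pi_margE lnM ?posrE ?mconst_gt0 ?mexp_gt0// /mexp expRK.
by rewrite mulNr.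
Qed.

Lemma cond_piE x : cond_pi blk U mu Q x = cexp x / cmass.
Proof.
rewrite /cond_pi pi_margE gaussE gexp_split /mconst; field.
by rewrite !gt_eqF ?mexp_gt0 ?cmass_gt0 ?gconst_gt0.
Qed.

Lemma cond_pi_gt0 x : 0 < cond_pi blk U mu Q x.
Proof. by rewrite cond_piE divr_gt0 ?cexp_gt0 ?cmass_gt0. Qed.

Lemma measurable_cond_pi : measurable_fun setT (cond_pi blk U mu Q).
Proof.
have -> : cond_pi blk U mu Q = fun x => cexp x * cmass^-1 by apply/funext => x; exact: cond_piE.
by apply: measurable_funM => //; exact: measurable_expR_qf.
Qed.

Lemma iint_cond_pi x : iint (coords (~: U)) (fun y => (cond_pi blk U mu Q y)%:E) x = 1%E.
Proof.
have -> : (fun y => (cond_pi blk U mu Q y)%:E) = (fun y => (cmass^-1)%:E * (cexp y)%:E)%E.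
  by apply/funext => y; rewrite cond_piE mulrC.
rewrite iintZl.
- by rewrite iint_cexp -EFinM mulVf// gt_eqF ?cmass_gt0.
- by apply/measurable_EFinP; exact: measurable_expR_qf.
- by move=> y; rewrite lee_fin ltW ?cexp_gt0.
- by rewrite lee_fin invr_ge0 ltW ?cmass_gt0.
Qed.

(* the density of [N(m_k, (S_kk)^-1)] on the block [k] *)
Definition nblock k (m : 'rV[R]_p) x : R :=
  bexp blk [set k]%SET S m x / bmass blk [set k]%SET S.

Lemma pd_block k : k \in U -> pd_on blk [set k]%SET S.
Proof. by move=> kU; apply: pd_schur_sub => //; rewrite finset.sub1set. Qed.

Section nblock.
Variables (k : 'I_K.+1) (m : 'rV[R]_p).
Hypothesis kU : k \in U.
Let pk := pd_block kU.
Let z0 := bmass_gt0 pk.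

Lemma nblock_gt0 x : 0 < nblock k m x.
Proof. by rewrite divr_gt0 ?bexp_gt0. Qed.

Lemma measurable_nblock : measurable_fun setT (nblock k m).
Proof. by apply: measurable_funM => //; exact: measurable_bexp. Qed.

Lemma dep_nblock : dep blk [set k]%SET (nblock k m).
Proof. by move=> x y xy; rewrite /nblock (dep_bexp _ _ xy). Qed.

Lemma iint_nblock x : iint (block k) (fun y => (nblock k m y)%:E) x = 1%E.
Proof.
have -> : (fun y => (nblock k m y)%:E) =
    (fun y => ((bmass blk [set k]%SET S)^-1)%:E * (bexp blk [set k]%SET S m y)%:E)%E.
  by apply/funext => y; rewrite -EFinM mulrC.
rewrite iintZl.
- by rewrite (iint_bexp pk) -EFinM mulVf// gt_eqF.
- by apply/measurable_EFinP; exact: measurable_bexp.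
- by move=> y; rewrite lee_fin ltW ?bexp_gt0.
- by rewrite lee_fin invr_ge0 ltW.
Qed.

Lemma block_density_nblock : block_density blk k (nblock k m).
Proof.
split; first by move=> x; rewrite ltW ?nblock_gt0.
- exact: measurable_nblock.
- by move=> x y xy; apply: dep_nblock => i; rewrite inE => /eqP /xy.
- exact: iint_nblock.
Qed.

End nblock.

Section update.
Variable qs : 'I_K.+1 -> T -> R.
Hypothesis dq : forall k, k \in U -> block_density blk k (qs k).
Hypothesis q2 : forall k, k \in U -> fin2 blk qs k.
Local Notation m := (bmeanv blk qs).

Definition bdev : 'rV[R]_p := (m - mu) *m PU.

Lemma projUD1 k : k \in U -> PU = bproj R blk (U :\ k)%SET + P1 k.
Proof.
move=> kU; apply/row_matrixP => i; rewrite !rowE mulmxDr; apply/rowP => j.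
rewrite [in RHS]mxE !mul_proj !inE -mulrDl; congr (_ * _).
by case: eqVneq => [->|_]; rewrite ?kU /= ?add0r ?addr0.
Qed.

(** Averaging the log marginal over the other factors leaves a quadratic function of block [k].
    Their means enter its linear term, their covariances only its constant, so the result is
    Gaussian whatever the factors are; completing the square puts its centre at the exact block
    minimiser. *)
Lemma updE k x : k \in U -> upd blk U mu Q qs k x = nblock k (mu + dstep blk U Q k bdev) x.
Proof.
move=> kU; have pk := pd_block kU.
pose A := (U :\ k)%SET.
have AU l : l \in A -> l \in U by rewrite inE => /andP[].
have dqA l : l \in A -> block_density blk l (qs l) by move=> /AU /dq.
have q2A l : l \in A -> fin2 blk qs l by move=> /AU /q2.
pose PA := bproj R blk A.
pose b y := (m - mu) *m PA + (vec y - mu) *m P1 k.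
have sS := schur_tr blk U pQ.
have E y : sint (coords A) (fun z => (\prod_(l in A) qs l z) * ln (pi_marg blk U mu Q z)) y =
    (ln mconst - 1 / 2 * (qf S (b y) + blocktr blk qs A S))%:E.
  pose h z := ln mconst * bprod qs A z - 1 / 2 * (bprod qs A z * qf S (b y + (vec z - m) *m PA)).
  have [Ih Eh] : has_int (fiber (coords A) y) h (ln mconst * 1 - 1 / 2 * (qf S (b y) + blocktr blk qs A S)).
    apply: has_intB; apply: has_intZ; first exact: has_int_bprod.
    exact: has_int_qf.
  rewrite mulr1 in Eh; rewrite -Eh -sint_fiber; last first.
    by apply/measurable_EFinP; exact: (measurable_int _ Ih).
  (* The equality holds on the fibre of [y] only, where block [k] is frozen at its value in [y]; the
     integral sees nothing else. *)
  have hE z : (forall i, i \notin coords A -> tnth z i = tnth y i) ->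
      (\prod_(l in A) qs l z) * ln (pi_marg blk U mu Q z) = h z.
    move=> zy; rewrite /h ln_pi_marg -/(bprod qs A z) mulrBr [ln _ * _]mulrC; congr (_ - _).
    rewrite mulrCA qf_schur_dep; congr (_ * (_ * qf S _)).
    rewrite (projUD1 kU) mulmxDr /b -/A -/PA.
    have -> : (vec z - mu) *m P1 k = (vec y - mu) *m P1 k.
      apply: dep_proj => i; rewrite inE => /eqP ik; apply: zy.
      by rewrite mem_coords !inE ik eqxx.
    have -> : vec z - mu = (m - mu) + (vec z - m) by rewrite [RHS]addrC addrA subrK.
    by rewrite mulmxDl addrAC.
  rewrite /sint; congr (_ - _)%E; apply: eq_iint => z zy; by rewrite hE.
pose a := (m - mu) *m PA; pose T1 := blockT blk U Q k.
pose m' := mu + dstep blk U Q k bdev.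
pose w y := (vec y - mu) *m P1 k.
have aE : a = bdev - bdev *m P1 k.
  have P11 : PU *m P1 k = P1 k by rewrite projI finset.setIC -projI proj1U.
  rewrite /bdev -[in X in _ - X](mulmxA (m - mu)) P11 (projUD1 kU) mulmxDr addrK.
  by [].
(* Completing the square: with the other blocks at [a], the form is minimal in block [k] at
   [- a *m S *m T1]. *)
have wa y : w y + a *m S *m T1 = (vec y - m') *m P1 k.
  rewrite aE /m' /dstep -/T1.
  have -> : vec y - (mu + (bdev - bdev *m S *m T1)) = (vec y - mu) - bdev + bdev *m S *m T1.
    by rewrite !opprD opprK !addrA.
  have -> : (bdev - bdev *m P1 k) *m S *m T1 = bdev *m S *m T1 - bdev *m P1 k.
    rewrite 2!mulmxBl -(mulmxA bdev (P1 k)) -(mulmxA bdev (P1 k *m S)).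
    by rewrite proj_mul_blockT//.
  rewrite mulmxDl mulmxBl -(mulmxA (bdev *m S)) blockT_proj.
  by rewrite addrA addrAC.
(* Collects everything independent of block [k], covariances included; the normalisation cancels
   it. *)
pose kappa := ln mconst - 1 / 2 * (qf S a - qf S (a *m S *m T1) + blocktr blk qs A S).
have gE y : expR (fine (sint (coords A)
    (fun z => (\prod_(l in A) qs l z) * ln (pi_marg blk U mu Q z)) y)) =
    expR kappa * bexp blk [set k]%SET S m' y.
  rewrite E /bexp -expRD; congr expR; rewrite /= /kappa -wa.
  have -> : b y = w y + a by rewrite addrC.
  rewrite !qfD//.
  have -> : bf S (w y) (a *m S *m T1) = bf S (w y) a.
    transitivity (bf (S *m T1 *m S) (w y) a); first by rewrite [LHS]bfMr blockT_tr// [LHS]bfMr sS.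
    rewrite /w [LHS]bfMl [RHS]bfMl (mulmxA (P1 k) (S *m T1)) (mulmxA (P1 k) S).
    by rewrite proj_mul_blockT//.
  ring.
rewrite /upd -/A; rewrite gE; under eq_fun do rewrite gE.
rewrite /nblock -/m'.
have -> : iint (block k) (fun y => (expR kappa * bexp blk [set k]%SET S m' y)%:E) x =
    (expR kappa * bmass blk [set k]%SET S)%:E.
  under eq_fun do rewrite EFinM.
  rewrite iintZl.
  - by rewrite (iint_bexp pk) -EFinM.
  - by apply/measurable_EFinP; exact: measurable_bexp.
  - by move=> y; rewrite lee_fin ltW ?bexp_gt0.
  - by rewrite lee_fin expR_ge0.
rewrite /=; field.
by rewrite !gt_eqF ?expR_gt0 ?(bmass_gt0 pk).
Qed.

End update.

End GaussianMarginals.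

(** * The optimality gap *)

Section RelativeEntropyIntegrand.
Variable R : realType.
Implicit Types a b : R.

(* The term [b - a] integrates to 0 for probability densities and makes the
   integrand of the relative entropy pointwise nonnegative. *)
Definition phi a b : R := a * (ln a - ln b) - a + b.

Lemma phi0 b : phi 0 b = b. Proof. by rewrite /phi mul0r subr0 add0r. Qed.

(** For [a > 0] and x = ln b - ln a the value is a (exp x - 1 - x). *)
Lemma phi_ge0 a b : 0 <= a -> 0 < b -> 0 <= phi a b.
Proof.
rewrite le_eqVlt => /predU1P[<-|a0] b0; first by rewrite phi0 ltW.
have := expR_ge1Dx (ln b - ln a); rewrite expRB !lnK ?posrE//.
rewrite ler_pdivlMr// /phi; nra.
Qed.

Lemma phi_eq0 a b : 0 <= a -> 0 < b -> phi a b = 0 -> a = b.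
Proof.
rewrite le_eqVlt => /predU1P[<-|a0] b0; first by rewrite phi0.
move=> h; apply: ln_inj; rewrite ?posrE//; apply/eqP/negPn/negP => ab.
have := @expR_gt1Dx R (ln b - ln a).
rewrite subr_eq0 eq_sym => /(_ ab); rewrite expRB !lnK ?posrE// ltr_pdivlMr//.
move: h; rewrite /phi; nra.
Qed.

Lemma phiZ c a b : 0 < c -> 0 <= a -> 0 < b -> phi (c * a) (c * b) = c * phi a b.
Proof.
move=> c0; rewrite le_eqVlt => /predU1P[<-|a0] b0; first by rewrite mulr0 !phi0.
by rewrite /phi !lnM ?posrE//; ring.
Qed.

(** Additivity of relative entropy at the level of integrands. The cross terms are placed so that
    both sides are sums of nonnegative terms and integrate by Tonelli, even when a divergence is
    infinite. *)
Lemma phiM a a' b b' : 0 <= a -> 0 <= a' -> 0 < b -> 0 < b' ->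
  phi (a * a') (b * b') + (a * b' + b * a') =
  a' * phi a b + a * phi a' b' + (a * a' + b * b').
Proof.
rewrite le_eqVlt => /predU1P[<-|a0]; first by move=> _ _ _; rewrite !mul0r !phi0; ring.
rewrite le_eqVlt => /predU1P[<-|a0'] b0 b0'; first by rewrite !mulr0 !mul0r !phi0; ring.
by rewrite /phi !lnM ?posrE//; ring.
Qed.

Lemma measurable_phi d (X : measurableType d) (f g : X -> R) :
  measurable_fun setT f -> measurable_fun setT g ->
  measurable_fun setT (fun x => phi (f x) (g x)).
Proof.
move=> mf mg; apply: measurable_funD => //; apply: measurable_funB => //.
apply: measurable_funM => //; apply: measurable_funB; exact: measurableT_comp.
Qed.

End RelativeEntropyIntegrand.

(** * Additivity of relative entropy over independent blocks *)

Section ChainRule.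
Variables (R : realType) (p K : nat) (blk : 'I_p -> 'I_K.+1).
Local Notation T := (p.-tuple R).
Local Notation coords := (coords blk).
Local Notation block k := (coords [set k]%SET).
Local Notation "0T" := (@origin R p).
Implicit Types (x y z : T) (k l : 'I_K.+1) (B : {set 'I_K.+1}).
Variables qs ns : 'I_K.+1 -> T -> R.

Definition bKL k : \bar R := iint (block k) (fun z => (phi (qs k z) (ns k z))%:E) 0T.

Lemma perm_coordsD1 B k : k \in B -> perm_eq (coords B) (block k ++ coords (B :\ k)%SET).
Proof.
move=> kB; rewrite uniq_perm ?uniq_coords//.
  rewrite cat_uniq !uniq_coords andbT /=; apply/hasPn => i.
  by rewrite !mem_coords !inE => /andP[].
by move=> i; rewrite mem_cat !mem_coords !inE; case: eqVneq => // ->.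
Qed.

(** Induction on the number of blocks by integrating [phiM]: the correction terms have integral 1 +
    1 on each side. *)
Lemma iint_phi_bprod B x :
  (forall k, k \in B -> block_density blk k (qs k)) ->
  (forall k, k \in B -> block_density blk k (ns k)) ->
  (forall k z, k \in B -> 0 < ns k z) ->
  iint (coords B) (fun z => (phi (bprod qs B z) (bprod ns B z))%:E) x
  = (\sum_(k in B) bKL k)%E.
Proof.
have [n] := ubnP #|B|; elim: n B x => // n IH B x Bn dq dn n0.
have [B0|/set0Pn[k kB]] := eqVneq B finset.set0.
  have -> : coords B = [::].
    apply/eqP; rewrite -size_eq0 -leqn0 leqNgt -has_predT; apply/hasPn => i.
    by rewrite mem_coords B0 inE.
  rewrite /= /bprod B0 !big_set0 /phi; congr EFin; ring.
pose B' := (B :\ k)%SET.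
have B'B l : l \in B' -> l \in B by rewrite inE => /andP[].
have dq' l : l \in B' -> block_density blk l (qs l) by move=> /B'B /dq.
have dn' l : l \in B' -> block_density blk l (ns l) by move=> /B'B /dn.
have n0' l z : l \in B' -> 0 < ns l z by move=> /B'B; exact: n0.
have IH' : iint (coords B') (fun z => (phi (bprod qs B' z) (bprod ns B' z))%:E) x =
    (\sum_(l in B') bKL l)%E.
  by apply: IH => //; move: Bn; rewrite (cardsD1 k B) kB.
have bq z : bprod qs B z = qs k z * bprod qs B' z by rewrite /bprod (big_setD1 k).
have bn z : bprod ns B z = ns k z * bprod ns B' z by rewrite /bprod (big_setD1 k).
have mq := density_meas dq kB; have q0 z := density_ge0 dq z kB; have dqk := density_dep dq kB.
have mn := density_meas dn kB; have nk0 z := n0 k z kB; have dnk := density_dep dn kB.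
have mq' := measurable_bprod dq'; have q0' := bprod_ge0 dq'; have ddq' := dep_bprod dq'.
have mn' := measurable_bprod dn'; have ddn' := dep_bprod dn'.
have nn0' z : 0 < bprod ns B' z by apply: prodr_gt0 => l lB'; exact: n0'.
have P2 (f g : T -> R) : measurable_fun setT f -> (forall z, 0 <= f z) ->
    measurable_fun setT g -> (forall z, 0 <= g z) ->
    dep blk [set k]%SET f -> dep blk B' g ->
    iint (coords B) (fun z => (f z * g z)%:E) x =
    (iint (block k) (fun z => (f z)%:E) x * iint (coords B') (fun z => (g z)%:E) x)%E.
  move=> mf f0 mg g0 fk gB'.
  rewrite -iint_prod2//.
  - rewrite (perm_iint _ (uniq_coords blk B) (perm_coordsD1 kB))//.
    + by apply/measurable_EFinP; exact: measurable_funM.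
    + by move=> z; rewrite lee_fin mulr_ge0.
  - by apply/finset.setP => l; rewrite !inE; case: eqVneq.
  - exact/measurable_EFinP.
  - exact/measurable_EFinP.
  - by apply: (dep_comp EFin).
  - by apply: (dep_comp EFin).
have phk0 z : 0 <= phi (qs k z) (ns k z) by exact: phi_ge0.
have phk0' z : 0 <= phi (bprod qs B' z) (bprod ns B' z) by exact: phi_ge0.
have mpk := measurable_phi mq mn; have mpk' := measurable_phi mq' mn'.
have E1 : iint (coords B) (fun z => (phi (bprod qs B z) (bprod ns B z))%:E +
     ((qs k z * bprod ns B' z)%:E + (ns k z * bprod qs B' z)%:E))%E x =
   iint (coords B) (fun z => ((phi (qs k z) (ns k z) * bprod qs B' z)%:E +
     (qs k z * phi (bprod qs B' z) (bprod ns B' z))%:E) +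
     ((qs k z * bprod qs B' z)%:E + (ns k z * bprod ns B' z)%:E))%E x.
  congr iint; apply/funext => z; rewrite bq bn -!EFinD; congr EFin.
  by rewrite phiM// [bprod qs B' z * _]mulrC.
have mM (f g : T -> R) : measurable_fun setT f -> measurable_fun setT g ->
    measurable_fun setT (fun z => (f z * g z)%:E).
  by move=> mf mg; apply/measurable_EFinP; exact: measurable_funM.
have M0 (f g : T -> R) : (forall z, 0 <= f z) -> (forall z, 0 <= g z) ->
    forall z, (0 <= (f z * g z)%:E)%E.
  by move=> f0 g0 z; rewrite lee_fin mulr_ge0.
have nkle z : 0 <= ns k z by exact: ltW.
have nnle z : 0 <= bprod ns B' z by exact: ltW.
have mD := fun f g => @emeasurable_funD _ T R setT f g.
have dphk : dep blk [set k]%SET (fun z => phi (qs k z) (ns k z)) by exact: dep_op.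
have dphk' : dep blk B' (fun z => phi (bprod qs B' z) (bprod ns B' z)) by exact: dep_op.
move: E1; rewrite iintD; last first.
- by move=> z; apply: adde_ge0; rewrite lee_fin mulr_ge0//.
- by apply: mD; exact: mM.
- by move=> z; rewrite lee_fin bq bn; apply: phi_ge0; rewrite ?mulr_ge0 ?mulr_gt0.
- apply/measurable_EFinP; apply: measurable_phi.
    exact: (measurable_bprod dq).
  exact: (measurable_bprod dn).
rewrite iintD; [|exact: mM|exact: M0|exact: mM|exact: M0].
rewrite iintD; last first.
- by move=> z; apply: adde_ge0; rewrite lee_fin mulr_ge0//.
- by apply: mD; exact: mM.
- by move=> z; apply: adde_ge0; rewrite lee_fin mulr_ge0//.
- by apply: mD; exact: mM.
rewrite iintD; [|exact: mM|exact: M0|exact: mM|exact: M0].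
rewrite iintD; [|exact: mM|exact: M0|exact: mM|exact: M0].
rewrite !P2//.
rewrite !(density_int dq)// !(density_int dn)// !(iint_bprod dq') !(iint_bprod dn') IH'.
rewrite !mule1 !mul1e.
have -> : iint (block k) (fun z => (phi (qs k z) (ns k z))%:E) x = bKL k.
  by apply: dep_iint; apply: (dep_comp EFin).
have -> : (\sum_(l in B) bKL l = bKL k + \sum_(l in B') bKL l)%E.
  by rewrite (big_setD1 k).
(* The correction 1 + 1 is finite, so it can be cancelled even if the divergences are infinite. *)
move=> /(congr1 (fun u : \bar R => u - (1 + 1))%E).
by rewrite !addeK.
Qed.

End ChainRule.

Section StructuredDensity.
Variables (R : realType) (p K : nat) (blk : 'I_p -> 'I_K.+1).
Local Notation T := (p.-tuple R).
Local Notation coords := (coords blk).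
Local Notation allc := (@allc p).
Local Notation block k := (coords [set k]%SET).
Local Notation "0T" := (@origin R p).
Local Notation lam := (fiber allc 0T).
Implicit Types (x y z : T) (k l : 'I_K.+1).
Variable U : {set 'I_K.+1}.
Variables (c : T -> R) (qs : 'I_K.+1 -> T -> R).
Hypothesis dq : forall k, k \in U -> block_density blk k (qs k).
Hypothesis c0 : forall x, 0 <= c x.
Hypothesis mc : measurable_fun setT c.
Hypothesis ic : forall x, iint (coords (~: U)) (fun y => (c y)%:E) x = 1%E.

(** [c] is an arbitrary conditional density because the maximiser is only known to belong to the
    family; for the iterates it is [cond_pi]. *)
Definition sdens x : R := c x * bprod qs U x.
Let mb := measurable_bprod dq.
Let b0 := bprod_ge0 dq.

Lemma sdens_ge0 x : 0 <= sdens x. Proof. exact: mulr_ge0. Qed.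
Lemma measurable_sdens : measurable_fun setT sdens. Proof. exact: measurable_funM. Qed.

(** Integrating over the [C] coordinates first uses up the conditional density, as [h] is constant
    along them. *)
Lemma iint_cond_dep (h : T -> R) x : measurable_fun setT h -> (forall z, 0 <= h z) ->
  dep blk U h -> iint allc (fun z => (c z * h z)%:E) x = iint (coords U) (fun z => (h z)%:E) x.
Proof.
move=> mh h0 hU.
rewrite (perm_iint _ (uniq_allc p) (perm_coordsC blk U)).
- rewrite iint_cat; congr iint; apply/funext => y.
  have -> : (fun z => (c z * h z)%:E) = (fun z => (h z)%:E * (c z)%:E)%E.
    by apply/funext => z; rewrite -EFinM mulrC.
  rewrite iint_Mindep.
  + by rewrite ic mule1.
  + exact/measurable_EFinP.
  + by move=> z; rewrite lee_fin.
  + by move=> z; rewrite lee_fin.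
  + move=> z zy; rewrite (hU z y)// => i iU.
    by apply: zy; rewrite mem_coords inE iU.
- by apply/measurable_EFinP; exact: measurable_funM.
- by move=> z; rewrite lee_fin mulr_ge0.
Qed.

Lemma iint_sdens_dep (g : T -> R) x : measurable_fun setT g -> (forall z, 0 <= g z) ->
  dep blk U g -> iint allc (fun z => (sdens z * g z)%:E) x
  = iint (coords U) (fun z => (bprod qs U z * g z)%:E) x.
Proof.
move=> mg g0 gU; rewrite -iint_cond_dep.
- by congr iint; apply/funext => z; rewrite /sdens mulrA.
- exact: measurable_funM.
- by move=> z; rewrite mulr_ge0.
- by apply: dep_op => //; exact: dep_bprod.
Qed.

Lemma iint_sdens x : iint allc (fun z => (sdens z)%:E) x = 1%E.
Proof.
have -> : (fun z => (sdens z)%:E) = (fun z => (sdens z * 1)%:E).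
  by apply/funext => z; rewrite mulr1.
rewrite (iint_sdens_dep (g := fun=> 1))//.
by under eq_fun do rewrite mulr1; exact: iint_bprod.
Qed.

Lemma has_int_sdens : has_int lam sdens 1.
Proof.
split; last first.
  rewrite integral_fiber ?iint_sdens//; first by apply/measurable_EFinP; exact: measurable_sdens.
  by move=> z; rewrite lee_fin sdens_ge0.
apply: integrable_fiber_ge0; [exact: measurable_sdens|exact: sdens_ge0|].
by rewrite iint_sdens ltry.
Qed.

Lemma has_int_sdens_dep (h : T -> R) a : measurable_fun setT h -> dep blk U h ->
  has_int (fiber (coords U) 0T) (fun z => bprod qs U z * h z) a ->
  has_int lam (fun z => sdens z * h z) a.
Proof.
move=> mh hU [Ih Eh]; have ms := measurable_sdens; have s0 := sdens_ge0.
have mn : measurable_fun setT (fun z => `|h z|) by exact: measurableT_comp.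
have dn : dep blk U (fun z => `|h z|) by exact: dep_comp hU.
have mpf := measurable_rpos mh; have pf0 := rpos_ge0 h.
have mnf := measurable_rneg mh; have nf0 := rneg_ge0 h.
have dpf : dep blk U (rpos h) by apply: (dep_comp (fun t => Num.max t 0)).
have dnf : dep blk U (rneg h) by apply: (dep_comp (fun t => Num.max (- t) 0)).
split.
  apply/integrable_fiberP => //; rewrite iint_sdens_dep//.
  exact/integrable_fiberP.
by rewrite -Eh !integral_fiber_posneg// !iint_sdens_dep.
Qed.

Lemma iint_sdens_block k (g : T -> R) x : k \in U -> measurable_fun setT g ->
  (forall z, 0 <= g z) -> dep blk [set k]%SET g ->
  iint allc (fun z => (sdens z * g z)%:E) x = iint (block k) (fun z => (qs k z * g z)%:E) x.
Proof.
move=> kU mg g0 gk; rewrite iint_sdens_dep//; first exact: iint_bprod1.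
by apply: dep_sub gk; rewrite finset.sub1set.
Qed.

Lemma measurable_coord2 i : measurable_fun setT (fun z => tnth z i ^+ 2).
Proof. exact: (measurable_funX 2 (measurable_coord i)). Qed.

Lemma fin2_sdens : (forall i, (iint allc (fun z => (sdens z * tnth z i ^+ 2)%:E) 0T < +oo)%E) ->
  forall k, k \in U -> fin2 blk qs k.
Proof.
move=> H k kU i ik; rewrite -iint_sdens_block//.
- exact: measurable_coord2.
- by move=> z; rewrite sqr_ge0.
- by apply: (dep_comp (fun t => t ^+ 2)); exact: dep_coord.
Qed.

End StructuredDensity.

Section MeanFieldGaussian.
Variables (R : realType) (p K : nat) (blk : 'I_p -> 'I_K.+1).
Local Notation T := (p.-tuple R).
Local Notation "0T" := (@origin R p).
Implicit Types (x y z : T) (k l : 'I_K.+1) (m d : 'rV[R]_p).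
Variables (U : {set 'I_K.+1}) (mu : 'rV[R]_p) (Q : 'M[R]_p).
Hypothesis pQ : posdef Q.
Local Notation S := (schur blk U Q).
Local Notation D := (bdiag blk U Q).
Local Notation PU := (bproj R blk U).
Local Notation P1 k := (bproj R blk [set k]%SET).
Local Notation nb m := (fun k => nblock blk U Q k m).

Lemma mf_sdens qs : mf blk U mu Q qs = sdens U (cond_pi blk U mu Q) qs.
Proof. by []. Qed.

Lemma nb_density m k : k \in U -> block_density blk k (nb m k).
Proof. by move=> kU; exact: block_density_nblock. Qed.

Let cpi0 x : 0 <= cond_pi blk U mu Q x. Proof. by rewrite ltW ?cond_pi_gt0. Qed.
Let mcpi := measurable_cond_pi blk U mu pQ.
Let icpi := iint_cond_pi blk U mu pQ.

Lemma in_Q_mf qs : (forall k, k \in U -> block_density blk k (qs k)) ->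
  in_Q blk U (mf blk U mu Q qs).
Proof. by move=> dq; exists (cond_pi blk U mu Q), qs. Qed.

Lemma mf_nb_gt0 m x : 0 < mf blk U mu Q (nb m) x.
Proof.
rewrite mulr_gt0 ?cond_pi_gt0//; apply: prodr_gt0 => k kU; exact: nblock_gt0.
Qed.

Definition zconst : R := \sum_(k in U) ln (bmass blk [set k]%SET S).

Lemma ln_bprod_nb m x : ln (bprod (nb m) U x) = - (1 / 2) * qf D (vec x - m) - zconst.
Proof.
have -> : qf D (vec x - m) = \sum_(k in U) qf S ((vec x - m) *m P1 k).
  by rewrite /qf bf_bdiag.
rewrite /bprod /zconst mulr_sumr -sumrB.
have : {in U, forall k, 0 < nb m k x} by move=> k kU; exact: nblock_gt0.
move=> n0.
suff [] : 0 < \prod_(k in U) nb m k x /\ ln (\prod_(k in U) nb m k x) =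
  \sum_(k in U) (- (1 / 2) * qf S ((vec x - m) *m P1 k) - ln (bmass blk [set k]%SET S)) by [].
elim/big_rec2: _ => [|k a b kU [b0 Eb]]; first by rewrite ltr01 ln1.
split; first by rewrite mulr_gt0// n0.
rewrite lnM ?posrE ?n0// Eb; congr (_ + _).
rewrite /nblock ln_div ?posrE; last 2 first.
- exact: bexp_gt0.
- exact: (bmass_gt0 (pd_block blk pQ kU)).
by rewrite /bexp expRK.
Qed.

(** The logarithm of the ratio of normalising constants; [maximizer_spec] shows it to be the maximum
    of [V]. *)
Definition Kconst : R := ln (mconst blk U Q) + zconst.

(** The common factor [cond_pi] cancels, which leaves the marginal of pi against the product of the
    block Gaussians. *)
Lemma ln_ratio_nb m x : ln (gauss mu Q x) - ln (mf blk U mu Q (nb m) x) =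
  Kconst - 1 / 2 * qf S (vec x - mu) + 1 / 2 * qf D (vec x - m).
Proof.
have -> : gauss mu Q x = cond_pi blk U mu Q x * pi_marg blk U mu Q x.
  rewrite /cond_pi mulfVK// pi_margE// mulf_neq0// gt_eqF ?mconst_gt0 ?mexp_gt0//.
have b0 : 0 < bprod (nb m) U x by apply: prodr_gt0 => k kU; exact: nblock_gt0.
have L (a b c : R) : 0 < a -> 0 < b -> 0 < c -> ln (a * b) - ln (a * c) = ln b - ln c.
  by move=> a0 b'0 c0; rewrite !lnM ?posrE//; ring.
have pm0 : 0 < pi_marg blk U mu Q x by rewrite pi_margE// mulr_gt0 ?mconst_gt0 ?mexp_gt0.
rewrite /mf -/(bprod (nb m) U x) L ?cond_pi_gt0//.
rewrite ln_pi_marg// ln_bprod_nb /Kconst; ring.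
Qed.

Lemma bdiag_entry i j : blk i \in U -> blk j = blk i -> D i j = S i j.
Proof.
move=> iU ji.
have E (M : 'M[R]_p) a b : M a b = bf M (delta_mx 0 a) (delta_mx 0 b).
  by rewrite /bf -rowE trmx_delta -colE !mxE.
rewrite E bf_bdiag (bigD1 (blk i))//= big1 ?addr0.
  have P (a : 'I_p) : blk a = blk i -> delta_mx 0 a *m P1 (blk i) = delta_mx 0 a :> 'rV[R]_p.
    move=> ai; apply/rowP => b; rewrite mul_proj !mxE inE eqxx /=.
    by case: (eqVneq b a) => [->|_]; rewrite ?ai ?eqxx ?mulr1 ?mulr0.
  by rewrite !P// -E.
move=> k /andP[_ ki].
have -> : delta_mx 0 i *m P1 k = 0 :> 'rV[R]_p; last by rewrite bf0l.
apply/rowP => b; rewrite mul_proj !mxE inE eqxx /=.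
by case: (eqVneq b i) => [->|_]; rewrite ?mulr0// eq_sym (negbTE ki) mul0r.
Qed.

(** The trace reads only entries inside a block, where [D] and [S] agree. This is why covariances
    drop out of the gap. *)
Lemma blocktr_bdiag qs : blocktr blk qs U D = blocktr blk qs U S.
Proof.
apply: eq_bigr => i _; apply: eq_bigr => j _; case: ifP => // /andP[iU /eqP ji].
by rewrite bdiag_entry.
Qed.

(* [m - mu] on the factorised blocks, completed by the conditional mean of [pi]
   given [theta_U] on the others. *)
Definition dlift m : 'rV[R]_p := (m - mu) *m PU - (m - mu) *m PU *m Q *m condT blk U Q.

(** [condQ] does not see [dlift m] and [D] sees only its [U] part, so the two quadratic exponents
    merge into one. The relation between [a] and the determinant comes from the total mass being
    1. *)
Lemma mf_nb_gexp m : exists2 a, a * gmass (mfprec blk U Q) = 1 &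
  forall x, mf blk U mu Q (nb m) x = a * gexp (mu + dlift m) (mfprec blk U Q) x.
Proof.
pose a := (cmass blk U Q)^-1 * expR (- zconst).
have E x : mf blk U mu Q (nb m) x = a * gexp (mu + dlift m) (mfprec blk U Q) x.
  have b0 : 0 < bprod (nb m) U x by apply: prodr_gt0 => k kU; exact: nblock_gt0.
  rewrite /mf -/(bprod (nb m) U x) cond_piE// -[bprod _ _ _]lnK ?posrE// ln_bprod_nb.
  rewrite /a [X in X * _ = _]mulrC -[LHS]mulrA -[RHS]mulrA; congr (_ * _).
  rewrite /cexp /gexp -!expRD; congr expR.
  have -> : qf (mfprec blk U Q) (vec x - (mu + dlift m)) =
     qf (condQ blk U Q) (vec x - mu) + qf D (vec x - m).
    rewrite opprD addrA qf_mfprec.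
    have dU : dlift m *m PU = (m - mu) *m PU.
      rewrite /dlift mulmxBl -(mulmxA ((m - mu) *m PU *m Q)) condT_projU// mulmx0 subr0.
      by rewrite -mulmxA proj_idem.
    congr (_ + _).
      rewrite !qf_condQ//; congr (qf Q _).
      rewrite 2!mulmxBl; suff -> : dlift m *m Q *m condT blk U Q = 0 by rewrite subr0.
      by rewrite /dlift 2!mulmxBl condQK// subrr.
    rewrite -qf_bdiag_projU// -[in RHS]qf_bdiag_projU//; congr (qf D _).
    rewrite mulmxBl dU -mulmxBl; congr (_ *m _).
    by rewrite opprB addrA subrK.
  ring.
exists a => //.
have := iint_sdens (nb_density m) cpi0 mcpi icpi 0T.
rewrite -mf_sdens.
have -> : (fun z => (mf blk U mu Q (nb m) z)%:E) =
  (fun z => a%:E * (gexp (mu + dlift m) (mfprec blk U Q) z)%:E)%E.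
  by apply/funext => z; rewrite E.
have pQs := posdef_mfprec blk U pQ.
rewrite iintZl.
- by rewrite iint_gexp// -EFinM => -[].
- by apply/measurable_EFinP; exact: measurable_gexp.
- by move=> z; rewrite lee_fin ltW ?gexp_gt0.
- by rewrite lee_fin mulr_ge0 ?expR_ge0// invr_ge0 ltW ?cmass_gt0.
Qed.

End MeanFieldGaussian.

Section FreeEnergy.
Variables (R : realType) (p K : nat) (blk : 'I_p -> 'I_K.+1).
Local Notation T := (p.-tuple R).
Local Notation coords := (coords blk).
Local Notation allc := (@allc p).
Local Notation "0T" := (@origin R p).
Local Notation lam := (fiber allc 0T).
Implicit Types (x y z : T) (k l : 'I_K.+1) (m d : 'rV[R]_p).
Variables (U : {set 'I_K.+1}) (mu : 'rV[R]_p) (Q : 'M[R]_p).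
Hypothesis pQ : posdef Q.
Local Notation S := (schur blk U Q).
Local Notation D := (bdiag blk U Q).
Local Notation PU := (bproj R blk U).
Local Notation nb m := (fun k => nblock blk U Q k m).
Local Notation cpi := (cond_pi blk U mu Q).
Local Notation Kc := (Kconst blk U Q).
Let cpi0 x : 0 <= cpi x. Proof. by rewrite ltW ?cond_pi_gt0. Qed.
Let mcpi := measurable_cond_pi blk U mu pQ.
Let icpi := iint_cond_pi blk U mu pQ.
Let dnb m k : k \in U -> block_density blk k (nb m k).
Proof. exact: nb_density. Qed.

Lemma lin_delta (i : 'I_p) (v : 'rV[R]_p) : lin (delta_mx 0 i) v = v 0 i.
Proof. by rewrite /lin trmx_delta -colE mxE. Qed.

Lemma vec_subE x m i : (vec x - m) 0 i = tnth x i - m 0 i.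
Proof. by rewrite !mxE. Qed.

Lemma iint_sqr_coord_lty (f : T -> R) (i : 'I_p) (a : R) : measurable_fun setT f ->
  (forall x, 0 <= f x) -> (iint allc (fun x => (f x)%:E) 0T < +oo)%E ->
  (iint allc (fun x => (f x * (tnth x i - a) ^+ 2)%:E) 0T < +oo)%E ->
  (iint allc (fun x => (f x * tnth x i ^+ 2)%:E) 0T < +oo)%E.
Proof.
move=> mf f0 f1 f2.
have mx2 (b : R) : measurable_fun setT (fun x => (f x * (tnth x i - b) ^+ 2)%:E).
  apply/measurable_EFinP; apply: measurable_funM => //.
  by apply: (measurable_funX 2); apply: measurable_funB => //; exact: measurable_coord.
have mx0 : measurable_fun setT (fun x => (f x * tnth x i ^+ 2)%:E).
  by have := mx2 0; under eq_fun do rewrite subr0.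
have mfE : measurable_fun setT (fun x => (f x)%:E) by exact/measurable_EFinP.
apply: (@le_lt_trans _ _ (iint allc (fun x => 2%:E * (f x * (tnth x i - a) ^+ 2)%:E +
    (2 * a ^+ 2)%:E * (f x)%:E)%E 0T)).
  apply: le_iint => //.
  - by move=> x; rewrite lee_fin mulr_ge0 ?sqr_ge0.
  - by apply: emeasurable_funD; exact: measurable_funeM.
  - move=> x; rewrite -!EFinM -EFinD lee_fin.
    have -> : 2 * (f x * (tnth x i - a) ^+ 2) + 2 * a ^+ 2 * f x =
      f x * (2 * (tnth x i - a) ^+ 2 + 2 * a ^+ 2) by ring.
    rewrite ler_wpM2l//; have := sqr_ge0 (tnth x i - 2 * a); nra.
have c0 : 0 <= 2 * a ^+ 2 by rewrite mulr_ge0 ?sqr_ge0.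
have F0 x : (0 <= (f x * (tnth x i - a) ^+ 2)%:E)%E by rewrite lee_fin mulr_ge0 ?sqr_ge0.
have F1 x : (0 <= (f x)%:E)%E by rewrite lee_fin.
have G1 x : (0 <= 2%:E * (f x * (tnth x i - a) ^+ 2)%:E)%E by rewrite mule_ge0.
have G2 x : (0 <= (2 * a ^+ 2)%:E * (f x)%:E)%E by rewrite mule_ge0// lee_fin.
rewrite (iintD _ 0T (measurable_funeM _ (mx2 a)) G1 (measurable_funeM _ mfE) G2).
rewrite !iintZl ?lee_fin//.
by rewrite lte_add_pinfty// lte_mul_pinfty// lee_fin.
Qed.

Lemma mf_nb_sqr_lty m i :
  (iint allc (fun x => (mf blk U mu Q (nb m) x * tnth x i ^+ 2)%:E) 0T < +oo)%E.
Proof.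
have [a aQ E] := mf_nb_gexp blk U mu pQ m.
have pQs := posdef_mfprec blk U pQ.
apply: (@iint_sqr_coord_lty _ i ((mu + dlift blk U mu Q m) 0 i)).
- by apply: measurable_sdens => //; exact: dnb.
- by apply: sdens_ge0 => //; exact: dnb.
- by rewrite (iint_sdens (dnb m)) ?ltry.
have := iint_gauss_density_lin2 (mu + dlift blk U mu Q m) pQs aQ (delta_mx 0 i) 0T.
under eq_fun => x do rewrite -E lin_delta vec_subE.
by move=> ->; rewrite ltry.
Qed.

Lemma fin2_nb m k : k \in U -> fin2 blk (nb m) k.
Proof.
move=> kU; apply: (fin2_sdens (dnb m) cpi0 mcpi icpi) => // i.
exact: mf_nb_sqr_lty.
Qed.

(** The same coordinate integral is evaluated twice: through the block factor, and through the
    centre of the joint Gaussian of [mf_nb_gexp]. *)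
Lemma bmean_nb m i : blk i \in U -> bmean blk (nb m) i = m 0 i.
Proof.
move=> iU.
have [a aQ E] := mf_nb_gexp blk U mu pQ m.
have pQs := posdef_mfprec blk U pQ.
have H1 : has_int lam (fun x => mf blk U mu Q (nb m) x * tnth x i) (bmean blk (nb m) i).
  apply: (has_int_sdens_dep (dnb m)) => //.
  - exact: measurable_coord.
  - by move=> x y xy; exact: xy.
  apply: (has_int_bprod1 (dnb m) _ iU).
  - exact: measurable_coord.
  - exact: dep_coord.
  - by apply: (has_int_coord (dnb m)) => // k; exact: fin2_nb.
have H2 : has_int lam (fun x => mf blk U mu Q (nb m) x * tnth x i)
    ((mu + dlift blk U mu Q m) 0 i).
  have I1 := integrable_gauss_density_lin (mu + dlift blk U mu Q m) pQs aQ (delta_mx 0 i).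
  have E1 := integral_gauss_density_lin (mu + dlift blk U mu Q m) pQs aQ (delta_mx 0 i).
  have G1 : has_int lam (fun x => mf blk U mu Q (nb m) x *
      (tnth x i - (mu + dlift blk U mu Q m) 0 i)) 0.
    split.
      apply: eq_integrable I1 => // x _.
      by rewrite /= E lin_delta vec_subE.
    apply: etrans E1; apply: eq_integral => x _.
    by rewrite /= E lin_delta vec_subE.
  have := has_intD G1 (has_intZ ((mu + dlift blk U mu Q m) 0 i) (has_int_sdens (dnb m) cpi0 mcpi icpi)).
  rewrite mulr1 add0r; congr has_int; apply/funext => x; rewrite -mf_sdens; ring.
rewrite (has_int_uniq H1 H2) /dlift.
(* Shows that the correction in [dlift] is supported outside [U] and vanishes at coordinate [i]. *)
have -> : condT blk U Q = condT blk U Q *m bproj R blk (~: U).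
  by symmetry; exact: cinv_proj.
rewrite mulmxA mxE [X in _ + X]mxE [X in _ + (_ + X)]mxE !mul_proj !inE iU /=.
by rewrite mul0r oppr0 addr0 mul1r !mxE subrKC.
Qed.

Lemma bdev_nb m : bdev blk U mu (nb m) = (m - mu) *m PU.
Proof.
apply/rowP => i; rewrite /bdev !mul_proj; case: (boolP (blk i \in U)) => iU; rewrite ?mul0r//.
by rewrite !mul1r !mxE bmean_nb.
Qed.

Section qs.
Variables (c : T -> R) (qs : 'I_K.+1 -> T -> R).
Hypothesis dq : forall k, k \in U -> block_density blk k (qs k).
Hypothesis c0 : forall x, 0 <= c x.
Hypothesis mc : measurable_fun setT c.
Hypothesis ic : forall x, iint (coords (~: U)) (fun y => (c y)%:E) x = 1%E.
Local Notation q := (sdens U c qs).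
Local Notation m := (bmeanv blk qs).
Local Notation g := (mf blk U mu Q (nb m)).
Let q0 := sdens_ge0 dq c0.
Let mq := measurable_sdens dq mc.
Let Hq := has_int_sdens dq c0 mc ic.
Let Hg : has_int lam g 1. Proof. exact: (has_int_sdens (dnb m) cpi0 mcpi icpi). Qed.
Let g0 x : 0 < g x. Proof. exact: mf_nb_gt0. Qed.
Let mg : measurable_fun setT g. Proof. exact: has_int_measurable Hg. Qed.

(** The reference [g] depends on [q]: it has Gaussian blocks centred at the block means of [q], and
    it uses [cond_pi] whatever the conditional part [c] of [q] is. *)
Definition KL : \bar R := iint allc (fun x => (phi (q x) (g x))%:E) 0T.
Definition Vint x := q x * (ln (gauss mu Q x) - ln (q x)).

Lemma measurable_Vint : measurable_fun setT Vint.
Proof.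
apply: measurable_funM => //; apply: measurable_funB; apply: measurableT_comp => //.
exact: measurable_gauss.
Qed.

Lemma VE : V mu Q q = (\int[lam]_x (Vint x)%:E)%E.
Proof. by rewrite /V sint_fiber//; exact: measurable_Vint. Qed.

Lemma VintE x : Vint x =
  q x * (ln (gauss mu Q x) - ln (g x)) - phi (q x) (g x) - q x + g x.
Proof. by rewrite /Vint /phi; ring. Qed.

(** The covariance contributions of [S] and [D] are equal by [blocktr_bdiag] and cancel; only the
    deviation of the means remains. *)
Lemma has_int_ratio : (forall k, k \in U -> fin2 blk qs k) ->
  has_int lam (fun x => q x * (ln (gauss mu Q x) - ln (g x)))
    (Kc - 1 / 2 * qf S (bdev blk U mu qs)).
Proof.
move=> q2.
pose h x := Kc - 1 / 2 * qf S (bdev blk U mu qs + (vec x - m) *m PU) +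
  1 / 2 * qf D (0 + (vec x - m) *m PU).
have hE x : ln (gauss mu Q x) - ln (g x) = h x.
  rewrite ln_ratio_nb// /h add0r qf_bdiag_projU//; congr (_ - _ * _ + _).
  rewrite qf_schur_dep// /bdev -mulmxDl; congr (qf S (_ *m _)).
  by rewrite [RHS]addrC addrA subrK.
have -> : (fun x => q x * (ln (gauss mu Q x) - ln (g x))) = (fun x => q x * h x).
  by apply/funext => x; rewrite hE.
have mh : measurable_fun setT h.
  have -> : h = fun x => ln (gauss mu Q x) - ln (g x) by apply/funext => x; rewrite hE.
  apply: measurable_funB; apply: measurableT_comp => //; exact: measurable_gauss.
apply: (has_int_sdens_dep dq c0 mc ic mh).
  by move=> x y xy; rewrite /h (dep_proj _ xy).
have sS := schur_tr blk U pQ; have sD := bdiag_tr blk U pQ.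
have H1 := has_int_bprod dq 0T.
have H2 := has_int_qf dq q2 (bdev blk U mu qs) 0T sS.
have H3 := has_int_qf dq q2 0 0T sD.
have := has_intD (has_intB (has_intZ Kc H1) (has_intZ (1 / 2) H2)) (has_intZ (1 / 2) H3).
rewrite blocktr_bdiag// qf0 add0r mulr1.
have -> : Kc - 1 / 2 * (qf S (bdev blk U mu qs) + blocktr blk qs U S) + 1 / 2 * blocktr blk qs U S
   = Kc - 1 / 2 * qf S (bdev blk U mu qs) by ring.
by congr has_int; apply/funext => x; rewrite /h; ring.
Qed.

Lemma measurable_phiq : measurable_fun setT (fun x => phi (q x) (g x)).
Proof. exact: measurable_phi. Qed.

Lemma phiq_ge0 x : 0 <= phi (q x) (g x). Proof. exact: phi_ge0. Qed.

Lemma KL_ge0 : (0 <= KL)%E.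
Proof. by apply: iint_ge0 => x; rewrite lee_fin phiq_ge0. Qed.

Lemma has_int_KL : (KL < +oo)%E -> has_int lam (fun x => phi (q x) (g x)) (fine KL).
Proof.
move=> KLy; have mp := measurable_phiq; have p0 := phiq_ge0; split.
  exact: integrable_fiber_ge0.
rewrite integral_fiber; last 2 first.
- exact/measurable_EFinP.
- by move=> x; rewrite lee_fin.
by rewrite fineK// ge0_fin_numE ?KL_ge0.
Qed.

Lemma V_sdens : (forall k, k \in U -> fin2 blk qs k) -> (KL < +oo)%E ->
  V mu Q q = (Kc - 1 / 2 * qf S (bdev blk U mu qs) - fine KL)%:E.
Proof.
move=> q2 KLy; rewrite VE.
have [_] := has_intD (has_intB (has_intB (has_int_ratio q2) (has_int_KL KLy)) Hq) Hg.
by rewrite subrK => <-; apply: eq_integral => x _; rewrite VintE.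
Qed.

End qs.

End FreeEnergy.

Section FreeEnergyFinite.
Variables (R : realType) (p K : nat) (blk : 'I_p -> 'I_K.+1).
Local Notation T := (p.-tuple R).
Local Notation coords := (coords blk).
Local Notation allc := (@allc p).
Local Notation "0T" := (@origin R p).
Local Notation lam := (fiber allc 0T).
Implicit Types (x y z : T) (k l : 'I_K.+1) (m d : 'rV[R]_p).
Variables (U : {set 'I_K.+1}) (mu : 'rV[R]_p) (Q : 'M[R]_p).
Hypothesis pQ : posdef Q.
Local Notation nb m := (fun k => nblock blk U Q k m).
Local Notation cpi := (cond_pi blk U mu Q).
Let cpi0 x : 0 <= cpi x. Proof. by rewrite ltW ?cond_pi_gt0. Qed.
Let mcpi := measurable_cond_pi blk U mu pQ.
Let icpi := iint_cond_pi blk U mu pQ.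
Let dnb m k : k \in U -> block_density blk k (nb m k).
Proof. exact: nb_density. Qed.

Section qs.
Variables (c : T -> R) (qs : 'I_K.+1 -> T -> R).
Hypothesis dq : forall k, k \in U -> block_density blk k (qs k).
Hypothesis c0 : forall x, 0 <= c x.
Hypothesis mc : measurable_fun setT c.
Hypothesis ic : forall x, iint (coords (~: U)) (fun y => (c y)%:E) x = 1%E.
Local Notation q := (sdens U c qs).
Local Notation m := (bmeanv blk qs).
Local Notation g := (mf blk U mu Q (nb m)).
Local Notation h := (Vint U mu Q c qs).
Let q0 := sdens_ge0 dq c0.
Let mq := measurable_sdens dq mc.
Let Hq := has_int_sdens dq c0 mc ic.
Let Hg : has_int lam g 1. Proof. exact: (has_int_sdens (dnb m) cpi0 mcpi icpi). Qed.
Let mh := measurable_Vint mu Q dq mc.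
Hypothesis VNy : (-oo < V mu Q q)%E.

(** Nonnegativity of phi at (q, pi) bounds the positive part of the integrand by pi, which has mass
    1; the hypothesis V > -oo then forces the negative part to be finite. *)
Let hint : (iint allc (fun x => (`|h x|)%:E) 0T < +oo)%E.
Proof.
have mp := measurable_rpos mh; have mn := measurable_rneg mh.
have p0 := rpos_ge0 h; have n0 := rneg_ge0 h.
have -> : (fun x => (`|h x|)%:E) = (fun x => (rpos h x)%:E + (rneg h x)%:E)%E.
  apply/funext => x; rewrite -EFinD; congr EFin; rewrite /rpos /rneg.
  have /orP[hx|hx] := le_total 0 (h x).
    by rewrite ger0_norm// max_l// max_r ?addr0// oppr_le0.
  by rewrite ler0_norm// max_r// max_l ?add0r// oppr_ge0.
have E0 (f : T -> R) : (forall x, 0 <= f x) -> forall x, (0 <= (f x)%:E)%E.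
  by move=> f0 x; rewrite lee_fin.
have ME (f : T -> R) : measurable_fun setT f -> measurable_fun setT (fun x => (f x)%:E).
  by move=> mf; exact/measurable_EFinP.
rewrite (iintD _ 0T (ME _ mp) (E0 _ p0) (ME _ mn) (E0 _ n0)).
have Pfin : (iint allc (fun x => (rpos h x)%:E) 0T < +oo)%E.
  have := iint_gauss_density mu pQ (gconst_gmass pQ) 0T.
  move=> G1; apply: (@le_lt_trans _ _ (iint allc (fun x => (gauss mu Q x)%:E) 0T)); last by rewrite G1 ltry.
  apply: le_iint; first exact: ME.
  - exact: (E0 _ p0).
  - by apply: ME; exact: measurable_gauss.
  - move=> x; rewrite lee_fin ge_max (ltW (gauss_gt0 mu pQ x)) andbT.
    have := phi_ge0 (q0 x) (gauss_gt0 mu pQ x); have := q0 x.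
    rewrite /phi /Vint; lra.
have := VNy; rewrite /V /sint -/(rpos h) -/(rneg h).
have -> : (fun x => (Num.max (q x * (ln (gauss mu Q x) - ln (q x))) 0)%:E) = (fun x => (rpos h x)%:E) by [].
have -> : (fun x => (Num.max (- (q x * (ln (gauss mu Q x) - ln (q x)))) 0)%:E) = (fun x => (rneg h x)%:E) by [].
have P0 : (0 <= iint allc (fun x => (rpos h x)%:E) 0T)%E by apply: iint_ge0; exact: (E0 _ p0).
have N0 : (0 <= iint allc (fun x => (rneg h x)%:E) 0T)%E by apply: iint_ge0; exact: (E0 _ n0).
move: Pfin P0 N0; move: (iint _ _ 0T) (iint _ _ 0T) => [a| |]// [b| |]//.
by move=> _ _ _ _; rewrite -EFinD ltry.
Qed.

Lemma integrable_Vint : lam.-integrable setT (fun x => (h x)%:E).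
Proof.
apply/integrableP; split; first exact/measurable_EFinP.
rewrite integral_fiber.
- exact: hint.
- by apply/measurable_EFinP; exact: measurableT_comp.
- by move=> x; rewrite lee_fin.
Qed.

(* Comparing [q] with the integrable function [pi * exp (qf Q / 4)] bounds its second moments. *)
Lemma V_gtNy_fin2 k : k \in U -> fin2 blk qs k.
Proof.
apply: (fin2_sdens dq c0 mc ic) => i; apply: (@iint_sqr_coord_lty _ _ q i (mu 0 i)) => //.
  by rewrite (iint_sdens dq c0 mc ic) ltry.
have [e e0 He] := posdef_dominates 1%:M pQ.
pose b x := gconst Q * gexp mu ((1 / 2) *: Q) x.
have pQ2 : posdef ((1 / 2) *: Q) by apply: posdefZ => //; lra.
have bE x : b x = gauss mu Q x * expR (1 / 4 * qf Q (vec x - mu)).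
  rewrite /b gaussE -mulrA /gexp -expRD; congr (_ * expR _).
  by rewrite /qf bfZm; field.
have b0 x : 0 < b x by rewrite mulr_gt0 ?gexp_gt0 ?gconst_gt0.
have mb : measurable_fun setT b by apply: measurable_funM => //; exact: measurable_gexp.
have bint : (iint allc (fun x => (b x)%:E) 0T < +oo)%E.
  have -> : (fun x => (b x)%:E) = (fun x => (gconst Q)%:E * (gexp mu ((1 / 2) *: Q) x)%:E)%E by [].
  rewrite iintZl.
  - by rewrite iint_gexp// -EFinM ltry.
  - by apply/measurable_EFinP; exact: measurable_gexp.
  - by move=> z; rewrite lee_fin ltW ?gexp_gt0.
  - by rewrite lee_fin ltW ?gconst_gt0.
(* Nonnegativity of phi at (q, b) reads q qf Q / 4 <= b - q - h. The factor 4 / e converts the form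
   [Q] into a squared coordinate. *)
have key x : q x * (tnth x i - mu 0 i) ^+ 2 <= (4 / e) * (`|h x| + b x).
  have y2 : e * (tnth x i - mu 0 i) ^+ 2 <= qf Q (vec x - mu).
    apply: le_trans (He (vec x - mu)); rewrite ler_wpM2l ?(ltW e0)//.
    rewrite /qf bf1 mxE (bigD1 i)//= [(vec x - mu)^T _ _]mxE vec_subE -expr2 lerDl.
    by apply: sumr_ge0 => j _; rewrite [(vec x - mu)^T _ _]mxE -expr2 sqr_ge0.
  have := phi_ge0 (q0 x) (b0 x).
  rewrite /phi bE lnM ?posrE ?gauss_gt0 ?expR_gt0// expRK -bE => hh.
  have h1 : q x * qf Q (vec x - mu) <= 4 * (`|h x| + b x).
    have := ler_norm (- h x); rewrite normrN /Vint; have := q0 x; move: hh; lra.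
  have h2 : q x * (e * (tnth x i - mu 0 i) ^+ 2) <= q x * qf Q (vec x - mu).
    by rewrite ler_wpM2l.
  rewrite [leRHS]mulrAC ler_pdivlMr//; lra.
have mn : measurable_fun setT (fun x => (`|h x|)%:E).
  by apply/measurable_EFinP; exact: measurableT_comp.
have mbE : measurable_fun setT (fun x => (b x)%:E) by exact/measurable_EFinP.
apply: (@le_lt_trans _ _ (iint allc (fun x => (4 / e)%:E * ((`|h x|)%:E + (b x)%:E))%E 0T)).
  apply: le_iint.
  - apply/measurable_EFinP; apply: measurable_funM => //.
    by apply: (measurable_funX 2); apply: measurable_funB => //; exact: measurable_coord.
  - by move=> x; rewrite lee_fin mulr_ge0 ?sqr_ge0.
  - by apply: measurable_funeM; exact: emeasurable_funD.
  - by move=> x; rewrite -EFinD -EFinM lee_fin.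
have ce0 : (0 <= (4 / e)%:E)%E by rewrite lee_fin divr_ge0// ltW.
have n0 x : (0 <= (`|h x|)%:E)%E by rewrite lee_fin.
have bE0 x : (0 <= (b x)%:E)%E by rewrite lee_fin ltW.
rewrite iintZl//; last 2 first.
- exact: emeasurable_funD.
- by move=> x; rewrite adde_ge0.
rewrite iintD// lte_mul_pinfty// lte_add_pinfty//.
Qed.

(** By [VintE] the integrand of the divergence is a combination of functions already known to be
    integrable. *)
Lemma V_gtNy_KL : (KL blk U mu Q c qs < +oo)%E.
Proof.
have [I1 _] := has_int_ratio mu pQ dq c0 mc ic V_gtNy_fin2.
have I2 := integrable_Vint; have [I3 _] := Hq; have [I4 _] := Hg.
have mp := measurable_phiq mu pQ dq mc; have p0 := phiq_ge0 mu pQ dq c0.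
rewrite /KL -integral_fiber; last 2 first.
- exact/measurable_EFinP.
- by move=> x; rewrite lee_fin.
have J : lam.-integrable setT (fun x => (phi (q x) (g x))%:E).
  have := integrableD measurableT (integrableB measurableT (integrableB measurableT I1 I2) I3) I4.
  apply: eq_integrable => // x _ /=.
  rewrite -!EFinB -EFinD; congr EFin; rewrite (VintE blk U mu Q c qs x); ring.
have /integrableP[_] := J.
by under eq_integral do rewrite abse_EFin ger0_norm ?p0//.
Qed.

End qs.

(** When [q] has the conditional part [cond_pi] itself, [phiZ] factors it out and the chain rule
    applies to the block factors. *)
Lemma KL_mf qs : (forall k, k \in U -> block_density blk k (qs k)) ->
  KL blk U mu Q cpi qs = (\sum_(k in U) bKL blk qs (nb (bmeanv blk qs)) k)%E.
Proof.
move=> dq; rewrite -(iint_phi_bprod 0T dq (dnb _)); last first.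
  by move=> k z kU; exact: nblock_gt0.
rewrite /KL.
have nn z : 0 < bprod (nb (bmeanv blk qs)) U z.
  by apply: prodr_gt0 => k kU; exact: nblock_gt0.
have dn k (kU : k \in U) := dnb (bmeanv blk qs) kU.
have pc0 x : 0 <= phi (bprod qs U x) (bprod (nb (bmeanv blk qs)) U x).
  by apply: phi_ge0 => //; exact: (bprod_ge0 dq).
rewrite -(iint_cond_dep cpi0 mcpi icpi).
- congr iint; apply/funext => z; rewrite mf_sdens /sdens phiZ//.
    exact: cond_pi_gt0.
  exact: (bprod_ge0 dq).
- apply: measurable_phi; first exact: (measurable_bprod dq).
  exact: (measurable_bprod dn).
- exact: pc0.
- by apply: dep_op; [exact: (dep_bprod dq)|exact: (dep_bprod dn)].
Qed.

End FreeEnergyFinite.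

(** * Coordinate updates *)

Section Steps.
Variables (R : realType) (p K : nat) (blk : 'I_p -> 'I_K.+1).
Local Notation T := (p.-tuple R).
Local Notation coords := (coords blk).
Local Notation block k := (coords [set k]%SET).
Local Notation "0T" := (@origin R p).
Implicit Types (x y z : T) (k l : 'I_K.+1) (m d : 'rV[R]_p) (qs : 'I_K.+1 -> T -> R).
Variables (U : {set 'I_K.+1}) (mu : 'rV[R]_p) (Q : 'M[R]_p).
Hypothesis pQ : posdef Q.
Local Notation S := (schur blk U Q).
Local Notation PU := (bproj R blk U).
Local Notation P1 k := (bproj R blk [set k]%SET).
Local Notation nb m := (fun k => nblock blk U Q k m).
Local Notation cpi := (cond_pi blk U mu Q).
Local Notation Kc := (Kconst blk U Q).
Local Notation step := (step blk U mu Q).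
Local Notation bdev := (bdev blk U mu).
Local Notation dstep := (dstep blk U Q).
Local Notation uqr := (uqf_ratio blk U Q).
Local Notation V := (V mu Q).
Local Notation mf := (mf blk U mu Q).
Let cpi0 x : 0 <= cpi x. Proof. by rewrite ltW ?cond_pi_gt0. Qed.
Let mcpi := measurable_cond_pi blk U mu pQ.
Let icpi := iint_cond_pi blk U mu pQ.

Definition kl qs k : \bar R := bKL blk qs (nb (bmeanv blk qs)) k.

(** The invariant of the algorithm: it holds at any start with V > -oo, is kept by every update, and
    makes all terms of the gap real numbers. *)
Definition good qs := [/\ forall k, k \in U -> block_density blk k (qs k),
  forall k, k \in U -> fin2 blk qs k & forall k, k \in U -> (kl qs k < +oo)%E].

Definition gapR qs : R := 1 / 2 * qf S (bdev qs) + \sum_(k in U) fine (kl qs k).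

Lemma kl_ge0 qs k : (forall k, k \in U -> block_density blk k (qs k)) -> k \in U -> (0 <= kl qs k)%E.
Proof.
move=> dq kU; apply: iint_ge0 => z; rewrite lee_fin; apply: phi_ge0.
  exact: (density_ge0 dq).
exact: nblock_gt0.
Qed.

Lemma KL_good qs : good qs -> KL blk U mu Q cpi qs = (\sum_(k in U) fine (kl qs k))%:E.
Proof.
move=> [dq q2 kly]; rewrite KL_mf// -sumEFin; apply: eq_bigr => k kU.
by rewrite fineK// ge0_fin_numE ?kl_ge0// kly.
Qed.

Lemma V_good qs : good qs -> V (mf qs) = (Kc - gapR qs)%:E.
Proof.
move=> gq; have [dq q2 kly] := gq; have KE := KL_good gq.
rewrite mf_sdens (V_sdens pQ dq cpi0 mcpi icpi q2) KE ?ltry//=.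
by congr EFin; rewrite /gapR; ring.
Qed.

Lemma good_V_gtNy qs : (forall k, k \in U -> block_density blk k (qs k)) ->
  (-oo < V (mf qs))%E -> good qs.
Proof.
move=> dq VNy; split => //.
  exact: (V_gtNy_fin2 pQ dq cpi0 mcpi icpi VNy).
move=> k kU; have := V_gtNy_KL pQ dq cpi0 mcpi icpi VNy.
rewrite KL_mf// (bigD1 k)//= => h.
apply: le_lt_trans h; rewrite leeDl// sume_ge0// => l /andP[lU _].
exact: kl_ge0.
Qed.

Lemma nblock_eq k m m' : m *m P1 k = m' *m P1 k ->
  nblock blk U Q k m = nblock blk U Q k m'.
Proof. by move=> mm'; apply/funext => x; rewrite /nblock /bexp !mulmxBl mm'. Qed.

Lemma kl_nb m k : k \in U -> kl (nb m) k = 0%E.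
Proof.
move=> kU; rewrite /kl /bKL -[RHS](iint0 (block k) 0T); congr iint; apply/funext => z.
have -> : nblock blk U Q k (bmeanv blk (nb m)) = nblock blk U Q k m.
  apply: nblock_eq; apply/rowP => i; rewrite !mul_proj !mxE inE.
  by case: eqVneq => [ik|_]; rewrite ?mul0r// (bmean_nb mu pQ)// ik.
by rewrite /phi subrr mulr0 sub0r addNr.
Qed.

Lemma good_nb m : good (nb m).
Proof.
split=> [k kU|k kU|k kU]; [exact: nb_density|exact: (fin2_nb mu)|by rewrite kl_nb].
Qed.

Lemma gapR_nb m : gapR (nb m) = 1 / 2 * qf S ((m - mu) *m PU).
Proof.
rewrite /gapR bdev_nb// big1 ?addr0// => k kU; by rewrite kl_nb.
Qed.

Lemma updE' qs k : good qs -> k \in U ->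
  upd blk U mu Q qs k = nblock blk U Q k (mu + dstep k (bdev qs)).
Proof. by move=> [dq q2 _] kU; apply/funext => x; rewrite updE. Qed.

Lemma bmean_step qs k i : good qs -> k \in U ->
  bmean blk (step qs k) i =
  if blk i == k then (mu + dstep k (bdev qs)) 0 i else bmean blk qs i.
Proof.
move=> gq kU; have h (iU : blk i \in U) := bmean_nb mu pQ (mu + dstep k (bdev qs)) iU.
rewrite /bmean /Defs.step in h *; case: eqVneq h => // ->; rewrite updE'// => h.
exact: h.
Qed.

Lemma dstep_other k d i : blk i != k -> dstep k d 0 i = d 0 i.
Proof.
move=> ik; rewrite /(dstep _ _) -blockT_proj mulmxA mxE [X in _ + X]mxE mul_proj inE (negbTE ik).
by rewrite mul0r oppr0 addr0.
Qed.

Lemma bdev_step qs k : good qs -> k \in U -> bdev (step qs k) = dstep k (bdev qs).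
Proof.
move=> gq kU; have dU : bdev qs *m PU = bdev qs by rewrite -mulmxA proj_idem.
rewrite -[RHS](dstep_projU Q kU dU); apply/rowP => i; rewrite [in LHS]/(bdev _) !mul_proj.
case: (boolP (blk i \in U)) => iU; rewrite ?mul0r// !mul1r.
rewrite mxE [X in _ + X]mxE [X in X + _]mxE bmean_step//.
case: eqVneq => [_|ik]; first by rewrite mxE addrAC subrr add0r.
by rewrite dstep_other// /(bdev _) mul_proj iU mul1r !mxE.
Qed.

Lemma bmeanv_step_other qs k l : good qs -> k \in U -> l != k ->
  bmeanv blk (step qs k) *m P1 l = bmeanv blk qs *m P1 l.
Proof.
move=> gq kU lk; apply/rowP => i; rewrite !mul_proj !mxE inE.
case: eqVneq => [il|_]; rewrite ?mul0r// bmean_step//.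
by case: eqVneq => // ik; rewrite -il ik eqxx in lk.
Qed.

Lemma kl_step_other qs k l : good qs -> k \in U -> l != k -> kl (step qs k) l = kl qs l.
Proof.
move=> gq kU lk; rewrite /kl /bKL (nblock_eq (bmeanv_step_other gq kU lk)).
by rewrite /Defs.step (negbTE lk).
Qed.

Lemma kl_step_same qs k : good qs -> k \in U -> kl (step qs k) k = 0%E.
Proof.
move=> gq kU; rewrite /kl /bKL -[RHS](iint0 (block k) 0T); congr iint; apply/funext => z.
rewrite [in X in phi X _]/Defs.step eqxx updE'//.
have -> : nblock blk U Q k (bmeanv blk (step qs k)) = nblock blk U Q k (mu + dstep k (bdev qs)).
  apply: nblock_eq; apply/rowP => i; rewrite !mul_proj inE.
  case: eqVneq => [ik|_]; rewrite ?mul0r// mxE bmean_step// ik eqxx//.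
by rewrite /phi subrr mulr0 sub0r addNr.
Qed.

Lemma good_step qs k : good qs -> k \in U -> good (step qs k).
Proof.
move=> gq kU; have [dq q2 kly] := gq; split=> l lU.
- by rewrite /Defs.step; case: eqP => [->|_]; [rewrite updE'//; exact: nb_density|exact: dq].
- rewrite /fin2 /Defs.step; case: eqP => [->|_]; last exact: q2.
  by rewrite updE'//; exact: (fin2_nb mu pQ _ kU).
- by have [->|lk] := eqVneq l k; [rewrite kl_step_same|rewrite kl_step_other// kly].
Qed.

Hypothesis U0 : U != finset.set0.
Hypothesis blk_surj : forall k, exists i, blk i = k.

Lemma sum_replace0 (a b : 'I_K.+1 -> R) k : k \in U -> a k = 0 ->
  (forall l, l \in U -> l != k -> a l = b l) ->
  \sum_(l in U) a l = \sum_(l in U) b l - b k.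
Proof.
move=> kU ak ab; rewrite (bigD1 k kU) [in RHS](bigD1 k kU) /= ak add0r addrAC subrr add0r.
by apply: eq_bigr => l /andP[lU lk]; exact: ab.
Qed.

(** For u = |U| and l = [uqr], the quadratic part loses in total at least an l-fold of itself by
    [sum_qf_blockT]. Each divergence is erased by exactly one of the u choices, so their total L
    becomes (u - 1) L, which is at most (u - l) L as l <= 1. *)
Lemma sum_gapR_step qs : good qs ->
  \sum_(k in U) gapR (step qs k) <= (#|U|%:R - uqr) * gapR qs.
Proof.
move=> gq; have [dq q2 kly] := gq.
have l1 := uqf_ratio_le1 pQ U0 blk_surj.
pose L := \sum_(k in U) fine (kl qs k).
have L0 : 0 <= L by apply: sumr_ge0 => k kU; rewrite fine_ge0// kl_ge0.
have E k : k \in U -> gapR (step qs k) =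
    1 / 2 * (qf S (bdev qs) - qf (blockT blk U Q k) (bdev qs *m S)) + (L - fine (kl qs k)).
  move=> kU; rewrite /gapR bdev_step// qf_dstep//; congr (_ + _).
  apply: (sum_replace0 kU); first by rewrite (kl_step_same gq kU).
  by move=> l lU lk; rewrite (kl_step_other gq kU lk).
have -> : gapR qs = 1 / 2 * qf S (bdev qs) + L by [].
rewrite (eq_bigr _ E) big_split /= -mulr_sumr !sumrB !sumr_const.
have <- : L = \sum_(k in U) fine (kl qs k) by [].
have := sum_qf_blockT pQ U0 blk_surj (bdev qs).
clearbody L; clear E; rewrite -[qf _ _ *+ _]mulr_natl -[L *+ _]mulr_natl.
move: (\sum_(k in U) _) (qf S _) => b e hb.
have : 0 <= (1 - uqr) * L by rewrite mulr_ge0// subr_ge0.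
lra.
Qed.

Lemma sum_bf_step qs d0 : good qs -> d0 *m PU = d0 -> d0 *m S = uqr *: (d0 *m bdiag blk U Q) ->
  \sum_(k in U) bf S (bdev (step qs k)) d0 = (#|U|%:R - uqr) * bf S (bdev qs) d0.
Proof.
move=> gq d0U d0E; rewrite -(sum_bf_dstep pQ _ d0U d0E); apply: eq_bigr => k kU.
by rewrite bdev_step.
Qed.

End Steps.

(** * Sums over the index sequences of the random scan *)

Section WordSums.
Variables (R : realType) (K : nat) (U : {set 'I_K.+1}).
Implicit Types (s : nat) (F : seq 'I_K.+1 -> R).

Definition wsum s F : R :=
  \sum_(w : {ffun 'I_s -> 'I_K.+1} | [forall i, w i \in U]) F [seq w i | i <- enum 'I_s].

Lemma wsum0 F : wsum 0 F = F [::].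
Proof.
pose w0 : {ffun 'I_0 -> 'I_K.+1} := [ffun=> ord0].
rewrite /wsum (big_pred1 w0).
  by congr F; apply/eqP; rewrite -size_eq0 size_map size_enum_ord.
move=> w; rewrite /= [RHS](_ : _ = true); first by apply/forallP => -[].
by apply/eqP/ffunP => -[].
Qed.

(** Splitting at the first letter matches [foldl]: that letter is the first update, and the rest is
    a run from the updated factors. *)
Lemma wsumS s F : wsum s.+1 F = \sum_(k in U) wsum s (fun w => F (k :: w)).
Proof.
pose h (kw : 'I_K.+1 * {ffun 'I_s -> 'I_K.+1}) : {ffun 'I_s.+1 -> 'I_K.+1} :=
  [ffun i => if unlift ord0 i is Some j then kw.2 j else kw.1].
pose h' (w : {ffun 'I_s.+1 -> 'I_K.+1}) := (w ord0, [ffun j => w (lift ord0 j)]).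
rewrite /wsum pair_big_dep /= (reindex h) /=; last first.
  exists h' => [[k w] _|w _] /=.
    rewrite /h' /h ffunE unlift_none; congr pair; apply/ffunP => j.
    by rewrite !ffunE liftK.
  apply/ffunP => i; rewrite ffunE /=; case: unliftP => [j ->|->] //.
  by rewrite ffunE.
apply: eq_big => [[k w]|[k w] _] /=.
  apply/forallP/andP => [H|[kU /forallP H] i].
    split; first by have := H ord0; rewrite ffunE unlift_none.
    by apply/forallP => j; have := H (lift ord0 j); rewrite ffunE liftK.
  by rewrite ffunE; case: unliftP => [j _|_]//=.
congr F; rewrite enum_ordSl /= ffunE unlift_none /= -map_comp; congr cons.
by apply: eq_map => j /=; rewrite ffunE liftK.
Qed.

End WordSums.

(** * Expected gap after s updates, and identification of the maximiser *)

Section Main.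
Variables (R : realType) (p K : nat) (blk : 'I_p -> 'I_K.+1).
Local Notation T := (p.-tuple R).
Local Notation allc := (@allc p).
Local Notation "0T" := (@origin R p).
Local Notation lam := (fiber allc 0T).
Variables (U : {set 'I_K.+1}) (mu : 'rV[R]_p) (Q : 'M[R]_p).
Hypothesis blk_surj : forall k, exists i, blk i = k.
Hypothesis pQ : posdef Q.
Hypothesis U0 : U != finset.set0.
Local Notation S := (schur blk U Q).
Local Notation PU := (bproj R blk U).
Local Notation nb m := (fun k => nblock blk U Q k m).
Local Notation Kc := (Kconst blk U Q).
Local Notation step := (step blk U mu Q).
Local Notation run := (run blk U mu Q).
Local Notation bdev := (bdev blk U mu).
Local Notation uqr := (uqf_ratio blk U Q).
Local Notation V := (V mu Q).
Local Notation mf := (mf blk U mu Q).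
Local Notation good := (good blk U Q).
Local Notation gapR := (gapR blk U mu Q).

Lemma wsum_run_le s qs : good qs ->
  wsum U s (fun w => gapR (run qs w)) <= (#|U|%:R - uqr) ^+ s * gapR qs.
Proof.
have u1 : 1 <= #|U|%:R :> R by rewrite ler1n card_gt0.
have l1 := uqf_ratio_le1 pQ U0 blk_surj.
elim: s qs => [|s IH] qs gq; first by rewrite wsum0 expr0 mul1r.
rewrite wsumS exprSr -mulrA.
apply: (@le_trans _ _ (\sum_(k in U) (#|U|%:R - uqr) ^+ s * gapR (step qs k))).
  by apply: ler_sum => k kU; apply: (IH (step qs k)); exact: good_step.
rewrite -mulr_sumr; apply: ler_wpM2l; first by rewrite exprn_ge0//; lra.
exact: sum_gapR_step.
Qed.

Lemma wsum_run_bf s qs d0 : good qs -> d0 *m PU = d0 ->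
  d0 *m S = uqr *: (d0 *m bdiag blk U Q) ->
  wsum U s (fun w => bf S (bdev (run qs w)) d0) = (#|U|%:R - uqr) ^+ s * bf S (bdev qs) d0.
Proof.
move=> + d0U d0E; elim: s qs => [|s IH] qs gq; first by rewrite wsum0 expr0 mul1r.
rewrite wsumS exprSr -mulrA -(sum_bf_step mu pQ gq d0U d0E) mulr_sumr.
by apply: eq_bigr => k kU; apply: (IH (step qs k)); exact: good_step.
Qed.

Lemma good_run qs w : good qs -> {in w, forall k, k \in U} -> good (run qs w).
Proof.
elim: w qs => [//|k w IH] qs gq wU; apply: (IH (step qs k)).
  by apply: good_step => //; apply: wU; exact: mem_head.
by move=> l lw; apply: wU; rewrite inE lw orbT.
Qed.

Lemma exp_gapE (qstar : T -> R) qs s : V qstar = Kc%:E -> good qs ->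
  exp_gap blk U mu Q qstar qs s =
  ((#|U| ^ s)%:R^-1 * wsum U s (fun w => gapR (run qs w)))%:E.
Proof.
move=> Vs gq; rewrite /exp_gap EFinM; congr (_ * _)%E.
rewrite /wsum -sumEFin; apply: eq_bigr => w /forallP wU.
have gr : good (run qs [seq w i | i <- enum 'I_s]).
  by apply: good_run gq _ => k /mapP[i _ ->].
by rewrite Vs (V_good mu pQ gr) -EFinB opprB addrC subrK.
Qed.

Section maximizer.
Variable qstar : T -> R.
Hypothesis qQ : in_Q blk U qstar.
Hypothesis qmax : forall q, in_Q blk U q -> (V q <= V qstar)%E.

(** The Gaussian candidate centred at [mu] lies in the family and reaches [Kc]. Comparison with it
    forces both nonnegative terms in the gap of [qstar] to vanish: the means are those of [mu], and
    the integrand of the divergence is 0 almost everywhere. *)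
Lemma maximizer_spec : [/\ V qstar = Kc%:E, measurable_fun setT qstar &
  {ae lam, forall x, qstar x = mf (nb mu) x}].
Proof.
have [c [qs [dq c0 mc ic qE]]] := qQ.
have -> : qstar = sdens U c qs by apply/funext => x; rewrite qE.
have gn := good_nb blk U mu pQ mu.
have V0 : V (mf (nb mu)) = Kc%:E.
  by rewrite (V_good mu pQ gn) (gapR_nb blk U mu pQ) subrr mul0mx qf0 mulr0 subr0.
have : (Kc%:E <= V (sdens U c qs))%E.
  rewrite -V0; have -> : sdens U c qs = qstar by apply/funext => x; rewrite qE.
  by apply: qmax; apply: in_Q_mf => // k kU; exact: nb_density.
move=> Vle.
have VNy : (-oo < V (sdens U c qs))%E by apply: lt_le_trans Vle; rewrite ltNyr.
have q2 := V_gtNy_fin2 pQ dq c0 mc ic VNy.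
have KLy := V_gtNy_KL pQ dq c0 mc ic VNy.
have KL0 := KL_ge0 mu pQ dq c0.
have VE := V_sdens pQ dq c0 mc ic q2 KLy.
have KLr : 0 <= fine (KL blk U mu Q c qs) by rewrite fine_ge0.
have S0 := (psd_schur blk U pQ).2 (bdev qs).
move: Vle; rewrite VE lee_fin => Vle.
have S00 : qf S (bdev qs) = 0 by lra.
have KL00 : fine (KL blk U mu Q c qs) = 0 by lra.
have d0 : bdev qs = 0.
  apply/eqP; apply: contraT => dn0.
  have dU : bdev qs *m PU = bdev qs by rewrite -mulmxA proj_idem.
  by have := (pd_schur blk U pQ).2 _ dU dn0; rewrite S00 ltxx.
split; first by rewrite S00 KL00; congr EFin; ring.
  exact: (measurable_sdens dq mc).
have mfE x : mf (nb (bmeanv blk qs)) x = mf (nb mu) x.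
  rewrite /Defs.mf; congr (_ * _); apply: eq_bigr => k kU.
  have -> : nblock blk U Q k (bmeanv blk qs) = nblock blk U Q k mu; last by [].
  apply: nblock_eq.
  have PP : PU *m bproj R blk [set k]%SET = bproj R blk [set k]%SET.
    by rewrite projI finset.setIC -projI (proj1U R blk kU).
  rewrite -PP !mulmxA; congr (_ *m _).
  by apply/eqP; rewrite -subr_eq0 -mulmxBl; apply/eqP; exact: d0.
have KLe : KL blk U mu Q c qs = 0%E.
  by rewrite -(fineK (x := KL blk U mu Q c qs)) ?KL00// ge0_fin_numE.
have mp := measurable_phiq mu pQ dq mc.
have p0 := phiq_ge0 mu pQ dq c0.
have : (\int[lam]_x `|(phi (sdens U c qs x) (mf (nb (bmeanv blk qs)) x))%:E| = 0)%E.
  rewrite -KLe /KL -integral_fiber; last 2 first.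
  - exact/measurable_EFinP.
  - by move=> x; rewrite lee_fin p0.
  by apply: eq_integral => x _; rewrite abse_EFin ger0_norm.
have mpE : measurable_fun setT (fun x => (phi (sdens U c qs x) (mf (nb (bmeanv blk qs)) x))%:E).
  exact/measurable_EFinP.
move=> /(ae_eq_integral_abs lam measurableT mpE).
apply: filterS => x /(_ Logic.I) [] h; rewrite -mfE; apply: phi_eq0 => //.
  exact: (sdens_ge0 dq c0).
exact: mf_nb_gt0.
Qed.

Lemma UQF_maximizer : UQF mu Q qstar = uqr.
Proof.
have [_ mq ae] := maximizer_spec.
have [a aQ E] := mf_nb_gexp blk U mu pQ mu.
have pQs := posdef_mfprec blk U pQ.
have vq v : var qstar v = (qf (invmx (mfprec blk U Q)) v)%:E.
  rewrite -(var_gauss_density (mu + dlift blk U mu Q mu) pQs aQ v).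
  apply: var_ae_gauss_density => //.
  by apply: filterS ae => x ->; exact: E.
have vg v : var (gauss mu Q) v = (qf (invmx Q) v)%:E.
  by rewrite -(var_gauss_density mu pQ (gconst_gmass pQ) v).
rewrite /UQF /uqf_ratio; congr inf; apply/seteqP; split => _ [v v0 <-]; exists v => //.
  by rewrite vq vg.
by rewrite vq vg.
Qed.

End maximizer.

End Main.

Lemma wsum_cst (R : realType) K (U : {set 'I_K.+1}) s (a : R) :
  wsum U s (fun=> a) = (#|U| ^ s)%:R * a.
Proof.
elim: s => [|s IH]; first by rewrite wsum0 expn0 mul1r.
rewrite wsumS; under eq_bigr do rewrite IH.
by rewrite sumr_const expnS natrM -mulrA -[LHS]mulr_natl.
Qed.

(** Used with a, b, e the values of [S] at (d, d), (d, d0), (d0, d0) and x = r^s. The hypothesis is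
    the expansion of [qf S (d - x *: d0)], and [c] stands for the divergences, which are only
    discarded. *)
Lemma half_square (R : realFieldType) (a b c e x : R) :
  0 <= c -> 0 <= a - 2 * (x * b) + x ^+ 2 * e ->
  x * b - x ^+ 2 * (1 / 2 * e) <= 1 / 2 * a + c.
Proof. by move=> *; lra. Qed.

(** Averages the linear lower bound: [n] is the number of words, [y] the factor (u - l)^s of the
    pairing with d0, and x = r^s the value of [x] that maximises the bound. *)
Lemma avg_eq (R : realFieldType) (n x y e : R) : n != 0 -> n^-1 * y = x ->
  n^-1 * (x * (y * e) - n * (x * x * (1 / 2 * e))) = x * x * (1 / 2 * e).
Proof. by move=> n0 <-; field. Qed.

Theorem theorem1 (R : realType) (p K : nat) (blk : 'I_p -> 'I_K.+1)
    (U : {set 'I_K.+1}) (mu : 'rV[R]_p) (Q : 'M[R]_p) (qstar : p.-tuple R -> R) :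
  (forall i j : 'I_p, (i <= j)%N -> (blk i <= blk j)%N) ->
  (forall k : 'I_K.+1, exists i, blk i = k) ->
  posdef Q ->
  U != finset.set0 ->
  in_Q blk U qstar ->
  (forall q, in_Q blk U q -> (V mu Q q <= V mu Q qstar)%E) ->
  let r := 1 - UQF mu Q qstar / #|U|%:R in
  (forall qs0 : 'I_K.+1 -> p.-tuple R -> R,
      (forall k, k \in U -> block_density blk k (qs0 k)) ->
      (-oo < V mu Q (mf blk U mu Q qs0))%E ->
      forall s : nat,
        (exp_gap blk U mu Q qstar qs0 s
         <= (r ^+ s)%:E * (V mu Q qstar - V mu Q (mf blk U mu Q qs0)))%E)
  /\
  (exists qs0 : 'I_K.+1 -> p.-tuple R -> R,
      [/\ forall k, k \in U -> block_density blk k (qs0 k),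
          (-oo < V mu Q (mf blk U mu Q qs0))%E,
          (V mu Q (mf blk U mu Q qs0) < V mu Q qstar)%E
        & forall s : nat,
          ((r ^+ (2 * s))%:E * (V mu Q qstar - V mu Q (mf blk U mu Q qs0))
           <= exp_gap blk U mu Q qstar qs0 s)%E]).
Proof.
move=> _ blk_surj pQ U0 qQ qmax r.
have [Vs _ _] := maximizer_spec pQ qQ qmax.
have u0 : 0 < #|U|%:R :> R by rewrite ltr0n card_gt0.
pose l := uqf_ratio blk U Q.
have rE : r = (#|U|%:R - l) / #|U|%:R.
  by rewrite /r (UQF_maximizer pQ qQ qmax) mulrBl divff// gt_eqF.
have rX s : (#|U| ^ s)%:R^-1 * (#|U|%:R - l) ^+ s = r ^+ s.
  by rewrite rE expr_div_n natrX mulrC.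
have us0 s : 0 < (#|U| ^ s)%:R^-1 :> R by rewrite invr_gt0 natrX exprn_gt0.
clearbody r; split.
  move=> qs0 dq VNy s.
  have gq := good_V_gtNy pQ dq VNy.
  rewrite (exp_gapE pQ s Vs gq) Vs (V_good mu pQ gq) -EFinB -EFinM lee_fin.
  rewrite opprB addrC subrK -rX -mulrA ler_wpM2l ?(ltW (us0 s))//.
  exact: wsum_run_le.
have [d0 [d0n0 d0U d0E]] := uqf_eigenvector pQ U0 blk_surj.
pose qs0 k := nblock blk U Q k (mu + d0).
have gq : good blk U Q qs0 := good_nb blk U mu pQ (mu + d0).
have bd : bdev blk U mu qs0 = d0.
  by rewrite /qs0 (bdev_nb blk U mu pQ) [mu + _]addrC addrK d0U.
have ge : gapR blk U mu Q qs0 = 1 / 2 * qf (schur blk U Q) d0.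
  by rewrite (gapR_nb blk U mu pQ) [mu + _]addrC addrK d0U.
have S0 : 0 < qf (schur blk U Q) d0 := (pd_schur blk U pQ).2 _ d0U d0n0.
exists qs0; split.
- by case: gq.
- by rewrite (V_good mu pQ gq) ltNyr.
- by rewrite Vs (V_good mu pQ gq) ge lte_fin; lra.
move=> s; rewrite (exp_gapE pQ s Vs gq) Vs (V_good mu pQ gq) -EFinB -EFinM lee_fin.
rewrite opprB addrC subrK ge.
have H2 := wsum_run_bf mu pQ s gq d0U d0E; rewrite bd -/(qf _ d0) -/l in H2.
have rs : r ^+ (2 * s) = r ^+ s * r ^+ s by rewrite mulnC exprM expr2.
have key : wsum U s (fun w => r ^+ s * bf (schur blk U Q) (bdev blk U mu (run blk U mu Q qs0 w)) d0
    - r ^+ (2 * s) * (1 / 2 * qf (schur blk U Q) d0)) <=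
  wsum U s (fun w => gapR blk U mu Q (run blk U mu Q qs0 w)).
  apply: ler_sum => w /forallP wU.
  have gr : good blk U Q (run blk U mu Q qs0 [seq w i | i <- enum 'I_s]).
    by apply: (good_run mu pQ gq _) => k /mapP[i _ ->].
  set qr := run _ _ _ _ _ _ in gr *.
  have dqr : forall k, k \in U -> block_density blk k (qr k) by case: gr.
  have Spos := (psd_schur blk U pQ).2 (bdev blk U mu qr - r ^+ s *: d0).
  rewrite (qfB _ _ (schur_tr blk U pQ)) bfZr qfZ in Spos.
  have kl0 : 0 <= \sum_(k in U) fine (kl blk U Q qr k).
    by apply: sumr_ge0 => k kU; apply: fine_ge0; exact: (kl_ge0 pQ dqr kU).
  rewrite /gapR rs -expr2.
  exact: half_square kl0 Spos.
have avg : wsum U s (fun w => r ^+ s * bf (schur blk U Q) (bdev blk U mu (run blk U mu Q qs0 w)) d0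
    - r ^+ (2 * s) * (1 / 2 * qf (schur blk U Q) d0)) =
  r ^+ s * ((#|U|%:R - l) ^+ s * qf (schur blk U Q) d0)
    - (#|U| ^ s)%:R * (r ^+ (2 * s) * (1 / 2 * qf (schur blk U Q) d0)).
  by rewrite -H2 -wsum_cst /wsum sumrB -mulr_sumr.
rewrite avg in key.
move: key; generalize (wsum U s (fun w => gapR blk U mu Q (run blk U mu Q qs0 w))) => W key.
have n0 : (#|U| ^ s)%:R != 0 :> R by rewrite -invr_eq0 gt_eqF.
rewrite -(ler_pM2l (us0 s)) rs (avg_eq _ n0 (rX s)) in key.
rewrite rs.
exact: key.
Qed.
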